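(* Let $T_+$ and $T_-$ be two bounded anti-self-adjoint operators in a right quaternionic Hilbert space $\mathcal H$ such that $\mathrm{rank}(T_+-T_-)=n<\infty$, and write $$T_+-T_-=-C^*JC,$$ where $J\in\mathbb H^{n\times n}$ satisfies $J^2=-I_n$ and $J^*=-J$, and $C$ is a bounded linear operator from $\mathcal H$ into $\mathbb H^n$. Then the function $$\Phi(p)=J+C\star(pI-T_+)^{-\star}C^*$$ is positive and its $\star$-inverse is $$\Phi^{-\star}(p)=-J-JC\star(pI-T_-)^{-\star}C^*J .$$
   Context: $\mathbb H$: quaternions; $\mathbb H_+=\{\mathrm{Re}\,p>0\}$; $\mathbb S$: purely imaginary unit quaternions; $\mathbb C_I=\mathbb R+I\mathbb R$. Anti-self-adjoint: $T^*=-T$. A matrix-valued function on $\mathbb H_+$ is left slice hyperholomorphic if it is real differentiable and $(\partial_x+I\partial_y)f(x+Iy)=0$ on $\mathbb H_+\cap\mathbb C_I$ for all $I\in\mathbb S$ (right: $I$ on the right). Such a function has the form $f(x+Iy)=\alpha(x,y)+I\beta(x,y)$ with $\alpha,\beta$ independent of $I$, $\alpha$ even and $\beta$ odd in $y$; for $g=\gamma+I\delta$, $(f\star g)(x+Iy)=(\alpha\gamma-\beta\delta)+I(\alpha\delta+\beta\gamma)$, and $f^{-\star}$ is the inverse with respect to $\star$. For a bounded operator $T$, $C\star(pI-T)^{-\star}C^*$ denotes the slice hyperholomorphic extension to $\mathbb H_+$ of the function $x\mapsto C(xI-T)^{-1}C^*$, $x>0$; analogously with $JC$ and $C^*J$.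 $\Phi$ is positive if the kernel $K_\Phi(p,q)=\Phi(p)\star k(p,q)+k(p,q)\star_r\Phi(q)^*$ is positive definite on $\mathbb H_+$, where $k(p,q)=(\bar p+\bar q)(|p|^2+2\mathrm{Re}(p)\bar q+\bar q^2)^{-1}$. $K_\Phi$ is the kernel left slice hyperholomorphic in $p$, right slice hyperholomorphic in $\bar q$, equal to $\frac{\Phi(x)+\Phi(y)^*}{x+y}$ for $p=x>0$, $q=y>0$. Positive definite: all Hermitian matrices $(c_i^*K_\Phi(w_i,w_j)c_j)_{i,j}$ are nonnegative. *)

(* Defs.v *)
From HB Require Import structures.
From mathcomp Require Import all_boot all_order all_algebra.
From mathcomp Require Import all_classical all_reals all_analysis.
From mathcomp Require Import ring lra.
Set Implicit Arguments.
Unset Strict Implicit.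
Unset Printing Implicit Defensive.
Import Order.TTheory GRing.Theory Num.Theory numFieldNormedType.Exports.
Local Open Scope classical_set_scope.
Local Open Scope ring_scope.

Record quat (R : realType) : Type :=
  Quat { qRe : R ; qIi : R ; qIj : R ; qIk : R }.

Definition qtuple (R : realType) (p : quat R) : R * R * R * R :=
  (qRe p, qIi p, qIj p, qIk p).
Definition quntuple (R : realType) (t : R * R * R * R) : quat R :=
  let: (a, b, c, d) := t in Quat a b c d.
Lemma qtupleK (R : realType) : cancel (@qtuple R) (@quntuple R).
Proof. by case. Qed.

HB.instance Definition _ (R : realType) :=
  Choice.copy (quat R) (can_type (@qtupleK R)).

Lemma quatP (R : realType) (p q : quat R) :
  qRe p = qRe q -> qIi p = qIi q -> qIj p = qIj q -> qIk p = qIk q -> p = q.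
Proof. by case: p q => [a b c d] [a' b' c' d'] /= -> -> -> ->. Qed.

Definition qadd (R : realType) (p q : quat R) : quat R :=
  Quat (qRe p + qRe q) (qIi p + qIi q) (qIj p + qIj q) (qIk p + qIk q).
Definition qopp (R : realType) (p : quat R) : quat R :=
  Quat (- qRe p) (- qIi p) (- qIj p) (- qIk p).
Definition qmul (R : realType) (p q : quat R) : quat R :=
  Quat (qRe p * qRe q - qIi p * qIi q - qIj p * qIj q - qIk p * qIk q)
       (qRe p * qIi q + qIi p * qRe q + qIj p * qIk q - qIk p * qIj q)
       (qRe p * qIj q - qIi p * qIk q + qIj p * qRe q + qIk p * qIi q)
       (qRe p * qIk q + qIi p * qIj q - qIj p * qIi q + qIk p * qRe q).

Fact qaddA (R : realType) : associative (@qadd R).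
Proof. by move=> p q r; apply: quatP => /=; rewrite addrA. Qed.
Fact qaddC (R : realType) : commutative (@qadd R).
Proof. by move=> p q; apply: quatP => /=; rewrite addrC. Qed.
Fact qadd0 (R : realType) : left_id (Quat 0 0 0 0) (@qadd R).
Proof. by move=> p; apply: quatP => /=; rewrite add0r. Qed.
Fact qaddN (R : realType) : left_inverse (Quat 0 0 0 0) (@qopp R) (@qadd R).
Proof. by move=> p; apply: quatP => /=; rewrite addNr. Qed.

HB.instance Definition _ (R : realType) :=
  GRing.isZmodule.Build (quat R)
    (@qaddA R) (@qaddC R) (@qadd0 R) (@qaddN R).

Fact qmulA (R : realType) : associative (@qmul R).
Proof. by move=> p q r; apply: quatP => /=; ring. Qed.
Fact qmul1 (R : realType) : left_id (Quat 1 0 0 0) (@qmul R).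
Proof. by move=> p; apply: quatP => /=; ring. Qed.
Fact qmulr1 (R : realType) : right_id (Quat 1 0 0 0) (@qmul R).
Proof. by move=> p; apply: quatP => /=; ring. Qed.
Fact qmulDl (R : realType) : left_distributive (@qmul R) +%R.
Proof. by move=> p q r; apply: quatP => /=; ring. Qed.
Fact qmulDr (R : realType) : right_distributive (@qmul R) +%R.
Proof. by move=> p q r; apply: quatP => /=; ring. Qed.
Fact qoner_neq0 (R : realType) : Quat 1 0 0 0 != 0 :> quat R.
Proof. by apply/eqP => -[] /eqP; rewrite oner_eq0. Qed.

HB.instance Definition _ (R : realType) :=
  GRing.Zmodule_isNzRing.Build (quat R)
    (@qmulA R) (@qmul1 R) (@qmulr1 R) (@qmulDl R) (@qmulDr R) (@qoner_neq0 R).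

Definition qconj (R : realType) (p : quat R) : quat R :=
  Quat (qRe p) (- qIi p) (- qIj p) (- qIk p).
Definition qnorm (R : realType) (p : quat R) : R :=
  Num.sqrt (qRe p ^+ 2 + qIi p ^+ 2 + qIj p ^+ 2 + qIk p ^+ 2).
Definition qreal (R : realType) (x : R) : quat R := Quat x 0 0 0.
Definition qi (R : realType) : quat R := Quat 0 1 0 0.
Definition qIm (R : realType) (p : quat R) : quat R :=
  Quat 0 (qIi p) (qIj p) (qIk p).

Notation "x %:q" := (qreal x) (at level 1, format "x %:q")
  : ring_scope.

Lemma qnorm_sqr (R : realType) (p : quat R) :
  qnorm p ^+ 2 = qRe p ^+ 2 + qIi p ^+ 2 + qIj p ^+ 2 + qIk p ^+ 2.
Proof. by rewrite sqr_sqrtr // !addr_ge0 ?sqr_ge0. Qed.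

Lemma qnorm_eq0 (R : realType) (p : quat R) : (qnorm p == 0) = (p == 0).
Proof.
rewrite -sqrf_eq0 qnorm_sqr !paddr_eq0 ?addr_ge0 ?sqr_ge0 //.
rewrite !sqrf_eq0; case: p => a b c d /=.
apply/idP/eqP => [/andP[/andP[/andP[/eqP-> /eqP->] /eqP->] /eqP->] //|].
by case=> -> -> -> ->; rewrite eqxx.
Qed.

Definition qinv (R : realType) (p : quat R) : quat R :=
  qconj p * ((qnorm p ^+ 2)^-1)%:q.

Fact qmulVr (R : realType) :
  {in [pred p : quat R | p != 0], left_inverse 1 (@qinv R) *%R}.
Proof.
move=> p; rewrite inE -qnorm_eq0 -sqrf_eq0 qnorm_sqr => p0.
by apply: quatP; rewrite /= qnorm_sqr; field.
Qed.
Fact qdivrr (R : realType) :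
  {in [pred p : quat R | p != 0], right_inverse 1 (@qinv R) *%R}.
Proof.
move=> p; rewrite inE -qnorm_eq0 -sqrf_eq0 qnorm_sqr => p0.
by apply: quatP; rewrite /= qnorm_sqr; field.
Qed.
Fact qunitP (R : realType) (x y : quat R) :
  y * x = 1 /\ x * y = 1 -> [pred p : quat R | p != 0] x.
Proof.
move=> [yx1 _] /=; apply/eqP => x0; move: yx1; rewrite x0 mulr0 => /eqP.
by rewrite eq_sym oner_eq0.
Qed.
Fact qinv_out (R : realType) :
  {in [predC [pred p : quat R | p != 0]], @qinv R =1 id}.
Proof.
move=> p; rewrite !inE negbK => /eqP ->.
by apply: quatP; rewrite /= ?oppr0; ring.
Qed.

HB.instance Definition _ (R : realType) :=
  GRing.NzRing_hasMulInverse.Build (quat R)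
    (@qmulVr R) (@qdivrr R) (@qunitP R) (@qinv_out R).

Definition halfspace (R : realType) : set (quat R) := [set p | 0 < qRe p].
Definition imag_sphere (R : realType) : set (quat R) :=
  [set I | qRe I = 0 /\ qnorm I = 1].

Definition hadj (R : realType) (m n : nat) (A : 'M[quat R]_(m, n)) :
  'M[quat R]_(n, m) := map_mx (@qconj R) A^T.

(* A right module over the quaternions is an lmodType over the converse ring:
   a *: u stands for u a, and (u a) b = u (a b). *)

Definition ip_norm (R : realType) (V : Type) (ip : V -> V -> quat R) (u : V) : R :=
  Num.sqrt (qRe (ip u u)).

HB.mixin Record isQHilbert (R : realType) V & GRing.Lmodule (quat R)^c V := {
  ip : V -> V -> quat R ;
  ipDl : forall u v w, ip (u + v) w = ip u w + ip v w ;
  ipZl : forall (a : quat R) u v, ip ((a : (quat R)^c) *: u) v = ip u v * a ;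
  ip_conj : forall u v, ip v u = qconj (ip u v) ;
  ip_ge0 : forall u, 0 <= qRe (ip u u) ;
  ip_eq0 : forall u, ip u u = 0 -> u = 0 ;
  ip_complete : forall f : nat -> V,
    (forall e : R, 0 < e -> exists N : nat, forall m n : nat,
       (N <= m)%N -> (N <= n)%N -> ip_norm ip (f m - f n) < e) ->
    exists l : V, forall e : R, 0 < e -> exists N : nat, forall n : nat,
       (N <= n)%N -> ip_norm ip (f n - l) < e }.

#[short(type="qHilbertType")]
HB.structure Definition QHilbert (R : realType) :=
  { V of GRing.Lmodule (quat R)^c V & isQHilbert R V }.

Definition hnorm (R : realType) (V : qHilbertType R) (u : V) : R :=
  ip_norm (@ip R V) u.

(* The right Hilbert space H^n of columns, with <u, v> = v^* u. *)
Definition hvec (R : realType) (n : nat) : Type := 'cV[(quat R)^c]_n.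

HB.instance Definition _ (R : realType) (n : nat) :=
  GRing.Lmodule.copy (hvec R n) ('cV[(quat R)^c]_n).

Definition hvec_ip (R : realType) (n : nat) (u v : hvec R n) : quat R :=
  \sum_(i < n) qconj ((v : 'cV[quat R]_n) i 0) * (u : 'cV[quat R]_n) i 0.

Definition qcoord (R : realType) (k : 'I_4) (p : quat R) : R :=
  tnth [tuple qRe p; qIi p; qIj p; qIk p] k.

Lemma qconjD (R : realType) : {morph @qconj R : p q / p + q}.
Proof. by move=> p q; apply: quatP => //=; rewrite opprD. Qed.
Lemma qconjM (R : realType) (p q : quat R) : qconj (p * q) = qconj q * qconj p.
Proof. by apply: quatP => /=; ring. Qed.
Lemma qconjK (R : realType) : involutive (@qconj R).
Proof. by move=> p; apply: quatP; rewrite /= ?opprK. Qed.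
Lemma qconj0 (R : realType) : qconj 0 = 0 :> quat R.
Proof. by apply: quatP; rewrite /= ?oppr0. Qed.
Lemma qconj_sum (R : realType) (I : finType) (F : I -> quat R) :
  qconj (\sum_i F i) = \sum_i qconj (F i).
Proof. exact: (big_morph _ (@qconjD R) (qconj0 R)). Qed.
Lemma qRe_sum (R : realType) (I : finType) (F : I -> quat R) :
  qRe (\sum_i F i) = \sum_i qRe (F i).
Proof. by apply: (big_morph (@qRe R)). Qed.

Fact hvec_ipDl (R : realType) (n : nat) (u v w : hvec R n) :
  hvec_ip (u + v) w = hvec_ip u w + hvec_ip v w.
Proof.
rewrite /hvec_ip -big_split; apply: eq_bigr => i _ /=.
by rewrite -mulrDr; congr (_ * _); rewrite mxE.
Qed.

Fact hvec_ipZl (R : realType) (n : nat) (a : quat R) (u v : hvec R n) :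
  hvec_ip ((a : (quat R)^c) *: u) v = hvec_ip u v * a.
Proof.
rewrite /hvec_ip mulr_suml; apply: eq_bigr => i _ /=.
by rewrite -mulrA; congr (_ * _); rewrite mxE.
Qed.

Fact hvec_ip_conj (R : realType) (n : nat) (u v : hvec R n) :
  hvec_ip v u = qconj (hvec_ip u v).
Proof.
by rewrite /hvec_ip qconj_sum; apply: eq_bigr => i _; rewrite qconjM qconjK.
Qed.

Lemma qRe_hvec_ip (R : realType) (n : nat) (u : hvec R n) :
  qRe (hvec_ip u u) =
  \sum_(i < n) \sum_(k < 4) qcoord k ((u : 'cV[quat R]_n) i 0) ^+ 2.
Proof.
rewrite /hvec_ip qRe_sum; apply: eq_bigr => i _.
rewrite !big_ord_recr big_ord0 /= /qcoord !(tnth_nth 0) /=.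
by ring.
Qed.

Fact hvec_ip_ge0 (R : realType) (n : nat) (u : hvec R n) :
  0 <= qRe (hvec_ip u u).
Proof.
rewrite qRe_hvec_ip; apply: sumr_ge0 => i _; apply: sumr_ge0 => k _.
exact: sqr_ge0.
Qed.

Lemma qcoord_eq0 (R : realType) (p : quat R) :
  (forall k, qcoord k p = 0) -> p = 0.
Proof.
move=> p0; apply: quatP.
- by have := p0 ord0; rewrite /qcoord (tnth_nth 0).
- by have := p0 (@Ordinal 4 1 isT); rewrite /qcoord (tnth_nth 0).
- by have := p0 (@Ordinal 4 2 isT); rewrite /qcoord (tnth_nth 0).
- by have := p0 (@Ordinal 4 3 isT); rewrite /qcoord (tnth_nth 0).
Qed.

Fact hvec_ip_eq0 (R : realType) (n : nat) (u : hvec R n) :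
  hvec_ip u u = 0 -> u = 0.
Proof.
move=> u0; have /eqP : qRe (hvec_ip u u) = 0 by rewrite u0.
rewrite qRe_hvec_ip psumr_eq0 => [/allP u0'|i _]; last first.
  by apply: sumr_ge0 => k _; exact: sqr_ge0.
apply/matrixP => i j; rewrite ord1 mxE; apply: qcoord_eq0 => k.
have /implyP/(_ isT) := u0' i (mem_index_enum _).
rewrite psumr_eq0 => [/allP ui0|l _]; last exact: sqr_ge0.
have /implyP/(_ isT) := ui0 k (mem_index_enum _).
by rewrite sqrf_eq0 => /eqP.
Qed.

Lemma real_complete (R : realType) (f : nat -> R) :
  (forall e, 0 < e -> exists N : nat, forall m n : nat,
     (N <= m)%N -> (N <= n)%N -> `|f m - f n| < e) ->
  exists l, forall e, 0 < e -> exists N : nat, forall n : nat,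
     (N <= n)%N -> `|f n - l| < e.
Proof.
move=> fC; have /cauchy_cvgP fl : cauchy (f @ \oo).
  apply/cauchy_exP => e e0; have [N HN] := fC _ e0.
  by exists (f N); exists N => // n /= Nn; apply: HN.
exists (lim (f @ \oo)) => e e0.
move/cvgrPdist_lt/(_ _ e0) : fl => [N _ HN].
by exists N => n Nn; rewrite distrC; apply: HN.
Qed.

Lemma qcoordB (R : realType) (k : 'I_4) (p q : quat R) :
  qcoord k (p - q) = qcoord k p - qcoord k q.
Proof.
rewrite /qcoord !(tnth_nth 0).
by case: k => -[|[|[|[|]]]].
Qed.

Fact hvec_ip_complete (R : realType) (n : nat) (f : nat -> hvec R n) :
  (forall e : R, 0 < e -> exists N : nat, forall a b : nat,
     (N <= a)%N -> (N <= b)%N -> ip_norm (@hvec_ip R n) (f a - f b) < e) ->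
  exists l : hvec R n, forall e : R, 0 < e -> exists N : nat, forall a : nat,
     (N <= a)%N -> ip_norm (@hvec_ip R n) (f a - l) < e.
Proof.
move=> fC.
pose g (i : 'I_n) (k : 'I_4) a := qcoord k ((f a : 'cV[quat R]_n) i 0).
have gl (ik : 'I_n * 'I_4) : exists l, forall e, 0 < e ->
    exists N : nat, forall a : nat, (N <= a)%N -> `|g ik.1 ik.2 a - l| < e.
  case: ik => i k /=; apply: real_complete => e e0; have [N HN] := fC e e0.
  exists N => a b Na Nb; apply: le_lt_trans (HN a b Na Nb).
  rewrite /ip_norm qRe_hvec_ip -sqrtr_sqr ler_sqrt; last first.
    by apply: sumr_ge0 => ? _; apply: sumr_ge0 => ? _; exact: sqr_ge0.
  rewrite (bigD1 i) //= (bigD1 k) //=.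
  have -> : qcoord k (((f a - f b) : 'cV[quat R]_n) i 0) = g i k a - g i k b.
    by rewrite -qcoordB; congr qcoord; rewrite !mxE.
  rewrite -addrA lerDl addr_ge0 //.
    by apply: sumr_ge0 => ? _; exact: sqr_ge0.
  by apply: sumr_ge0 => ? _; apply: sumr_ge0 => ? _; exact: sqr_ge0.
have [l Hl] := choice gl.
pose L : 'cV[quat R]_n := \col_i Quat (l (i, ord0)) (l (i, @Ordinal 4 1 isT))
  (l (i, @Ordinal 4 2 isT)) (l (i, @Ordinal 4 3 isT)).
have LE i k : qcoord k (L i 0) = l (i, k).
  rewrite mxE /qcoord (tnth_nth 0).
  by case: k => -[|[|[|[|//]]]] /= p; congr l; congr pair; apply: val_inj.
exists L => e e0; set d := e / (2 * n.+1%:R).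
have d0 : 0 < d by rewrite divr_gt0 // mulr_gt0.
have [N HN] := choice (fun ik => Hl ik d d0).
exists (\max_ik N ik)%N => a Na.
rewrite /ip_norm qRe_hvec_ip -[ltRHS]gtr0_norm // -sqrtr_sqr ltr_sqrt ?exprn_gt0 //.
apply: (@le_lt_trans _ _ (\sum_(i < n) \sum_(k < 4) d ^+ 2)).
  apply: ler_sum => i _; apply: ler_sum => k _.
  have -> : qcoord k (((f a - (L : hvec R n)) : 'cV[quat R]_n) i 0)
     = g i k a - l (i, k).
    by rewrite -LE -qcoordB; congr qcoord; rewrite !mxE.
  rewrite -[leLHS]real_normK ?num_real // lerXn2r ?nnegrE ?normr_ge0 ?ltW //.
  by apply: HN (i, k) _ _; apply: leq_trans Na; apply: leq_bigmax.
rewrite !sumr_const !card_ord -mulrnA -mulr_natr.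
have n0 : (n.+1%:R : R) != 0 by rewrite pnatr_eq0.
have -> : d ^+ 2 * (4 * n)%:R = e ^+ 2 * (n%:R / n.+1%:R ^+ 2).
  by rewrite /d natrM; field; rewrite -natr1 in n0 *.
rewrite gtr_pMr ?exprn_gt0 // ltr_pdivrMr ?exprn_gt0 // mul1r.
rewrite -natrX ltr_nat; apply: (@leq_trans n.+1) => //.
by rewrite leq_pmulr.
Qed.

HB.instance Definition _ (R : realType) (n : nat) :=
  isQHilbert.Build R (hvec R n) (@hvec_ipDl R n) (@hvec_ipZl R n)
    (@hvec_ip_conj R n) (@hvec_ip_ge0 R n) (@hvec_ip_eq0 R n)
    (@hvec_ip_complete R n).

Definition bounded_op (R : realType) (U V : qHilbertType R) (T : U -> V) : Prop :=
  exists M : R, forall u : U, hnorm (T u) <= M * hnorm u.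

Definition adjoint (R : realType) (U V : qHilbertType R) (T : U -> V) : V -> U :=
  xget (fun=> 0) [set S : V -> U | forall u v, ip (T u) v = ip u (S v)].

Definition anti_self_adjoint (R : realType) (V : qHilbertType R)
  (T : V -> V) : Prop := adjoint T = (fun u => - T u).

Definition opinv (R : realType) (V : qHilbertType R) (T : V -> V) : V -> V :=
  xget (fun=> 0) [set S : V -> V | cancel T S /\ cancel S T].

Definition has_rank (R : realType) (U V : qHilbertType R) (T : U -> V)
  (n : nat) : Prop :=
  exists e : 'I_n -> V,
    range T = [set v | exists c : 'I_n -> (quat R)^c, v = \sum_i c i *: e i] /\
    (forall c : 'I_n -> (quat R)^c, \sum_i c i *: e i = 0 -> forall i, c i = 0).

Definition mxop (R : realType) (m n : nat) (A : 'M[quat R]_(m, n)) :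
  hvec R n -> hvec R m := fun v => A *m (v : 'cV[quat R]_n).

Definition opmx (R : realType) (m n : nat) (T : hvec R n -> hvec R m) :
  'M[quat R]_(m, n) :=
  \matrix_(i, j) (T (delta_mx j 0 : 'cV[(quat R)^c]_n) : 'cV[quat R]_m) i 0.

Lemma mxopK (R : realType) (m n : nat) (A : 'M[quat R]_(m, n)) :
  opmx (mxop A) = A.
Proof.
apply/matrixP => i j; rewrite !mxE (bigD1 j) //= big1 => [|k kj].
  by rewrite mxE !eqxx addr0; exact: mulr1.
by rewrite mxE (negbTE kj) /=; exact: mulr0.
Qed.

Definition slice_pt (R : realType) (I : quat R) (x y : R) : quat R :=
  x%:q + I * y%:q.

Definition qrow (R : realType) (p : quat R) : 'rV[R]_4 := \row_k qcoord k p.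
Definition rowq (R : realType) (v : 'rV[R]_4) : quat R :=
  Quat (v 0 0) (v 0 1) (v 0 (inord 2)) (v 0 (inord 3)).

Lemma qrowK (R : realType) : cancel (@qrow R) (@rowq R).
Proof.
by move=> p; apply: quatP; rewrite /= mxE /qcoord (tnth_nth 0) ?inordK.
Qed.

Definition qderive (R : realType) (g : R -> quat R) (t : R) : quat R :=
  rowq (derive1 (fun s => qrow (g s)) t).

(* Real differentiability is that of the entries, as maps from R^4 to R^4. *)
Definition real_differentiable (R : realType) (m n : nat)
  (f : quat R -> 'M[quat R]_(m, n)) (p : quat R) : Prop :=
  forall i j, differentiable (fun v : 'rV[R]_4 => qrow (f (rowq v) i j)) (qrow p).

Definition left_slice_hyperholomorphic (R : realType) (m n : nat)
  (f : quat R -> 'M[quat R]_(m, n)) : Prop :=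
  (forall p, halfspace p -> real_differentiable f p) /\
  (forall I x y, imag_sphere I -> 0 < x -> forall i j,
     qderive (fun s => f (slice_pt I s y) i j) x +
     I * qderive (fun t => f (slice_pt I x t) i j) y = 0).

(* The functions alpha and beta of a decomposition
   f (x + I y) = alpha (x, y) + I beta (x, y), read off on the slice of the
   unit i; they do not depend on that choice. *)
Definition slice_re (R : realType) (m n : nat)
  (f : quat R -> 'M[quat R]_(m, n)) (x y : R) : 'M[quat R]_(m, n) :=
  (2^-1)%:q *: (f (slice_pt (qi R) x y) + f (slice_pt (qi R) x (- y))).

Definition slice_im (R : realType) (m n : nat)
  (f : quat R -> 'M[quat R]_(m, n)) (x y : R) : 'M[quat R]_(m, n) :=
  ((2^-1)%:q * - qi R) *:
    (f (slice_pt (qi R) x y) - f (slice_pt (qi R) x (- y))).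

(* The same for f (x + I y) = alpha (x, y) + beta (x, y) I; the value at
   x + I (- y) being alpha (x, y) - beta (x, y) I, it makes no difference
   whether f is viewed as a function of the variable or of its conjugate. *)
Definition slice_im_r (R : realType) (m n : nat)
  (f : quat R -> 'M[quat R]_(m, n)) (x y : R) : 'M[quat R]_(m, n) :=
  (f (slice_pt (qi R) x y) - f (slice_pt (qi R) x (- y))) *m
    ((2^-1)%:q * - qi R)%:M.

Lemma slice_reimE (R : realType) (m n : nat) (f : quat R -> 'M[quat R]_(m, n))
  (a b : R -> R -> 'M[quat R]_(m, n)) (x y : R) :
  (forall I y, imag_sphere I -> f (slice_pt I x y) = a x y + I *: b x y) ->
  a x (- y) = a x y -> b x (- y) = - b x y ->
  slice_re f x y = a x y /\ slice_im f x y = b x y.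
Proof.
move=> fE aE bE; have si : imag_sphere (qi R).
  by split; rewrite // /qnorm /= !expr0n /= !addr0 add0r expr1n sqrtr1.
have h2 : (2^-1 + 2^-1 : R) = 1 by field.
split; rewrite /slice_re /slice_im !fE // aE bE scalerN.
  rewrite addrACA subrr addr0 scalerDr -scalerDl.
  have -> : (2^-1 : R)%:q + (2^-1)%:q = 1.
    by apply: quatP; rewrite /= ?addr0 ?h2.
  by rewrite scale1r.
rewrite opprD opprK addrACA subrr add0r -scalerDl scalerA.
have -> : (2^-1 : R)%:q * - qi R * (qi R + qi R) = 1.
  by apply: quatP => /=; field.
by rewrite scale1r.
Qed.

(* Every p is Re p + I |Im p| with I := qdir p; for real p this I is 0
   instead of a unit, which is harmless because slice_im f x 0 = 0. *)
Definition qdir (R : realType) (p : quat R) : quat R :=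
  qIm p * ((qnorm (qIm p))^-1)%:q.

Definition star (R : realType) (m n r : nat) (f : quat R -> 'M[quat R]_(m, n))
  (g : quat R -> 'M[quat R]_(n, r)) (p : quat R) : 'M[quat R]_(m, r) :=
  let x := qRe p in let y := qnorm (qIm p) in
  (slice_re f x y *m slice_re g x y - slice_im f x y *m slice_im g x y) +
  qdir p *: (slice_re f x y *m slice_im g x y + slice_im f x y *m slice_re g x y).

Definition star_r (R : realType) (m n r : nat) (f : quat R -> 'M[quat R]_(m, n))
  (g : quat R -> 'M[quat R]_(n, r)) (p : quat R) : 'M[quat R]_(m, r) :=
  let x := qRe p in let y := qnorm (qIm p) in
  (slice_re f x y *m slice_re g x y - slice_im_r f x y *m slice_im_r g x y) +
  (slice_re f x y *m slice_im_r g x y + slice_im_r f x y *m slice_re g x y)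
    *m (qdir p)%:M.

Definition star_inverse (R : realType) (n : nat)
  (f g : quat R -> 'M[quat R]_n) : Prop :=
  left_slice_hyperholomorphic f /\ left_slice_hyperholomorphic g /\
  forall p, halfspace p -> star f g p = 1%:M /\ star g f p = 1%:M.

Definition slice_extension (R : realType) (m n : nat)
  (f : R -> 'M[quat R]_(m, n)) : quat R -> 'M[quat R]_(m, n) :=
  xget (fun=> 0) [set F : quat R -> 'M[quat R]_(m, n) |
    left_slice_hyperholomorphic F /\ forall x, 0 < x -> F x%:q = f x].

(* C * (p I - T)^{- *} * D, the extension of x |-> C (x I - T)^-1 D. *)
Definition star_resolvent (R : realType) (H : qHilbertType R) (m n : nat)
  (C : H -> hvec R m) (T : H -> H) (D : hvec R n -> H) :
  quat R -> 'M[quat R]_(m, n) :=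
  slice_extension (fun x : R =>
    opmx (C \o opinv (fun u : H => (x%:q : (quat R)^c) *: u - T u) \o D)).

Definition kker (R : realType) (p q : quat R) : quat R :=
  (qconj p + qconj q) *
  ((qnorm p ^+ 2)%:q + (2 * qRe p)%:q * qconj q + qconj q ^+ 2)^-1.

Definition Phi_kernel (R : realType) (n : nat) (Phi : quat R -> 'M[quat R]_n)
  (p q : quat R) : 'M[quat R]_n :=
  star Phi (fun p' => (kker p' q)%:M) p +
  star_r (fun q' => (kker p q')%:M) (fun q' => hadj (Phi q')) q.

Lemma Phi_kernel_real (R : realType) (n : nat) (Phi : quat R -> 'M[quat R]_n)
  (x y : R) : 0 < x -> 0 < y ->
  Phi_kernel Phi x%:q y%:q =
  ((x + y)^-1)%:q *: (Phi x%:q + hadj (Phi y%:q)).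
Proof.
move=> x0 y0; have qIm0 (t : R) : qIm t%:q = 0 by apply: quatP.
have qnorm0 : qnorm (0 : quat R) = 0 by apply/eqP; rewrite qnorm_eq0.
have qdir0 (t : R) : qdir t%:q = 0 by rewrite /qdir qIm0 mul0r.
have pt0 (t : R) : slice_pt (qi R) t 0 = t%:q.
  by rewrite /slice_pt [0%:q](_ : _ = 0) ?mulr0 ?addr0 //; apply: quatP.
have re0 (f : quat R -> 'M[quat R]_n) t : slice_re f t 0 = f t%:q.
  rewrite /slice_re oppr0 pt0 scalerDr -scalerDl.
  have -> : (2^-1 : R)%:q + (2^-1)%:q = 1.
    by apply: quatP; rewrite /= ?addr0 //; field.
  by rewrite scale1r.
have im0 (f : quat R -> 'M[quat R]_n) t : slice_im f t 0 = 0.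
  by rewrite /slice_im oppr0 subrr scaler0.
have imr0 (f : quat R -> 'M[quat R]_n) t : slice_im_r f t 0 = 0.
  by rewrite /slice_im_r oppr0 subrr mul0mx.
have kE : kker x%:q y%:q = ((x + y)^-1)%:q.
  have xy0 : (x + y)%:q != 0 :> quat R.
    by apply/eqP => -[] /eqP; rewrite gt_eqF // addr_gt0.
  have D : (qnorm x%:q ^+ 2)%:q + (2 * qRe x%:q)%:q * qconj y%:q + qconj y%:q ^+ 2
     = (x + y)%:q * (x + y)%:q :> quat R.
    by rewrite qnorm_sqr expr2; apply: quatP => /=; ring.
  have N : qconj x%:q + qconj y%:q = (x + y)%:q :> quat R.
    by apply: quatP => //=; rewrite oppr0 addr0.
  rewrite /kker D N.
  have U : ((x + y)%:q : quat R) \is a GRing.unit by [].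
  rewrite invrM // mulrA divrr // mul1r.
  apply: (mulIr U); rewrite mulVr //; apply: quatP => /=;
    by field; rewrite gt_eqF // addr_gt0.
rewrite /Phi_kernel /star /star_r /= !qdir0 !qIm0 !qnorm0 !re0 !im0 !imr0.
rewrite !mul0mx !mulmx0 !subr0 !addr0 scaler0 mul0mx !addr0 kE.
rewrite scalerDr mul_scalar_mx; congr (_ + _).
apply/matrixP => i j; rewrite mxE (bigD1 j) //= big1 => [|k kj]; last first.
  by rewrite mxE (negbTE kj) mulr0n mulr0.
rewrite !mxE eqxx mulr1n addr0; by apply: quatP => /=; ring.
Qed.

Definition hermitian_nonneg (R : realType) (N : nat) (A : 'M[quat R]_N) : Prop :=
  hadj A = A /\ forall v : 'cV[quat R]_N, 0 <= qRe ((hadj v *m A *m v) 0 0).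

Definition positive_definite_kernel (R : realType) (n : nat)
  (K : quat R -> quat R -> 'M[quat R]_n) : Prop :=
  forall (N : nat) (w : 'I_N -> quat R) (c : 'I_N -> 'cV[quat R]_n),
    (forall i, halfspace (w i)) ->
    hermitian_nonneg (\matrix_(i, j) (hadj (c i) *m K (w i) (w j) *m c j) 0 0).

Definition positive_function (R : realType) (n : nat)
  (Phi : quat R -> 'M[quat R]_n) : Prop :=
  positive_definite_kernel (Phi_kernel Phi).

(* Main.v *)
Require Import Defs.
From HB Require Import structures.
From mathcomp Require Import all_boot all_order all_algebra.
From mathcomp Require Import all_classical all_reals all_analysis.
From mathcomp Require Import ring lra.
Import Order.TTheory GRing.Theory Num.Theory numFieldNormedType.Exports.
Local Open Scope classical_set_scope.
Local Open Scope ring_scope.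
Set Implicit Arguments.
Unset Strict Implicit.
Unset Printing Implicit Defensive.

(** Why the theorem is true.

    For a bounded anti-self-adjoint T and Re p > 0, the equation
    T g + g conj(p) = d has exactly one solution g = g(p), because
    Re <T g + g conj(p), g> = (Re p) |g|^2 ([coercive_surj], [rsolP]).  The function
    p |-> <d', g(p)> is left slice hyperholomorphic: it is differentiable as a
    function of four real variables since the equation is affine in p, and it
    satisfies the Cauchy-Riemann equation on the slice of I because I commutes
    with p ([qdiff_rsol], [qdiff_rsol_slice]).  At p = x > 0 it equals
    <(x - T)^-1 d', d>.  Hence the entries of the star resolvent are such
    functions, with d and d' among the images of the unit columns under the
    adjoint of C ([star_resolventE]), once slice extensions are known to be unique.

    Uniqueness is the identity principle [slice_identity].  On a slice, the
    difference of two extensions is complex differentiable and vanishes on a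
    half-line; it may be continued by 0 to one side of it.  Goursat's lemma
    ([goursat_square]) in logarithmic polar coordinates gives the mean value
    property ([mean_value]) and with it a bound of the value at the centre of a
    disc by the maximum on the circle.  For a centre slightly outside the zero set,
    the function vanishes on nearly half of the circle, and multiplying it by a
    high power of a polynomial that is 1 at the centre and of modulus below 1 on the
    rest of the circle shows that it vanishes at the centre too ([vanish_center]).
    So the zero set grows until it fills the half-plane ([vanish_halfplane]).

    Positivity.  The kernel k(p, q) satisfies p k + k conj(q) = 1, so that the
    kernel K of Phi satisfies p K + K conj(q) = Phi(p) + Phi(q)^*
    ([Phi_kernel_sylvester]).  Such an equation has only one solution
    ([sylvester_inj]).  The inner products <g_j(q), g_i(p)> of the solutions for
    d_i and d_j solve it as well, because T is skew and J + J^* = 0; therefore K is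
    a kernel of inner products ([resolvent_positive]).

    The inverse.  On a slice, functions multiply like their pairs of components
    (alpha, beta), that is, like matrices over the complexified quaternions, in
    which z = x + i y commutes with everything.  Write F and G for
    C (z - T_+)^-1 C^* and J C (z - T_-)^-1 C^* J.  From T_+ - T_- = - C^* J C and
    the resolvent identity one gets J G + F J + F G = 0
    ([resolvent_identity_slice]), and then J^2 = - 1 gives
    (J + F) (- J - G) = 1 ([star_unit]); exchanging the roles of T_+ and T_- gives
    the product in the other order. *)

(** * Quaternions *)

Section QuatAlgebra.
Variable R : realType.
Implicit Types (p q a b I : quat R) (x y r : R).

Lemma qrealD : {morph @qreal R : x y / x + y}.
Proof. by move=> x y; apply: quatP; rewrite /= ?addr0. Qed.
Lemma qrealN : {morph @qreal R : x / - x}.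
Proof. by move=> x; apply: quatP; rewrite /= ?oppr0. Qed.
Lemma qrealB : {morph @qreal R : x y / x - y}.
Proof. by move=> x y; rewrite qrealD qrealN. Qed.
Lemma qrealM : {morph @qreal R : x y / x * y}.
Proof. by move=> x y; apply: quatP => /=; ring. Qed.
Lemma qreal0 : (0 : R)%:q = 0. Proof. by []. Qed.
Lemma qreal1 : (1 : R)%:q = 1. Proof. by []. Qed.
Lemma qreal_comm x q : x%:q * q = q * x%:q.
Proof. by apply: quatP => /=; ring. Qed.
Lemma qconj_real x : qconj x%:q = x%:q.
Proof. by apply: quatP; rewrite /= ?oppr0. Qed.
Lemma qconjN p : qconj (- p) = - qconj p.
Proof. by apply: quatP. Qed.
Lemma qconjB p q : qconj (p - q) = qconj p - qconj q.
Proof. by rewrite qconjD qconjN. Qed.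
Lemma qReD p q : qRe (p + q) = qRe p + qRe q. Proof. by []. Qed.
Lemma qReN p : qRe (- p) = - qRe p. Proof. by []. Qed.
Lemma qReMC p q : qRe (p * q) = qRe (q * p).
Proof. by rewrite /=; ring. Qed.
Lemma qRe_realM x q : qRe (x%:q * q) = x * qRe q.
Proof. by rewrite /=; ring. Qed.
Lemma qhalf2 : (2^-1 : R)%:q + (2^-1)%:q = 1.
Proof. by rewrite -qrealD -qreal1; congr qreal; field. Qed.

Lemma qmul_conj p : p * qconj p = (qnorm p ^+ 2)%:q.
Proof. by rewrite qnorm_sqr; apply: quatP => /=; ring. Qed.
Lemma qconj_mul p : qconj p * p = (qnorm p ^+ 2)%:q.
Proof. by rewrite qnorm_sqr; apply: quatP => /=; ring. Qed.

Lemma qnorm_ge0 p : 0 <= qnorm p. Proof. exact: sqrtr_ge0. Qed.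

Lemma eq_sqr_ge0 x y : 0 <= x -> 0 <= y -> x ^+ 2 = y ^+ 2 -> x = y.
Proof. by move=> x0 y0 /eqP; rewrite eqrXn2 // => /eqP. Qed.

Lemma le_sqr_ge0 x y : 0 <= y -> x ^+ 2 <= y ^+ 2 -> x <= y.
Proof.
move=> y0 xy; have [x0|x0] := leP 0 x; first by rewrite -ler_sqr ?nnegrE.
exact: le_trans (ltW x0) y0.
Qed.

Lemma qnormM p q : qnorm (p * q) = qnorm p * qnorm q.
Proof.
apply: eq_sqr_ge0; rewrite ?mulr_ge0 ?qnorm_ge0 //.
by rewrite exprMn !qnorm_sqr /=; ring.
Qed.
Lemma qnorm_conj p : qnorm (qconj p) = qnorm p.
Proof. by rewrite /qnorm /= !sqrrN. Qed.
Lemma qnormN p : qnorm (- p) = qnorm p.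
Proof. by rewrite /qnorm /= !sqrrN. Qed.
Lemma qnorm_real x : qnorm x%:q = `|x|.
Proof. by rewrite /qnorm /= expr0n /= !addr0 sqrtr_sqr. Qed.
Lemma qnorm0 : qnorm (0 : quat R) = 0.
Proof. by rewrite -qreal0 qnorm_real normr0. Qed.

Lemma qRe_le_norm p : `|qRe p| <= qnorm p.
Proof.
rewrite le_sqr_ge0 ?qnorm_ge0 // real_normK ?num_real // qnorm_sqr.
by rewrite -!addrA lerDl !addr_ge0 ?sqr_ge0.
Qed.

(** As the norm is multiplicative, Cauchy-Schwarz for p and q is the bound of the
    real part of p (conj q) by its norm. *)
Lemma ler_qnormD p q : qnorm (p + q) <= qnorm p + qnorm q.
Proof.
rewrite le_sqr_ge0 ?addr_ge0 ?qnorm_ge0 //.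
have -> : qnorm (p + q) ^+ 2 = qnorm p ^+ 2 + qnorm q ^+ 2
    + 2 * qRe (p * qconj q) by rewrite !qnorm_sqr /=; ring.
have -> : (qnorm p + qnorm q) ^+ 2 = qnorm p ^+ 2 + qnorm q ^+ 2
    + 2 * (qnorm p * qnorm q) by ring.
rewrite lerD2l ler_pM2l // -(qnorm_conj q) -qnormM.
exact: le_trans (ler_norm _) (qRe_le_norm _).
Qed.
Lemma ler_qnormB p q : qnorm (p - q) <= qnorm p + qnorm q.
Proof. by rewrite -(qnormN q) ler_qnormD. Qed.

Lemma qcoord_le_norm k p : `|qcoord k p| <= qnorm p.
Proof.
rewrite le_sqr_ge0 ?qnorm_ge0 // real_normK ?num_real // qnorm_sqr.
have [/= H0 H1 H2 H3] : [/\ 0 <= qRe p ^+ 2, 0 <= qIi p ^+ 2, 0 <= qIj p ^+ 2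
  & 0 <= qIk p ^+ 2] by rewrite !sqr_ge0.
by rewrite /qcoord (tnth_nth 0); case: k => -[|[|[|[|//]]]] ? /=; lra.
Qed.

Lemma qnorm_le_coord p : qnorm p <= `|qcoord 0 p| + `|qcoord 1 p|
  + `|qcoord (inord 2) p| + `|qcoord (inord 3) p|.
Proof.
rewrite /qcoord !(tnth_nth 0) !inordK //=.
have -> : p = (qRe p)%:q + Quat 0 (qIi p) 0 0 + Quat 0 0 (qIj p) 0 + Quat 0 0 0 (qIk p).
  by apply: quatP; rewrite /= ?addr0 ?add0r.
have n1 x : qnorm (Quat 0 x 0 0) = `|x|.
  by rewrite /qnorm /= !expr0n /= !addr0 add0r sqrtr_sqr.
have n2 x : qnorm (Quat 0 0 x 0) = `|x|.
  by rewrite /qnorm /= !expr0n /= !addr0 !add0r sqrtr_sqr.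
have n3 x : qnorm (Quat 0 0 0 x) = `|x|.
  by rewrite /qnorm /= !expr0n /= !add0r sqrtr_sqr.
do 3![apply: le_trans (ler_qnormD _ _) _; apply: lerD; last by
  rewrite ?n1 ?n2 ?n3 /= ?addr0 ?add0r].
by rewrite qnorm_real /= ?addr0.
Qed.

Lemma qcoordD k p q : qcoord k (p + q) = qcoord k p + qcoord k q.
Proof. by rewrite /qcoord !(tnth_nth 0); case: k => -[|[|[|[|]]]]. Qed.
Lemma qcoord_realM k x p : qcoord k (x%:q * p) = x * qcoord k p.
Proof.
by rewrite /qcoord !(tnth_nth 0); case: k => -[|[|[|[|//]]]] ? /=; ring.
Qed.

Lemma imag_sphereP I : imag_sphere I -> I * I = -1 /\ qconj I = - I.
Proof.
move=> [I0 I1]; have I2 := qnorm_sqr I; rewrite I1 I0 expr1n expr0n add0r in I2.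
have cI : qconj I = - I by apply: quatP; rewrite //= I0 oppr0.
split=> //; have := qmul_conj I; rewrite cI I1 expr1n mulrN => /eqP.
by rewrite eqr_oppLR => /eqP.
Qed.

Lemma imag_sphereN I : imag_sphere I -> imag_sphere (- I).
Proof. by case=> I0 I1; split; rewrite ?qnormN //= I0 oppr0. Qed.

Lemma imag_sphere_qi : imag_sphere (qi R).
Proof. by split; rewrite // /qnorm /= !expr0n /= !addr0 add0r expr1n sqrtr1. Qed.

Lemma qRe_slice I x y : qRe I = 0 -> qRe (slice_pt I x y) = x.
Proof. by move=> I0; rewrite /slice_pt /= I0; ring. Qed.

Lemma slice_ptD I x y x' y' :
  slice_pt I (x + x') (y + y') = slice_pt I x y + slice_pt I x' y'.
Proof. by rewrite /slice_pt !qrealD mulrDr addrACA. Qed.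
Lemma slice_ptB I x y x' y' :
  slice_pt I (x - x') (y - y') = slice_pt I x y - slice_pt I x' y'.
Proof. by rewrite /slice_pt !qrealB mulrBr opprD addrACA. Qed.
Lemma slice_pt0 I x : slice_pt I x 0 = x%:q.
Proof. by rewrite /slice_pt qreal0 mulr0 addr0. Qed.
Lemma slice_ptZ I x y r : slice_pt I (r * x) (r * y) = r%:q * slice_pt I x y.
Proof. by rewrite /slice_pt !qrealM mulrDr !mulrA (qreal_comm r I). Qed.

Lemma slice_ptM I x y x' y' : imag_sphere I ->
  slice_pt I x y * slice_pt I x' y' =
  slice_pt I (x * x' - y * y') (x * y' + y * x').
Proof.
move=> /imag_sphereP[II _]; rewrite /slice_pt mulrDl !mulrDr qrealB qrealD !qrealM.
have -> : I * y%:q * (I * y'%:q) = - (y%:q * y'%:q).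
  by rewrite -[in LHS](qreal_comm y I) mulrA -(mulrA y%:q) II mulrN1 mulNr.
have -> : x%:q * (I * y'%:q) = I * (x%:q * y'%:q) by rewrite mulrA qreal_comm !mulrA.
by rewrite [X in _ + X]addrC addrACA -mulrA -mulrDr.
Qed.

Lemma slice_pt_comm I x y x' y' : imag_sphere I ->
  slice_pt I x y * slice_pt I x' y' = slice_pt I x' y' * slice_pt I x y.
Proof.
by move=> SI; rewrite !slice_ptM //; congr slice_pt; ring.
Qed.

Lemma qnorm_slice I x y : imag_sphere I ->
  qnorm (slice_pt I x y) ^+ 2 = x ^+ 2 + y ^+ 2.
Proof.
move=> SI; have [I0 I1] := SI; have := qnorm_sqr I.
rewrite I1 I0 qnorm_sqr /slice_pt /= I0 => E.
have {}E : qIi I ^+ 2 + qIj I ^+ 2 + qIk I ^+ 2 = 1.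
  by rewrite -[RHS](expr1n _ 2) E; ring.
have -> : x ^+ 2 + y ^+ 2 = x ^+ 2 + (qIi I ^+ 2 + qIj I ^+ 2 + qIk I ^+ 2) * y ^+ 2.
  by rewrite E mul1r.
by ring.
Qed.

Lemma slice_le_norm I x y : imag_sphere I ->
  `|x| <= qnorm (slice_pt I x y) /\ `|y| <= qnorm (slice_pt I x y).
Proof.
by move=> SI; split; rewrite le_sqr_ge0 ?qnorm_ge0 // real_normK ?num_real //
  qnorm_slice // ?lerDl ?lerDr sqr_ge0.
Qed.

Lemma qnorm_slice_le I x y : imag_sphere I ->
  qnorm (slice_pt I x y) <= `|x| + `|y|.
Proof.
move=> [_ I1]; apply: le_trans (ler_qnormD _ _) _.
by rewrite qnormM I1 mul1r !qnorm_real.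
Qed.

Lemma qdirE p : p = (qRe p)%:q + qdir p * (qnorm (qIm p))%:q.
Proof.
have [y0|y0] := eqVneq (qnorm (qIm p)) 0.
  rewrite y0 qreal0 mulr0 addr0; move/eqP: y0; rewrite qnorm_eq0 => /eqP.
  by case: p => a b c d [? ? ?]; apply: quatP.
rewrite /qdir -mulrA -qrealM mulVf // qreal1 mulr1.
by apply: quatP => /=; ring.
Qed.

Lemma qdir_sphere p : qnorm (qIm p) != 0 -> imag_sphere (qdir p).
Proof.
move=> y0; split; first by rewrite /qdir /=; ring.
by rewrite qnormM qnorm_real normfV ger0_norm ?qnorm_ge0 // divff.
Qed.

(** The relation I^2 = -1 in the form that survives at real p, where the
    direction I is 0 but so is |Im p|: it lets the slice computations below treat
    real and nonreal points alike. *)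
Lemma qdir_mul p : qdir p * (qdir p * (qnorm (qIm p))%:q) = - (qnorm (qIm p))%:q.
Proof.
have [->|/qdir_sphere/imag_sphereP[II _]] := eqVneq (qnorm (qIm p)) 0.
  by rewrite qreal0 !mulr0 oppr0.
by rewrite mulrA II mulN1r.
Qed.

Lemma qconj_qdir p : qconj (qdir p) = - qdir p.
Proof. by rewrite /qdir; apply: quatP => /=; ring. Qed.

Lemma halfspaceP p : halfspace p -> exists I x y,
  [/\ imag_sphere I, 0 < x & p = slice_pt I x y].
Proof.
move=> p0; have [y0|y0] := eqVneq (qnorm (qIm p)) 0.
  exists (qi R), (qRe p), 0; split=> //; first exact: imag_sphere_qi.
  by rewrite [LHS]qdirE y0 qreal0 mulr0 addr0 slice_pt0.
exists (qdir p), (qRe p), (qnorm (qIm p)); split=> //; first exact: qdir_sphere.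
exact: qdirE.
Qed.

(** Uniqueness for the Sylvester equation p k + k q = c when p and q have
    positive real part: multiply the homogeneous equation by the conjugate of k
    and take real parts. *)
Lemma sylvester_inj p q a b : 0 < qRe p -> 0 < qRe q ->
  p * a + a * q = p * b + b * q -> a = b.
Proof.
move=> p0 q0 E; apply/eqP; rewrite -subr_eq0; set k := a - b.
have Ek : p * k + k * q = 0.
  by rewrite /k mulrBr mulrBl addrACA E -opprD subrr.
have : qRe (p * k * qconj k + k * q * qconj k) = 0 by rewrite -mulrDl Ek mul0r.
rewrite -mulrA qmul_conj qReD -qreal_comm qRe_realM.
rewrite -mulrA qReMC -mulrA qconj_mul -qreal_comm qRe_realM -mulrDr => /eqP.
by rewrite mulf_eq0 sqrf_eq0 qnorm_eq0 (gt_eqF (addr_gt0 p0 q0)) orbF.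
Qed.

End QuatAlgebra.

(** * Quaternionic Hilbert spaces *)

Section RightScaling.
Variables (R : realType) (V : lmodType (quat R)^c).

(** The module structure is a left one over the converse ring; this writes the
    scalar on the side where it acts, so that (u a) b = u (a b). *)
Definition rscale (u : V) (a : quat R) : V := (a : (quat R)^c) *: u.

End RightScaling.
Notation "u ** a" := (rscale u a) (at level 40, left associativity) : ring_scope.

Section RightScalingTheory.
Variables (R : realType) (V : lmodType (quat R)^c).
Implicit Types (u v w : V) (a b : quat R).

Lemma rscaleA u a b : (u ** a) ** b = u ** (a * b).
Proof. by rewrite /rscale scalerA. Qed.
Lemma rscaleDl u v a : (u + v) ** a = u ** a + v ** a.
Proof. exact: scalerDr. Qed.
Lemma rscaleBl u v a : (u - v) ** a = u ** a - v ** a.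
Proof. exact: scalerBr. Qed.
Lemma rscaleDr u a b : u ** (a + b) = u ** a + u ** b.
Proof. exact: scalerDl. Qed.
Lemma rscaleNl u a : (- u) ** a = - (u ** a).
Proof. exact: scalerN. Qed.
Lemma rscaleNr u a : u ** (- a) = - (u ** a).
Proof. exact: scaleNr. Qed.
Lemma rscaleBr u a b : u ** (a - b) = u ** a - u ** b.
Proof. exact: scalerBl. Qed.
Lemma rscale1 u : u ** 1 = u.
Proof. exact: scale1r. Qed.
Lemma rscale0l a : (0 : V) ** a = 0.
Proof. exact: scaler0. Qed.

Lemma linear_rscale (W : lmodType (quat R)^c) (T : {linear V -> W}) u a :
  T (u ** a) = T u ** a.
Proof. exact: linearZ. Qed.

End RightScalingTheory.

Section Hilbert.
Variables (R : realType) (V : qHilbertType R).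
Implicit Types (u v w : V) (a b : quat R).

Lemma ip_rscale a u v : ip (u ** a) v = ip u v * a.
Proof. exact: ipZl. Qed.
Lemma ipDr u v w : ip u (v + w) = ip u v + ip u w.
Proof. by rewrite ip_conj ipDl qconjD -!ip_conj. Qed.
Lemma ip_rscaler a u v : ip u (v ** a) = qconj a * ip u v.
Proof. by rewrite ip_conj ip_rscale qconjM -ip_conj. Qed.
Lemma ip0l v : ip 0 v = 0.
Proof. by apply: (addrI (ip 0 v)); rewrite -ipDl !addr0. Qed.
Lemma ip0r v : ip v 0 = 0.
Proof. by rewrite ip_conj ip0l qconj0. Qed.
Lemma ipNl u v : ip (- u) v = - ip u v.
Proof. by apply: (addrI (ip u v)); rewrite -ipDl !subrr ip0l. Qed.
Lemma ipNr u v : ip u (- v) = - ip u v.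
Proof. by rewrite ip_conj ipNl qconjN -ip_conj. Qed.
Lemma ipBl u v w : ip (u - v) w = ip u w - ip v w.
Proof. by rewrite ipDl ipNl. Qed.
Lemma ipBr u v w : ip u (v - w) = ip u v - ip u w.
Proof. by rewrite ipDr ipNr. Qed.
Lemma ip_suml n (u : 'I_n -> V) v : ip (\sum_i u i) v = \sum_i ip (u i) v.
Proof. exact: (big_morph (fun u => ip u v) (fun u w => ipDl u w v) (ip0l v)). Qed.
Lemma ip_sumr n (u : 'I_n -> V) v : ip v (\sum_i u i) = \sum_i ip v (u i).
Proof. exact: (big_morph _ (ipDr v) (ip0r v)). Qed.

Lemma hnorm_ge0 u : 0 <= hnorm u. Proof. exact: sqrtr_ge0. Qed.
Lemma hnorm_sqr u : hnorm u ^+ 2 = qRe (ip u u).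
Proof. by rewrite sqr_sqrtr // ip_ge0. Qed.
Lemma ip_self u : ip u u = (hnorm u ^+ 2)%:q.
Proof.
rewrite hnorm_sqr; have := ip_conj u u; case: (ip u u) => a b c d [E1 E2 E3].
by apply: quatP => //=; lra.
Qed.
Lemma hnorm0 : hnorm (0 : V) = 0.
Proof. by rewrite /hnorm /ip_norm ip0l sqrtr0. Qed.
Lemma hnorm0_eq0 u : hnorm u = 0 -> u = 0.
Proof. by move=> u0; apply: ip_eq0; rewrite ip_self u0 expr0n. Qed.
Lemma hnorm_opp u : hnorm (- u) = hnorm u.
Proof. by rewrite /hnorm /ip_norm ipNl ipNr opprK. Qed.
Lemma hnorm_distC u v : hnorm (u - v) = hnorm (v - u).
Proof. by rewrite -hnorm_opp opprB. Qed.

Lemma hnorm_rscale u a : hnorm (u ** a) = hnorm u * qnorm a.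
Proof.
apply: eq_sqr_ge0; rewrite ?mulr_ge0 ?hnorm_ge0 ?qnorm_ge0 //.
rewrite hnorm_sqr ip_rscale ip_rscaler ip_self -qreal_comm -mulrA qconj_mul.
by rewrite -qrealM exprMn.
Qed.

Lemma hnorm_sqrD u v :
  hnorm (u + v) ^+ 2 = hnorm u ^+ 2 + hnorm v ^+ 2 + 2 * qRe (ip u v).
Proof.
rewrite !hnorm_sqr ipDl !ipDr !qReD (ip_conj u v) [qRe (qconj _)]/=; ring.
Qed.

Lemma qRe_ip_le u v : qRe (ip u v) <= hnorm u * hnorm v.
Proof.
have [v0|v0] := eqVneq (hnorm v) 0.
  by rewrite (hnorm0_eq0 v0) ip0r hnorm0 mulr0.
have [u0|u0] := eqVneq (hnorm u) 0.
  by rewrite (hnorm0_eq0 u0) ip0l hnorm0 mul0r.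
have := sqr_ge0 (hnorm (u ** (hnorm v)%:q - v ** (hnorm u)%:q)).
rewrite hnorm_sqrD hnorm_opp !hnorm_rscale !qnorm_real !ger0_norm ?hnorm_ge0 //.
rewrite ipNr qReN ip_rscale ip_rscaler qconj_real -mulrA qRe_realM qReMC qRe_realM.
have hu : 0 < hnorm u by rewrite lt_def u0 hnorm_ge0.
have hv : 0 < hnorm v by rewrite lt_def v0 hnorm_ge0.
move=> H; rewrite -subr_ge0.
have /(pmulr_rge0 _) <- : 0 < 2 * (hnorm u * hnorm v).
  by rewrite !mulr_gt0.
by apply: le_trans H _; rewrite le_eqVlt; apply/orP; left; apply/eqP; ring.
Qed.

Lemma ler_hnormD u v : hnorm (u + v) <= hnorm u + hnorm v.
Proof.
rewrite le_sqr_ge0 ?addr_ge0 ?hnorm_ge0 // hnorm_sqrD.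
by have := qRe_ip_le u v; lra.
Qed.

(** Cauchy-Schwarz for the quaternion-valued product follows from its real part
    by rotating u with the phase of the product. *)
Lemma qnorm_ip_le u v : qnorm (ip u v) <= hnorm u * hnorm v.
Proof.
have [->|z0] := eqVneq (qnorm (ip u v)) 0; first by rewrite mulr_ge0 ?hnorm_ge0.
have := qRe_ip_le (u ** qconj (ip u v)) v.
rewrite ip_rscale qmul_conj hnorm_rscale qnorm_conj expr2 -mulrA.
rewrite [hnorm u * _]mulrCA; rewrite ler_pM2l // lt_def z0 qnorm_ge0 //.
Qed.

Lemma contraction_fixpoint (F : V -> V) (k : R) : 0 <= k -> k < 1 ->
  (forall u v, hnorm (F u - F v) <= k * hnorm (u - v)) -> exists u, F u = u.
Proof.
move=> k0 k1 Fk; pose s n := iter n F 0.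
have k1' : 0 < 1 - k by rewrite subr_gt0.
pose D := hnorm (F 0 - 0) / (1 - k).
have D0 : 0 <= D by rewrite divr_ge0 ?hnorm_ge0 // ltW.
have sD n : hnorm (s n - 0) <= D.
  elim: n => [|n IHn]; first by rewrite subrr hnorm0.
  have -> : s n.+1 - 0 = (F (s n) - F 0) + (F 0 - 0).
    by rewrite !subr0 subrK.
  apply: le_trans (ler_hnormD _ _) _; apply: le_trans (lerD (Fk _ _) (lexx _)) _.
  have -> : hnorm (F 0 - 0) = D * (1 - k) by rewrite /D divfK // gt_eqF.
  by rewrite mulrBr mulr1 addrCA [D * k]mulrC gerDl subr_le0 ler_wpM2l.
have sk n m : hnorm (s (m + n)%N - s n) <= k ^+ n * D.
  elim: n => [|n IHn]; first by rewrite addn0 expr0 mul1r.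
  rewrite addnS /s !iterS; apply: le_trans (Fk _ _) _.
  by rewrite exprS -mulrA ler_wpM2l.
have kcvg e : 0 < e -> exists N, k ^+ N * D < e.
  move=> e0; have := @cvg_geometric R D k; rewrite ger0_norm // => /(_ k1).
  move/cvgrPdist_lt/(_ _ e0) => [N _ /(_ N (leqnn N))] /=.
  rewrite sub0r normrN => DN; exists N; rewrite mulrC.
  exact: le_lt_trans (ler_norm _) DN.
have [|l sl] := ip_complete s.
  move=> e e0; have [N HN] := kcvg _ (divr_gt0 e0 (ltr0n _ 2)).
  exists N => m n Nm Nn; rewrite -/(hnorm _) -(subnK Nm) -(subnK Nn).
  rewrite -(subrKA (s N)); apply: le_lt_trans (ler_hnormD _ _) _.
  rewrite [hnorm (s N - _)]hnorm_distC [e]splitr.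
  by apply: ltrD; apply: le_lt_trans HN.
exists l; apply/eqP; rewrite -subr_eq0; apply/eqP/hnorm0_eq0/eqP.
rewrite eq_le hnorm_ge0 andbT; apply/ler_addgt0Pl => e e0; rewrite addr0.
have [N HN] := sl _ (divr_gt0 e0 (ltr0n _ 2)).
rewrite -(subrKA (s N.+1)) [e]splitr; apply: le_trans (ler_hnormD _ _) _.
apply: lerD; last by apply: ltW; exact: HN.
apply: le_trans (Fk _ _) _; rewrite hnorm_distC.
apply: le_trans (ltW (HN N (leqnn N))).
by rewrite ler_piMl ?hnorm_ge0 // ltW.
Qed.

(** The Lax-Milgram argument: for small r > 0 the map u |-> u - r (L u - d) is a
    contraction, and its fixed point solves L u = d.  The operator L is only
    additive, because it will be the sum of T and of a right multiplication,
    which is not right linear. *)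
Lemma coercive_surj (L : V -> V) (c M : R) : 0 < c ->
  (forall u v, L (u - v) = L u - L v) ->
  (forall u, hnorm (L u) <= M * hnorm u) ->
  (forall u, c * hnorm u ^+ 2 <= qRe (ip (L u) u)) ->
  forall d, exists g, L g = d.
Proof.
move=> c0 LB LM Lc d; pose m : R := `|M| + c.
have m0 : 0 < m by rewrite ltr_wpDl.
have Lm u : hnorm (L u) <= m * hnorm u.
  apply: le_trans (LM u) _; rewrite ler_wpM2r ?hnorm_ge0 //.
  by rewrite /m (le_trans (ler_norm _)) // lerDl ltW.
(* The minimum of 1 - 2 r c + r^2 m^2, which bounds the square of the
   contraction factor, is attained at this r. *)
pose r := c / m ^+ 2.
have r0 : 0 < r by rewrite divr_gt0 // exprn_gt0.
have rc : r * c = (c / m) ^+ 2 by rewrite /r; field; rewrite gt_eqF.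
have rM : r * m ^+ 2 = c by rewrite /r divfK // expf_neq0 // gt_eqF.
clearbody r; pose k2 : R := 1 - r * c.
have cm : c / m <= 1 by rewrite ler_pdivrMr // mul1r /m lerDr.
have cm0 : 0 < c / m by rewrite divr_gt0.
have k20 : 0 <= k2 by rewrite subr_ge0 rc expr_le1 // ltW.
have k21 : k2 < 1 by rewrite gtrDl oppr_lt0 rc exprn_gt0.
have [||u v|u Fu] :=
    @contraction_fixpoint (fun u => u - (L u - d) ** r%:q) (Num.sqrt k2).
- exact: sqrtr_ge0.
- by rewrite -[X in _ < X]sqrtr1 ltr_sqrt.
- set w := u - v.
  have -> : u - (L u - d) ** r%:q - (v - (L v - d) ** r%:q) = w + (L w) ** (- r)%:q.
    rewrite qrealN rscaleNr LB opprD opprK addrACA -/w; congr (_ + _).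
    by rewrite addrC -rscaleBl -rscaleNl !opprB addrA subrK.
  rewrite le_sqr_ge0 ?mulr_ge0 ?sqrtr_ge0 ?hnorm_ge0 //.
  rewrite exprMn (sqr_sqrtr k20) hnorm_sqrD hnorm_rscale qnorm_real normrN ger0_norm ?(ltW r0) //.
  rewrite ip_rscaler qconj_real qRe_realM.
  rewrite ip_conj [qRe (qconj _)]/=.
  have H1 := Lc w; have H2 := Lm w.
  have H3 : (hnorm (L w) * r) ^+ 2 <= r * c * hnorm w ^+ 2.
    have -> : r * c * hnorm w ^+ 2 = (m * hnorm w * r) ^+ 2.
      by rewrite -rM; ring.
    have Lr : hnorm (L w) * r <= m * hnorm w * r by rewrite ler_pM2r.
    by rewrite ler_sqr // nnegrE !mulr_ge0 ?hnorm_ge0 ?(ltW r0) ?(ltW m0).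
  have H4 : r * (c * hnorm w ^+ 2) <= r * qRe (ip (L w) w) by rewrite ler_pM2l.
  rewrite /k2; move: H3 H4; rewrite mulNr mulrA mulrBl mul1r; lra.
exists u; apply/eqP; rewrite -subr_eq0; apply/eqP/hnorm0_eq0.
move/eqP: Fu; rewrite -subr_eq0 addrAC subrr add0r oppr_eq0 => /eqP Fu.
have := hnorm_rscale (L u - d) r%:q; rewrite Fu hnorm0 qnorm_real => /eqP.
by rewrite eq_sym mulf_eq0 normr_eq0 (gt_eqF r0) orbF => /eqP.
Qed.

End Hilbert.

(** * Integrals of continuous functions and Goursat's lemma *)

Section Goursat.
Variable R : realType.
Implicit Types (f g : R -> R) (P Q : R -> R -> R) (a b c e s t : R).

Definition itg f a b : R := \int[lebesgue_measure]_(x in `[a, b]) f x.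

(** Two-sided continuity at the points of [a, b], end points included: the
    functions integrated below are defined around the interval. *)
Definition ccont f a b := forall x, a <= x -> x <= b -> {for x, continuous f}.

Lemma for_continuousP f x :
  (forall e, 0 < e -> exists2 d, 0 < d &
     forall h, `|h| <= d -> `|f (x + h) - f x| <= e) ->
  {for x, continuous f}.
Proof.
move=> fx; apply/cvgrPdist_le => e e0; have [d d0 fd] := fx e e0.
apply/nbhs_ballP; exists d => //= y; rewrite /ball /= => xy.
by rewrite distrC -(subrKC x y) fd // distrC ltW.
Qed.

Lemma ccontS f a b a' b' : a <= a' -> b' <= b -> ccont f a b -> ccont f a' b'.
Proof.
by move=> aa bb fc x xa xb; apply: fc; [exact: le_trans xa|exact: le_trans bb].
Qed.

Lemma ccont_integrable f a b : ccont f a b ->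
  (@lebesgue_measure R).-integrable `[a, b]%classic (EFin \o f).
Proof.
move=> fc; apply: continuous_compact_integrable; first exact: segment_compact.
by apply: continuous_in_subspaceT => x; rewrite inE /= in_itv /= => /andP[]; apply: fc.
Qed.

Lemma itg_split f a b c : a <= c -> c <= b -> ccont f a b ->
  itg f a b = itg f a c + itg f c b.
Proof.
move=> ac cb fc; have Ii := ccont_integrable fc.
have I2 := ccont_integrable (ccontS ac (lexx b) fc).
have E : itg f a b - itg f a c = itg f c b.
  rewrite /itg Rintegral_itvB // ?bnd_simp // Rintegral_itv_obnd_cbnd //.
  by apply: integrableS I2 => //; apply: subset_itvr; rewrite bnd_simp.
by rewrite -E addrC subrK.
Qed.

Lemma itgD f g a b : ccont f a b -> ccont g a b ->
  itg (fun x => f x + g x) a b = itg f a b + itg g a b.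
Proof.
by move=> fc gc; rewrite /itg RintegralD //; exact: ccont_integrable.
Qed.

Lemma itg_cst a b c : a <= b -> itg (fun=> c) a b = c * (b - a).
Proof.
move=> ab; rewrite /itg Rintegral_cst //= lebesgue_measure_itv /= lte_fin.
case: ltP => // ba; have -> : b = a by apply/eqP; rewrite eq_le ab ba.
by rewrite subrr.
Qed.

Lemma itg_near f a b c e : a <= b -> ccont f a b ->
  (forall x, a <= x -> x <= b -> `|f x - c| <= e) ->
  `|itg f a b - c * (b - a)| <= e * (b - a).
Proof.
move=> ab fc fe; have cc k : ccont (fun=> k) a b by move=> x _ _; exact: cvg_cst.
have fi := ccont_integrable fc; have ci k := ccont_integrable (cc k).
have H x : `[a, b]%classic x -> c - e <= f x <= c + e.
  rewrite /= in_itv /= => /andP[xa xb]; have := fe x xa xb.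
  by rewrite ler_norml => /andP[]; lra.
have up : itg f a b <= itg (fun=> c + e) a b.
  by apply: le_Rintegral => // x /H /andP[].
have lo : itg (fun=> c - e) a b <= itg f a b.
  by apply: le_Rintegral => // x /H /andP[].
by move: up lo; rewrite !itg_cst // ler_norml; lra.
Qed.

Lemma ccont_bounded f a b : a <= b -> ccont f a b ->
  exists B, forall x, a <= x -> x <= b -> `|f x| <= B.
Proof.
move=> ab fc; have nc : {within `[a, b], continuous (fun x => `|f x|)}.
  apply: continuous_in_subspaceT => x; rewrite inE /= in_itv /= => /andP[xa xb].
  by apply: continuous_comp; [exact: fc|exact: norm_continuous].
have [c _ Hc] := EVT_max ab nc; exists `|f c| => x xa xb.
by apply: Hc; rewrite in_itv /= xa.
Qed.

Definition totally_diff P s t a b := forall e, 0 < e -> exists2 d, 0 < d &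
  forall h k, `|h| <= d -> `|k| <= d ->
  `|P (s + h) (t + k) - P s t - (a * h + b * k)| <= e * (`|h| + `|k|).

Lemma totally_diff_cont P s t a b : totally_diff P s t a b ->
  {for s, continuous (fun s' => P s' t)} /\ {for t, continuous (P s)}.
Proof.
move=> HP; have [d d0 Hd] := HP 1 ltr01.
have HM : 0 < 1 + `|a| + `|b| by rewrite -addrA ltr_wpDr // addr_ge0.
split; apply: for_continuousP => e e0.
  exists (Num.min d (e / (1 + `|a| + `|b|))).
    by rewrite lt_min d0 divr_gt0.
  move=> h; rewrite le_min ler_pdivlMr // => /andP[hd he].
  have := Hd h 0 hd; rewrite normr0 (ltW d0) => /(_ isT).
  rewrite addr0 mulr0 addr0 mul1r addr0 => H.
  have -> : P (s + h) t - P s t = (P (s + h) t - P s t - a * h) + a * h by rewrite subrK.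
  apply: le_trans (ler_normD _ _) _; rewrite normrM.
  apply: le_trans (lerD H (lexx _)) _; apply: le_trans he.
  by have := mulr_ge0 (normr_ge0 h) (normr_ge0 b); lra.
exists (Num.min d (e / (1 + `|a| + `|b|))).
  by rewrite lt_min d0 divr_gt0.
move=> k; rewrite le_min ler_pdivlMr // => /andP[kd ke].
have := Hd 0 k; rewrite normr0 (ltW d0) => /(_ isT kd).
rewrite addr0 mulr0 add0r mul1r add0r => H.
have -> : P s (t + k) - P s t = (P s (t + k) - P s t - b * k) + b * k by rewrite subrK.
apply: le_trans (ler_normD _ _) _; rewrite normrM.
apply: le_trans (lerD H (lexx _)) _; apply: le_trans ke.
by have := mulr_ge0 (normr_ge0 k) (normr_ge0 a); lra.
Qed.

(** The integral of P ds + Q dt around the rectangle [s0, s1] x [t0, t1], with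
    opposite sides combined so that their difference is integrated: to first
    order it is the variation of P or Q across the rectangle. *)
Definition contour P Q s0 s1 t0 t1 : R :=
  itg (fun s => P s t0 - P s t1) s0 s1 + itg (fun t => Q s1 t - Q s0 t) t0 t1.

Section Rectangle.
Variables (P Q : R -> R -> R) (S0 S1 T0 T1 : R).
Hypothesis PQ : forall s t, S0 <= s -> s <= S1 -> T0 <= t -> t <= T1 ->
  exists a b c, totally_diff P s t a b /\ totally_diff Q s t b c.

Let Pc t t' s0 s1 : T0 <= t -> t <= T1 -> T0 <= t' -> t' <= T1 ->
  S0 <= s0 -> s1 <= S1 -> ccont (fun s => P s t - P s t') s0 s1.
Proof.
move=> t0 t1 t0' t1' ss0 ss1 s sa sb.
have sS0 : S0 <= s by exact: le_trans sa.
have sS1 : s <= S1 by exact: le_trans ss1.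
have [? [? [? [/totally_diff_cont[c1 _] _]]]] := PQ sS0 sS1 t0 t1.
have [? [? [? [/totally_diff_cont[c2 _] _]]]] := PQ sS0 sS1 t0' t1'.
exact: cvgB.
Qed.

Let Qc s s' t0 t1 : S0 <= s -> s <= S1 -> S0 <= s' -> s' <= S1 ->
  T0 <= t0 -> t1 <= T1 -> ccont (fun t => Q s t - Q s' t) t0 t1.
Proof.
move=> s0 s1 s0' s1' tt0 tt1 t ta tb.
have tT0 : T0 <= t by exact: le_trans ta.
have tT1 : t <= T1 by exact: le_trans tt1.
have [? [? [? [_ /totally_diff_cont[_ c1]]]]] := PQ s0 s1 tT0 tT1.
have [? [? [? [_ /totally_diff_cont[_ c2]]]]] := PQ s0' s1' tT0 tT1.
exact: cvgB.
Qed.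

Lemma contour_splits s0 s s1 t0 t1 :
  S0 <= s0 -> s0 <= s -> s <= s1 -> s1 <= S1 -> T0 <= t0 -> t0 <= t1 -> t1 <= T1 ->
  contour P Q s0 s1 t0 t1 = contour P Q s0 s t0 t1 + contour P Q s s1 t0 t1.
Proof.
move=> h1 h2 h3 h4 h5 h6 h7; rewrite /contour.
rewrite (@itg_split _ s0 s1 s) //; last by apply: Pc => //; lra.
have -> : (fun t => Q s1 t - Q s0 t) = (fun t => (Q s1 t - Q s t) + (Q s t - Q s0 t)).
  by apply/funext => t; rewrite subrKA.
rewrite (@itgD (fun t => Q s1 t - Q s t)); try (by apply: Qc => //; lra).
by rewrite [X in _ + X = _]addrC addrACA.
Qed.

Lemma contour_splitt s0 s1 t0 t t1 :
  S0 <= s0 -> s0 <= s1 -> s1 <= S1 -> T0 <= t0 -> t0 <= t -> t <= t1 -> t1 <= T1 ->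
  contour P Q s0 s1 t0 t1 = contour P Q s0 s1 t0 t + contour P Q s0 s1 t t1.
Proof.
move=> h1 h2 h3 h4 h5 h6 h7; rewrite /contour.
rewrite (@itg_split _ t0 t1 t) //; last by apply: Qc => //; lra.
have -> : (fun s => P s t0 - P s t1) = (fun s => (P s t0 - P s t) + (P s t - P s t1)).
  by apply/funext => s; rewrite subrKA.
rewrite (@itgD (fun s => P s t0 - P s t)); try (by apply: Pc => //; lra).
by rewrite addrACA.
Qed.

(** The linear parts of P and Q at a point contribute - b w^2 and + b w^2, by the
    equality of the cross derivatives, so that only the remainders are left. *)
Lemma contour_local s t e : S0 <= s -> s <= S1 -> T0 <= t -> t <= T1 -> 0 < e ->
  exists2 d, 0 < d & forall s0 t0 w, 0 <= w -> w <= d ->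
    S0 <= s0 -> s0 <= s -> s <= s0 + w -> s0 + w <= S1 ->
    T0 <= t0 -> t0 <= t -> t <= t0 + w -> t0 + w <= T1 ->
    `|contour P Q s0 (s0 + w) t0 (t0 + w)| <= e * w ^+ 2.
Proof.
move=> hs0 hs1 ht0 ht1 e0; have [a [b [c [HP HQ]]]] := PQ hs0 hs1 ht0 ht1.
have e8 : 0 < e / 8 by rewrite divr_gt0.
have [d1 d10 {}HP] := HP _ e8; have [d2 d20 {}HQ] := HQ _ e8.
exists (Num.min d1 d2); first by rewrite lt_min d10.
move=> s0 t0 w w0; rewrite le_min => /andP[wd1 wd2] h1 h2 h3 h4 h5 h6 h7 h8.
have HI : `|itg (fun s' => P s' t0 - P s' (t0 + w)) s0 (s0 + w)
    - (- b * w) * (s0 + w - s0)| <= (e / 2 * w) * (s0 + w - s0).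
  apply: itg_near; [lra|by apply: Pc => //; lra|move=> x x0 x1].
  have hx : `|x - s| <= w by rewrite ler_norml; lra.
  have hk0 : `|t0 - t| <= w by rewrite ler_norml; lra.
  have hk1 : `|t0 + w - t| <= w by rewrite ler_norml; lra.
  have := HP (x - s) (t0 - t) (le_trans hx wd1) (le_trans hk0 wd1).
  have := HP (x - s) (t0 + w - t) (le_trans hx wd1) (le_trans hk1 wd1).
  rewrite !(subrKC s) !(subrKC t) => H1 H0.
  have {}H1 : `|P x (t0 + w) - P s t - (a * (x - s) + b * (t0 + w - t))| <= e / 8 * (w + w).
    by apply: le_trans H1 _; rewrite ler_pM2l // lerD.
  have {}H0 : `|P x t0 - P s t - (a * (x - s) + b * (t0 - t))| <= e / 8 * (w + w).
    by apply: le_trans H0 _; rewrite ler_pM2l // lerD.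
  by move: H0 H1; rewrite !ler_norml; lra.
have HJ : `|itg (fun t' => Q (s0 + w) t' - Q s0 t') t0 (t0 + w)
    - (b * w) * (t0 + w - t0)| <= (e / 2 * w) * (t0 + w - t0).
  apply: itg_near; [lra|by apply: Qc => //; lra|move=> x x0 x1].
  have hx : `|x - t| <= w by rewrite ler_norml; lra.
  have hk0 : `|s0 - s| <= w by rewrite ler_norml; lra.
  have hk1 : `|s0 + w - s| <= w by rewrite ler_norml; lra.
  have := HQ (s0 - s) (x - t) (le_trans hk0 wd2) (le_trans hx wd2).
  have := HQ (s0 + w - s) (x - t) (le_trans hk1 wd2) (le_trans hx wd2).
  rewrite !(subrKC s) !(subrKC t) => H1 H0.
  have {}H1 : `|Q (s0 + w) x - Q s t - (b * (s0 + w - s) + c * (x - t))| <= e / 8 * (w + w).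
    by apply: le_trans H1 _; rewrite ler_pM2l // lerD.
  have {}H0 : `|Q s0 x - Q s t - (b * (s0 - s) + c * (x - t))| <= e / 8 * (w + w).
    by apply: le_trans H0 _; rewrite ler_pM2l // lerD.
  by move: H0 H1; rewrite !ler_norml; lra.
move: HI HJ; rewrite /contour !ler_norml expr2; lra.
Qed.
End Rectangle.

End Goursat.

Section GoursatSquare.
Variable R : realType.
Variables (P Q : R -> R -> R) (S T w : R).
Hypothesis w0 : 0 <= w.
Hypothesis PQ : forall s t, S <= s -> s <= S + w -> T <= t -> t <= T + w ->
  exists a b c, totally_diff P s t a b /\ totally_diff Q s t b c.

Let side n : R := w / 2 ^+ n.
Let ctr n (z : R * R) := contour P Q z.1 (z.1 + side n) z.2 (z.2 + side n).
Let fits n (z : R * R) := [/\ S <= z.1, z.1 + side n <= S + w, T <= z.2 &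
  z.2 + side n <= T + w].

Let side_ge0 n : 0 <= side n.
Proof. by rewrite divr_ge0 // exprn_ge0. Qed.
Let sideS n : side n = side n.+1 + side n.+1.
Proof. by rewrite /side exprS; field; rewrite expf_neq0. Qed.

Let quarter n z (m : R) : fits n z -> m <= `|ctr n z| ->
  exists z', [/\ fits n.+1 z', m / 4 <= `|ctr n.+1 z'|,
    z.1 <= z'.1 /\ z'.1 + side n.+1 <= z.1 + side n &
    z.2 <= z'.2 /\ z'.2 + side n.+1 <= z.2 + side n].
Proof.
case: z => s t [/= h1 h2 h3 h4] hm; set v := side n.+1.
have E := sideS n; rewrite -/v in E; have v0 : 0 <= v by exact: side_ge0.
have C : ctr n (s, t) = ctr n.+1 (s, t) + ctr n.+1 (s, t + v) +
    (ctr n.+1 (s + v, t) + ctr n.+1 (s + v, t + v)).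
  rewrite /ctr /= -/v E.
  rewrite (@contour_splits _ _ _ _ _ _ _ PQ s (s + v)); try lra.
  rewrite (@contour_splitt _ _ _ _ _ _ _ PQ s (s + v) t (t + v)); try lra.
  rewrite (@contour_splitt _ _ _ _ _ _ _ PQ (s + v) _ t (t + v)); try lra.
  by rewrite !addrA.
have [|no] := pselect (exists z', (z' = (s, t) \/ z' = (s, t + v) \/
    z' = (s + v, t) \/ z' = (s + v, t + v)) /\ m / 4 <= `|ctr n.+1 z'|).
  move=> [z' [Ez Hz]]; exists z'; rewrite -/v E; split=> //.
  - by case: Ez => [->|[->|[->|->]]]; split; rewrite /= -/v; lra.
  - by case: Ez => [->|[->|[->|->]]] /=; lra.
  - by case: Ez => [->|[->|[->|->]]] /=; lra.
have N z' : (z' = (s, t) \/ z' = (s, t + v) \/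
    z' = (s + v, t) \/ z' = (s + v, t + v)) -> `|ctr n.+1 z'| < m / 4.
  by move=> Hz; rewrite ltNge; apply/negP => Hm; apply: no; exists z'.
exfalso; move: hm; rewrite leNgt => /negP; apply; rewrite C.
have H1 := N (s, t) (or_introl erefl).
have H2 := N (s, t + v) (or_intror (or_introl erefl)).
have H3 := N (s + v, t) (or_intror (or_intror (or_introl erefl))).
have H4 := N (s + v, t + v) (or_intror (or_intror (or_intror erefl))).
apply: le_lt_trans (ler_normD _ _) _.
have := ler_normD (ctr n.+1 (s, t)) (ctr n.+1 (s, t + v)).
have := ler_normD (ctr n.+1 (s + v, t)) (ctr n.+1 (s + v, t + v)).
lra.
Qed.

(** Goursat's lemma, for coefficients differentiable at every point as slice
    hyperholomorphic functions are: repeated quartering would concentrate a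
    nonzero integral at one point, and there the form is exact to first order. *)
Lemma goursat_square : contour P Q S (S + w) T (T + w) = 0.
Proof.
apply/eqP; rewrite -normr_eq0; apply/negPn/negP => m0.
set m : R := `|contour P Q S (S + w) T (T + w)|.
have {}m0 : 0 < m by rewrite lt_def m0 normr_ge0.
pose good n z := fits n z /\ m / 4 ^+ n <= `|ctr n z|.
have /choice[F HF] : forall nz : nat * (R * R), exists z', good nz.1 nz.2 ->
    [/\ good nz.1.+1 z',
    nz.2.1 <= z'.1 /\ z'.1 + side nz.1.+1 <= nz.2.1 + side nz.1 &
    nz.2.2 <= z'.2 /\ z'.2 + side nz.1.+1 <= nz.2.2 + side nz.1].
  move=> -[n z] /=.
  have [[fz mz]|ngz] := pselect (good n z); last by exists z.
  have [z' [h1 h2 h3 h4]] := quarter fz mz; exists z' => _; split=> //; split=> //.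
  by rewrite exprSr invfM mulrA.
pose z := fix z n := if n is n'.+1 then F (n', z n') else (S, T).
have gz n : good n (z n).
  elim: n => [|n IHn]; last by have [] := HF (n, z n) IHn.
  by rewrite /good /fits /ctr /side /= !expr0 !divr1.
have side_cvg d : 0 < d -> exists n, side n <= d.
  move=> d0; have [n wn] : exists n : nat, w / d < n%:R.
    exists (Num.trunc (w / d)).+1; exact: truncnS_gt.
  exists n; rewrite /side ler_pdivrMr ?exprn_gt0 // mulrC -ler_pdivrMr //.
  apply: le_trans (ltW wn) _; rewrite -natrX ler_nat ltnW //; exact: ltn_expl.
have limit (p : R * R -> R) : (forall n, p (z n) <= p (z n.+1)) ->
    (forall n, p (z n.+1) + side n.+1 <= p (z n) + side n) ->
    exists l, forall n, p (z n) <= l /\ l <= p (z n) + side n.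
  move=> up dn; have mono n k : p (z n) <= p (z (k + n)%N) /\
      p (z (k + n)%N) + side (k + n)%N <= p (z n) + side n.
    elim: k => [|k [IH1 IH2]] //; rewrite addSn; split.
      exact: le_trans IH1 (up _).
    exact: le_trans (dn _) IH2.
  have bound n k : p (z k) <= p (z n) + side n.
    have [nk|kn] := leqP n k.
      have := (mono n (k - n)%N).2; rewrite subnK //; have := side_ge0 k; lra.
    have := (mono k (n - k)%N).1; rewrite subnK ?(ltnW kn) //; have := side_ge0 n; lra.
  exists (sup (range (fun n => p (z n)))) => n; split.
    apply: ub_le_sup; last by exists n.
    by exists (p (z n) + side n) => _ [k _ <-].
  apply: ge_sup; first by exists (p (z n)); exists n.
  by move=> _ [k _ <-].
have [|n|s Hs] := limit fst.
- by move=> n; have [_ []] := HF (n, z n) (gz n).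
- by have [_ []] := HF (n, z n) (gz n).
have [|n|t Ht] := limit snd.
- by move=> n; have [_ _ []] := HF (n, z n) (gz n).
- by have [_ _ []] := HF (n, z n) (gz n).
have [hs1 hs2] := Hs 0%N; have [ht1 ht2] := Ht 0%N.
rewrite /side /= expr0 divr1 in hs1 hs2 ht1 ht2.
have w2 : 0 < w ^+ 2 + 1 by rewrite ltr_wpDl // exprn_ge0.
(* Any e with e w^2 < m will do: at level n it contradicts the lower bound
   m / 4^n on the integral around a square of side w / 2^n. *)
pose e := m / (w ^+ 2 + 1); have e0 : 0 < e by rewrite divr_gt0.
have [d d0 Hd] := contour_local PQ hs1 hs2 ht1 ht2 e0.
have [n nd] := side_cvg d d0; have [[f1 f2 f3 f4] gn] := gz n.
have [a1 a2] := Hs n; have [b1 b2] := Ht n.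
have := Hd _ _ _ (side_ge0 n) nd f1 a1 a2 f2 f3 b1 b2 f4.
rewrite -/(ctr n (z n)) => H; have {}H := le_trans gn H.
have p0 : 0 < (4 ^+ n : R) by rewrite exprn_gt0.
move: H; rewrite ler_pdivrMr // /side.
have -> : e * (w / 2 ^+ n) ^+ 2 * 4 ^+ n = e * w ^+ 2.
  have -> : (4 : R) = 2 ^+ 2 by rewrite -natrX.
  by rewrite -exprM mulnC exprM; field; rewrite expf_neq0.
rewrite /e -mulrA ler_pMr // mulrC ler_pdivlMr // mul1r leNgt.
by rewrite ltrDl ltr01.
Qed.

End GoursatSquare.

(** * Holomorphic functions on one slice *)

Section SliceDifferentiable.
Variable R : realType.
Variable I : quat R.
Hypothesis SI : imag_sphere I.
Implicit Types (w : R -> R -> quat R) (c : quat R) (s t x y h k e d : R).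

(** Complex differentiability of w as a function of s + I t, the plane C_I acting
    on the quaternionic values from the left. *)
Definition ldiff w s t c := forall e, 0 < e -> exists2 d, 0 < d &
  forall h k, `|h| <= d -> `|k| <= d ->
  qnorm (w (s + h) (t + k) - w s t - slice_pt I h k * c) <= e * (`|h| + `|k|).

Lemma ldiff_totally_diff w s t c j : ldiff w s t c ->
  totally_diff (fun s t => qcoord j (w s t)) s t (qcoord j c) (qcoord j (I * c)).
Proof.
move=> wc e e0; have [d d0 Hd] := wc e e0; exists d => // h k hd kd.
apply: le_trans (Hd h k hd kd); apply: le_trans _ (qcoord_le_norm j _).
rewrite !qcoordB /slice_pt mulrDl qcoordD qcoord_realM -(qreal_comm k) -mulrA.
by rewrite qcoord_realM [_ * h]mulrC [_ * k]mulrC.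
Qed.

Lemma ldiff_local w1 w2 s t c d0 : 0 < d0 ->
  (forall h k, `|h| <= d0 -> `|k| <= d0 -> w1 (s + h) (t + k) = w2 (s + h) (t + k)) ->
  ldiff w1 s t c -> ldiff w2 s t c.
Proof.
move=> d00 E wc e e0; have [d dp Hd] := wc e e0; exists (Num.min d d0).
  by rewrite lt_min dp.
move=> h k; rewrite !le_min => /andP[hd hd0] /andP[kd kd0].
have := E 0 0; rewrite normr0 ltW // !addr0 => <- //.
by rewrite -E //; exact: Hd.
Qed.

Lemma ldiff0 s t : ldiff (fun _ _ => 0) s t 0.
Proof.
move=> e e0; exists 1 => // h k _ _.
by rewrite mulr0 !subr0 qnorm0 mulr_ge0 ?addr_ge0 // ltW.
Qed.

Lemma ldiffB w1 w2 s t c1 c2 : ldiff w1 s t c1 -> ldiff w2 s t c2 ->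
  ldiff (fun s t => w1 s t - w2 s t) s t (c1 - c2).
Proof.
move=> H1 H2 e e0; have e20 : 0 < e / 2 by rewrite divr_gt0.
have [d1 d10 {}H1] := H1 _ e20; have [d2 d20 {}H2] := H2 _ e20.
exists (Num.min d1 d2); first by rewrite lt_min d10.
move=> h k; rewrite !le_min => /andP[hd1 hd2] /andP[kd1 kd2].
have -> : w1 (s + h) (t + k) - w2 (s + h) (t + k) - (w1 s t - w2 s t)
    - slice_pt I h k * (c1 - c2)
  = (w1 (s + h) (t + k) - w1 s t - slice_pt I h k * c1)
    - (w2 (s + h) (t + k) - w2 s t - slice_pt I h k * c2).
  by rewrite mulrBr; apply: quatP => /=; ring.
apply: le_trans (ler_qnormB _ _) _.
by have := H1 h k hd1 kd1; have := H2 h k hd2 kd2; lra.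
Qed.

Lemma ldiff_lip w s t c : ldiff w s t c -> exists2 d, 0 < d &
  forall h k, `|h| <= d -> `|k| <= d ->
  qnorm (w (s + h) (t + k) - w s t) <= (1 + qnorm c) * (`|h| + `|k|).
Proof.
move=> wc; have [d d0 Hd] := wc 1 ltr01; exists d => // h k hd kd.
rewrite -(subrK (slice_pt I h k * c) (_ - _)).
apply: le_trans (ler_qnormD _ _) _; rewrite qnormM [leRHS]mulrDl.
apply: lerD; first exact: Hd.
by rewrite mulrC ler_wpM2l ?qnorm_ge0 // qnorm_slice_le.
Qed.

(** Leibniz' rule holds for a first factor with values in C_I, because such a
    factor commutes with the increment of the variable. *)
Lemma ldiffM (X Y : R -> R -> R) w s t a b c :
  ldiff (fun s t => slice_pt I (X s t) (Y s t)) s t (slice_pt I a b) ->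
  ldiff w s t c ->
  ldiff (fun s t => slice_pt I (X s t) (Y s t) * w s t) s t
    (slice_pt I a b * w s t + slice_pt I (X s t) (Y s t) * c).
Proof.
move=> qc wc e e0; have [d1 d10 H1] := ldiff_lip wc.
set q := fun s t => slice_pt I (X s t) (Y s t) in qc *; set cq := slice_pt I a b in qc *.
pose A := qnorm (w s t); pose B := qnorm (q s t); pose G := qnorm cq.
pose D := qnorm c.
have [A0 B0 G0 D0] : [/\ 0 <= A, 0 <= B, 0 <= G & 0 <= D] by rewrite !qnorm_ge0.
pose m := A + B + D + 2; have m0 : 0 < m by rewrite /m; lra.
pose e1 := e / (2 * m); have e10 : 0 < e1 by rewrite divr_gt0 ?mulr_gt0.
have [d2 d20 H2] := qc _ e10; have [d3 d30 H3] := wc _ e10.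
pose m' := 2 * (G * (1 + D) + 1).
have m'0 : 0 < m' by rewrite mulr_gt0 // ltr_wpDl // mulr_ge0 // addr_ge0.
pose d4 := Num.min (1 / 2) (e / m' / 2).
have d40 : 0 < d4 by rewrite lt_min !divr_gt0.
exists (Num.min (Num.min d1 d2) (Num.min d3 d4)).
  by rewrite !lt_min d10 d20 d30 -lt_min.
move=> h k; rewrite !le_min.
move=> /andP[/andP[hd1 hd2] /andP[hd3 /andP[h1 h4]]].
move=> /andP[/andP[kd1 kd2] /andP[kd3 /andP[k1 k4]]].
set n := `|h| + `|k|; have n0 : 0 <= n by rewrite addr_ge0.
have n1 : n <= 1 by rewrite /n; lra.
have n4 : n * m' <= e by rewrite -ler_pdivlMr // /n; lra.
have E1 := H1 h k hd1 kd1; have E2 := H2 h k hd2 kd2; have E3 := H3 h k hd3 kd3.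
rewrite -/n -/D -/(q s t) in E1 E2 E3.
set w' := w (s + h) (t + k) in E1 E3 *; set q' := q (s + h) (t + k) in E2 *.
set hk := slice_pt I h k in E2 E3 *.
have Ew : qnorm w' <= A + (1 + D).
  rewrite -(subrK (w s t) w') addrC; apply: le_trans (ler_qnormD _ _) _.
  rewrite lerD2l; apply: le_trans E1 _.
  by rewrite ler_piMr // addr_ge0.
rewrite -/(q (s + h) (t + k)) -/q' -/(q s t).
have -> : q' * w' - q s t * w s t - hk * (cq * w s t + q s t * c) =
    (q' - q s t - hk * cq) * w' + hk * cq * (w' - w s t)
    + q s t * (w' - w s t - hk * c).
  have -> : hk * (cq * w s t + q s t * c) = hk * cq * w s t + q s t * (hk * c).
    have hq : hk * q s t = q s t * hk by exact: slice_pt_comm.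
    by rewrite mulrDr !mulrA hq.
  rewrite !mulrBl !mulrBr; rewrite opprD !addrA; apply/eqP; rewrite -subr_eq0; apply/eqP.
  by apply: quatP => /=; ring.
apply: le_trans (ler_qnormD _ _) _.
apply: le_trans (lerD (ler_qnormD _ _) (lexx _)) _; rewrite !qnormM -/G -/B.
have F1 : qnorm (q' - q s t - hk * cq) * qnorm w' <= e1 * n * (A + (1 + D)).
  by rewrite ler_pM ?qnorm_ge0.
have F2 : qnorm hk * G * qnorm (w' - w s t) <= n * G * ((1 + D) * n).
  rewrite ler_pM ?mulr_ge0 ?qnorm_ge0 // ler_wpM2r //; exact: qnorm_slice_le.
have F3 : B * qnorm (w' - w s t - hk * c) <= B * (e1 * n) by rewrite ler_wpM2l.
have F4 : e1 * m = e / 2 by rewrite /e1; field; rewrite gt_eqF.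
have F5 : n * (n * m') <= n * e by rewrite ler_wpM2l.
have F6 : e1 * n * (A + (1 + D)) + B * (e1 * n) <= e / 2 * n.
  rewrite -F4 /m; have : 0 <= e1 * n by rewrite mulr_ge0 // ltW.
  by lra.
have F7 : n * G * ((1 + D) * n) <= e / 2 * n.
  move: F5; rewrite /m'; have : 0 <= n * n by rewrite mulr_ge0.
  lra.
lra.
Qed.

Lemma ldiff_comp (X Y : R -> R -> R) w s t a b c :
  ldiff (fun s t => slice_pt I (X s t) (Y s t)) s t (slice_pt I a b) ->
  ldiff w (X s t) (Y s t) c ->
  ldiff (fun s t => w (X s t) (Y s t)) s t (slice_pt I a b * c).
Proof.
move=> qc wc e e0; set cq := slice_pt I a b in qc *.
pose G := qnorm cq; pose D := qnorm c.
have [G0 D0] : 0 <= G /\ 0 <= D by rewrite !qnorm_ge0.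
have G1 : 0 < G + 1 by rewrite ltr_wpDl.
have D1 : 0 < D + 1 by rewrite ltr_wpDl.
pose e1 := Num.min 1 (e / (2 * (D + 1))).
have e10 : 0 < e1 by rewrite lt_min ltr01 divr_gt0 ?mulr_gt0.
have [d1 d10 H1] := qc _ e10.
pose e2 := e / (4 * (G + 1)).
have e20 : 0 < e2 by rewrite divr_gt0 ?mulr_gt0.
have [d2 d20 H2] := wc _ e20.
pose d3 := d2 / (2 * (G + 1)).
have d30 : 0 < d3 by rewrite divr_gt0 ?mulr_gt0.
exists (Num.min d1 d3); first by rewrite lt_min d10.
move=> h k; rewrite !le_min => /andP[hd1 hd3] /andP[kd1 kd3].
set n := `|h| + `|k|; have n0 : 0 <= n by rewrite addr_ge0.
have n3 : n * (G + 1) <= d2.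
  by rewrite -ler_pdivlMr // (_ : d2 / (G + 1) = d3 + d3) ?lerD // /d3; field; rewrite gt_eqF.
have E1 := H1 h k hd1 kd1; rewrite -/n -slice_ptB in E1.
set H := X (s + h) (t + k) - X s t in E1; set K := Y (s + h) (t + k) - Y s t in E1.
have e11 : e1 <= 1 by rewrite ge_min lexx.
have e1D : e1 * (D + 1) <= e / 2.
  rewrite -ler_pdivlMr // ge_min; apply/orP; right.
  by rewrite le_eqVlt; apply/orP; left; apply/eqP; field; rewrite gt_eqF.
have HK : qnorm (slice_pt I H K) <= n * (G + 1).
  rewrite -(subrK (slice_pt I h k * cq) (slice_pt I H K)).
  apply: le_trans (ler_qnormD _ _) _; rewrite qnormM -/G.
  have : qnorm (slice_pt I h k) * G <= n * G.
    by rewrite ler_wpM2r // qnorm_slice_le.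
  have : e1 * n <= 1 * n by rewrite ler_wpM2r.
  by lra.
have [LH LK] := slice_le_norm H K SI.
have HX : X (s + h) (t + k) = X s t + H by rewrite subrKC.
have HY : Y (s + h) (t + k) = Y s t + K by rewrite subrKC.
have E2 := H2 H K (le_trans LH (le_trans HK n3)) (le_trans LK (le_trans HK n3)).
rewrite HX HY.
have -> : w (X s t + H) (Y s t + K) - w (X s t) (Y s t) - slice_pt I h k * (cq * c)
  = (w (X s t + H) (Y s t + K) - w (X s t) (Y s t) - slice_pt I H K * c)
   + (slice_pt I H K - slice_pt I h k * cq) * c.
  rewrite [X in _ = _ + X]mulrBl mulrA.
  by rewrite subrKA.
apply: le_trans (ler_qnormD _ _) _; rewrite qnormM -/D.
have F1 : qnorm (slice_pt I H K - slice_pt I h k * cq) * D <= e1 * n * D.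
  by rewrite ler_wpM2r.
have F2 : e2 * (`|H| + `|K|) <= e / 2 * n.
  apply: (@le_trans _ _ (e2 * (n * (G + 1) + n * (G + 1)))).
    by rewrite ler_pM2l // lerD // (le_trans _ HK).
  by rewrite le_eqVlt; apply/orP; left; apply/eqP; rewrite /e2; field; rewrite gt_eqF.
have F3 : e1 * n * D <= e / 2 * n.
  have : e1 * (D + 1) * n <= e / 2 * n by rewrite ler_wpM2r.
  have : 0 <= e1 * n by rewrite mulr_ge0 // ltW.
  by lra.
by apply: le_trans (lerD E2 F1) _; lra.
Qed.

Lemma is_derive_eps (f : R -> R) x l : is_derive x 1 f l ->
  forall e, 0 < e -> exists2 d, 0 < d & forall h, `|h| <= d ->
  `|f (x + h) - f x - l * h| <= e * `|h|.
Proof.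
case=> fd fl e e0; have : h^-1 *: (f (h *: 1 + x) - f x) @[h --> 0^'] --> l.
  by rewrite -fl; exact: fd.
move/cvgrPdist_le/(_ _ e0); rewrite near_withinE => /nbhs_ballP[d /= d0 Hd].
exists (d / 2); first by rewrite divr_gt0.
move=> h hd; have [->|h0] := eqVneq h 0.
  by rewrite addr0 mulr0 subr0 subrr normr0 mulr0.
have := Hd h; rewrite /ball /= sub0r normrN => /(_ _ h0) H.
have {}H : `|l - h^-1 *: (f (h *: 1 + x) - f x)| <= e.
  by apply: H; apply: le_lt_trans hd _; rewrite ltr_pdivrMr // ltr_pMr // ltr1n.
have -> : f (x + h) - f x - l * h = - (l - h^-1 *: (f (h *: 1 + x) - f x)) * h.
  by rewrite /GRing.scale /= mulr1 [h + x]addrC; field.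
by rewrite normrM normrN ler_wpM2r.
Qed.

(** The exponential of s + I t. *)
Definition cis s t := slice_pt I (expR s * cos t) (expR s * sin t).

(** By the addition formulas it is enough to differentiate at 0. *)
Lemma ldiff_cis s t : ldiff cis s t (cis s t).
Proof.
have cisD s' t' h k : cis (s' + h) (t' + k) = cis s' t' * cis h k.
  by rewrite /cis slice_ptM // expRD cosD sinD; congr slice_pt; ring.
have N0 : qnorm (cis s t) >= 0 by exact: qnorm_ge0.
set N := qnorm (cis s t) in N0.
have N1 : 0 < N + 1 by rewrite ltr_wpDl.
move=> e e0; pose e1 := Num.min 1 (e / (8 * (N + 1))).
have e10 : 0 < e1 by rewrite lt_min ltr01 divr_gt0 ?mulr_gt0.
have [d1 d10 H1] := is_derive_eps (@is_derive_expR R 0) e10.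
have [d2 d20 H2] := is_derive_eps (@is_derive_sin R 0) e10.
have [d3 d30 H3] := is_derive_eps (@is_derive_cos R 0) e10.
pose d4 := Num.min d3 (Num.min 1 (e1 / 2)).
have d40 : 0 < d4 by rewrite !lt_min d30 ltr01 divr_gt0.
exists (Num.min (Num.min d1 d2) d4); first by rewrite !lt_min d10 d20 -!lt_min.
move=> h k; rewrite !le_min => /andP[/andP[h1 h2] /and3P[h3 h4 h5]].
move=> /andP[/andP[k1 k2] /and3P[k3 k4 k5]].
have := H1 h h1; have := H2 k k2; have := H3 k k3.
rewrite !add0r expR0 sin0 cos0 oppr0 mul0r !mul1r !subr0 !addr0 => E3 E2 E1.
have e11 : e1 <= 1 by rewrite ge_min lexx.
have e1N : e1 * (N + 1) <= e / 8.
  rewrite -ler_pdivlMr // ge_min; apply/orP; right.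
  by rewrite le_eqVlt; apply/orP; left; apply/eqP; field; rewrite gt_eqF.
rewrite cisD.
have -> : cis s t * cis h k - cis s t - slice_pt I h k * cis s t =
    cis s t * slice_pt I (expR h * cos k - 1 - h) (expR h * sin k - k).
  have hc : slice_pt I h k * cis s t = cis s t * slice_pt I h k by exact: slice_pt_comm.
  have -> : slice_pt I (expR h * cos k - 1 - h) (expR h * sin k - k)
    = cis h k - 1 - slice_pt I h k.
    by rewrite -[in RHS]qreal1 -(slice_pt0 I 1) -!slice_ptB subr0.
  by rewrite hc !mulrBr mulr1.
rewrite qnormM -/N.
have eh : `|expR h - 1| <= 2 * `|h|.
  rewrite -(subrK h (_ - 1)); apply: le_trans (ler_normD _ _) _.
  have : e1 * `|h| <= 1 * `|h| by rewrite ler_wpM2r.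
  by lra.
have ehb : `|expR h| <= 3.
  rewrite -(subrK 1 (expR h)); apply: le_trans (ler_normD _ _) _.
  by rewrite normr1; lra.
have A1 : `|expR h * cos k - 1 - h| <= e1 * `|h| + 3 * (e1 * `|k|).
  have -> : expR h * cos k - 1 - h = (expR h - 1 - h) + expR h * (cos k - 1) by ring.
  apply: le_trans (ler_normD _ _) _; rewrite lerD // normrM.
  by rewrite ler_pM.
have A2 : `|expR h * sin k - k| <= 3 * (e1 * `|k|) + 2 * `|h| * `|k|.
  have -> : expR h * sin k - k = expR h * (sin k - k) + (expR h - 1) * k by ring.
  apply: le_trans (ler_normD _ _) _; rewrite !normrM lerD //.
    by rewrite ler_pM.
  by rewrite ler_wpM2r.
have A3 : 2 * `|h| * `|k| <= e1 * `|k|.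
  by rewrite ler_wpM2r //; lra.
set n := `|h| + `|k|; have n0 : 0 <= n by rewrite addr_ge0.
have A4 : qnorm (slice_pt I (expR h * cos k - 1 - h) (expR h * sin k - k)) <= 7 * e1 * n.
  apply: le_trans (qnorm_slice_le _ _ SI) _.
  have : 0 <= e1 * `|h| by rewrite mulr_ge0 // ltW.
  by rewrite /n; lra.
apply: le_trans (ler_wpM2l N0 A4) _.
have : e1 * (N + 1) * n <= e / 8 * n by rewrite ler_wpM2r.
have : 0 <= e1 * n by rewrite mulr_ge0 // ltW.
have : 0 <= e * n by rewrite mulr_ge0 // ltW.
lra.
Qed.

End SliceDifferentiable.

(** * The mean value property *)

Section MeanValue.
Variable R : realType.
Variable I : quat R.
Hypothesis SI : imag_sphere I.
Implicit Types (s t x y h k e d : R).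

Lemma ldiff_affine (X Y : R -> R -> R) s t a b p1 p2 r : 0 < r ->
  ldiff I (fun s t => slice_pt I (X s t) (Y s t)) s t (slice_pt I a b) ->
  ldiff I (fun s t => slice_pt I (p1 + r * X s t) (p2 + r * Y s t)) s t
    (slice_pt I (r * a) (r * b)).
Proof.
move=> r0 H e e0; have [d d0 Hd] := H _ (divr_gt0 e0 r0); exists d => // h k hd kd.
have := Hd h k hd kd; rewrite mulrAC ler_pdivlMr //.
suff -> : slice_pt I (p1 + r * X (s + h) (t + k)) (p2 + r * Y (s + h) (t + k)) -
   slice_pt I (p1 + r * X s t) (p2 + r * Y s t) -
   slice_pt I h k * slice_pt I (r * a) (r * b) =
   (slice_pt I (X (s + h) (t + k)) (Y (s + h) (t + k)) - slice_pt I (X s t) (Y s t)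
    - slice_pt I h k * slice_pt I a b) * r%:q.
  by rewrite qnormM qnorm_real (gtr0_norm r0).
rewrite -qreal_comm !slice_ptM // -!slice_ptB -slice_ptZ.
by congr slice_pt; ring.
Qed.

Section Disc.
Variables (V : R -> R -> quat R) (p1 p2 r : R).
Hypothesis r0 : 0 < r.
Hypothesis VD : forall x y, (x - p1) ^+ 2 + (y - p2) ^+ 2 <= r ^+ 2 ->
  exists c, ldiff I V x y c.

Let W s t := V (p1 + r * (expR s * cos t)) (p2 + r * (expR s * sin t)).

Let W_ldiff s t : s <= 0 -> exists c, ldiff I W s t c.
Proof.
move=> s0; have [|c Vc] := @VD (p1 + r * (expR s * cos t)) (p2 + r * (expR s * sin t)).
  have -> : (p1 + r * (expR s * cos t) - p1) ^+ 2 +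
      (p2 + r * (expR s * sin t) - p2) ^+ 2
      = (r * expR s) ^+ 2 * (cos t ^+ 2 + sin t ^+ 2) by ring.
  rewrite cos2Dsin2 mulr1 ler_sqr ?nnegrE ?mulr_ge0 ?expR_ge0 ?(ltW r0) //.
  by rewrite ger_pMr // expR_le1.
exists (slice_pt I (r * (expR s * cos t)) (r * (expR s * sin t)) * c).
apply: (@ldiff_comp R I SI (fun s t => p1 + r * (expR s * cos t))
  (fun s t => p2 + r * (expR s * sin t)) V s t _ _ c _ Vc).
apply: (@ldiff_affine (fun s t => expR s * cos t) (fun s t => expR s * sin t)) => //.
exact: ldiff_cis.
Qed.

Variable j : 'I_4.
Let L : R := pi *+ 2.
Let Q s t := qcoord j (W s t).
Let P s t := qcoord j (- I * W s t).
Let M s := itg (Q s) 0 L.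

Let L0 : 1 <= L.
Proof. by rewrite /L mulr2n; have := pi_ge2 R; lra. Qed.

Let ldiff_lmul w s t c : ldiff I w s t c ->
  ldiff I (fun s t => - I * w s t) s t (- I * c).
Proof.
move=> H e e0; have [d d0 Hd] := H _ e0; exists d => // h k hd kd.
have -> : - I * w (s + h) (t + k) - - I * w s t - slice_pt I h k * (- I * c)
   = - I * (w (s + h) (t + k) - w s t - slice_pt I h k * c).
  have E : - I = slice_pt I 0 (-1).
    by rewrite /slice_pt qreal0 add0r qrealN qreal1 mulrN1.
  by rewrite E (mulrA (slice_pt I h k)) (slice_pt_comm h k 0 (-1) SI) !mulrBr mulrA.
by rewrite qnormM qnormN (proj2 SI) mul1r; exact: Hd.
Qed.

Let PQ s t : s <= 0 -> exists a b c, totally_diff P s t a b /\ totally_diff Q s t b c.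
Proof.
move=> /(W_ldiff t)[c Wc].
exists (qcoord j (- I * c)), (qcoord j (I * (- I * c))), (qcoord j (I * c)).
split; first exact: ldiff_totally_diff (ldiff_lmul Wc).
have <- : c = I * (- I * c).
  by rewrite mulrA mulrN (imag_sphereP SI).1 opprK mul1r.
exact: ldiff_totally_diff Wc.
Qed.

Let Qc s : s <= 0 -> ccont (Q s) 0 L.
Proof.
by move=> s0 t _ _; have [? [? [? [_ /totally_diff_cont[_]]]]] := PQ t s0.
Qed.

Let M_step s : s <= 0 -> M s = M (s - L).
Proof.
move=> s0; have L0' : 0 <= L by exact: le_trans L0.
have := @goursat_square R P Q (s - L) 0 L L0'.
rewrite subrK add0r => G; have {}G : contour P Q (s - L) s 0 L = 0.
  by apply: G => x t _ xs _ _; apply: PQ; exact: le_trans s0.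
move: G; rewrite /contour.
have -> : (fun x => P x 0 - P x L) = (fun=> 0).
  by apply/funext => x; rewrite /P /W /L cos2pi sin2pi cos0 sin0 subrr.
rewrite itg_cst; last by lra.
rewrite mul0r add0r => G; rewrite /M.
have sL : s - L <= 0 by lra.
have -> : Q s = (fun t => (Q s t - Q (s - L) t) + Q (s - L) t).
  by apply/funext => t; rewrite subrK.
rewrite itgD ?G ?add0r //; last exact: Qc.
by move=> t ta tb; apply: cvgB; exact: Qc.
Qed.

(** Gauss' mean value property.  In the coordinates p + r exp (s + I t) the
    function is periodic in t, so that Goursat's lemma on squares of side 2 pi
    makes the integral over a period independent of s; let s tend to -oo. *)
Lemma mean_value : itg (fun t => qcoord j (V (p1 + r * cos t) (p2 + r * sin t))) 0 L
  = qcoord j (V p1 p2) * L.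
Proof.
have -> : (fun t => qcoord j (V (p1 + r * cos t) (p2 + r * sin t))) = Q 0.
  by apply/funext => t; rewrite /Q /W expR0 !mul1r.
rewrite -/(M 0); have L0' : 0 <= L by exact: le_trans L0.
have MN n : M 0 = M (- (n%:R * L)).
  elim: n => [|n ->]; first by rewrite mul0r oppr0.
  rewrite M_step; last by rewrite oppr_le0 mulr_ge0.
  by rewrite -opprD -natr1 mulrDl mul1r.
apply/eqP; rewrite -subr_eq0 -normr_eq0 eq_le normr_ge0 andbT.
apply/ler_addgt0Pl => e e0; rewrite addr0.
have Lp : 0 < L by exact: lt_le_trans L0.
have [c Vc] : exists c, ldiff I V p1 p2 c.
  by apply: VD; rewrite !subrr expr0n addr0 sqr_ge0.
have [d d0 Hd] := ldiff_lip SI Vc.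
pose K := 1 + qnorm c; have K0 : 0 < K by rewrite ltr_wpDr ?qnorm_ge0.
pose x := Num.min d (e / L / (2 * K)).
have x0 : 0 < x by rewrite lt_min d0 !divr_gt0 // mulr_gt0.
have [n nx] : exists n : nat, r / x < n%:R.
  by exists (Num.trunc (r / x)).+1; exact: truncnS_gt.
have sx : r * expR (- (n%:R * L)) <= x.
  rewrite expRN ler_pdivrMr ?expR_gt0 // -ler_pdivrMl // mulrC.
  apply: le_trans (ltW nx) _; apply: le_trans (expR_ge1Dx _).
  have : n%:R * 1 <= n%:R * L by rewrite ler_wpM2l.
  by lra.
have s0 : - (n%:R * L) <= 0 by rewrite oppr_le0 mulr_ge0.
rewrite (MN n); suff near_p t : `|Q (- (n%:R * L)) t - qcoord j (V p1 p2)| <= e / L.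
  have := itg_near L0' (Qc s0) (fun t _ _ => near_p t).
  by rewrite subr0 divfK // gt_eqF.
rewrite /Q -qcoordB; apply: le_trans (qcoord_le_norm _ _) _.
have xd : x <= d by rewrite ge_min lexx.
have rE : 0 <= r * expR (- (n%:R * L)) by rewrite mulr_ge0 ?expR_ge0 ?ltW.
have Hc (u : R) : `|u| <= 1 -> `|r * (expR (- (n%:R * L)) * u)| <= x.
  move=> u1; rewrite mulrA normrM ger0_norm //.
  by rewrite -[x]mulr1 ler_pM.
have Hcos := Hc _ (cos_max t); have Hsin := Hc _ (sin_max t).
apply: le_trans (Hd _ _ (le_trans Hcos xd) (le_trans Hsin xd)) _.
rewrite -/K; apply: (@le_trans _ _ (K * (x + x))).
  by rewrite ler_pM2l // lerD.
have : x <= e / L / (2 * K) by rewrite ge_min lexx orbT.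
by rewrite ler_pdivlMr ?mulr_gt0 //; lra.
Qed.

Lemma circle_ccont :
  ccont (fun t => qcoord j (V (p1 + r * cos t) (p2 + r * sin t))) 0 L.
Proof.
have -> : (fun t => qcoord j (V (p1 + r * cos t) (p2 + r * sin t))) = Q 0.
  by apply/funext => t; rewrite /Q /W expR0 !mul1r.
exact: Qc.
Qed.

Lemma max_modulus b :
  (forall t, 0 <= t -> t <= L -> qnorm (V (p1 + r * cos t) (p2 + r * sin t)) <= b) ->
  `|qcoord j (V p1 p2)| <= b.
Proof.
move=> Vb; have L0' : 0 < L by exact: lt_le_trans L0.
have near_0 t : 0 <= t -> t <= L ->
    `|qcoord j (V (p1 + r * cos t) (p2 + r * sin t)) - 0| <= b.
  by move=> t0 tL; rewrite subr0; exact: le_trans (qcoord_le_norm _ _) (Vb t t0 tL).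
have := itg_near (ltW L0') circle_ccont near_0.
by rewrite mean_value mul0r !subr0 normrM (gtr0_norm L0') ler_pM2r.
Qed.

End Disc.

Lemma circle_bounded (V : R -> R -> quat R) p1 p2 r : 0 < r ->
  (forall x y, (x - p1) ^+ 2 + (y - p2) ^+ 2 <= r ^+ 2 -> exists c, ldiff I V x y c) ->
  exists B, forall t, 0 <= t -> t <= pi *+ 2 ->
    qnorm (V (p1 + r * cos t) (p2 + r * sin t)) <= B.
Proof.
move=> r0 VD; have L0 : 0 <= pi *+ 2 :> R by rewrite mulrn_wge0 // pi_ge0.
have /choice[B HB] : forall j, exists B, forall t, 0 <= t -> t <= pi *+ 2 ->
    `|qcoord j (V (p1 + r * cos t) (p2 + r * sin t))| <= B.
  by move=> j; apply: ccont_bounded => //; exact: circle_ccont.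
exists (B 0 + B 1 + B (inord 2) + B (inord 3)) => t t0 tL.
apply: le_trans (qnorm_le_coord _) _.
by do ?apply: lerD; exact: HB.
Qed.

End MeanValue.

(** * Unique continuation *)

Section UniqueContinuation.
Variable R : realType.
Variable I : quat R.
Hypothesis SI : imag_sphere I.
Implicit Types (s t x y h k e d : R).

Section Weight.
Variables (p1 p2 r : R).
Hypothesis r0 : 0 < r.

(** The polynomial 1 + (I z - z^2 / 2) / 12 in z = ((x - p1) + I (y - p2)) / r.
    It equals 1 at z = 0, and on the unit circle its modulus is below 1 as long
    as Im z >= - 1 / 4: there Re (I z - z^2 / 2) = s^2 - s - 1 / 2 with s = Im z,
    which is at most - 3 / 16. *)
Definition weight_re x y : R := let X := (x - p1) / r in let Y := (y - p2) / r in
  1 + (- Y - (X ^+ 2 - Y ^+ 2) / 2) / 12.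
Definition weight_im x y : R := let X := (x - p1) / r in let Y := (y - p2) / r in
  (X - X * Y) / 12.
Definition weight x y := slice_pt I (weight_re x y) (weight_im x y).

Lemma ldiff_weight x y : ldiff I weight x y
  (slice_pt I (- ((x - p1) / r) / (12 * r)) ((1 - (y - p2) / r) / (12 * r))).
Proof.
have r1 : r != 0 by rewrite gt_eqF.
move=> e e0; have d0 : 0 < 6 * r ^+ 2 * e by rewrite !mulr_gt0 ?exprn_gt0.
exists (6 * r ^+ 2 * e) => // h k hd kd; set n := `|h| + `|k|.
have n0 : 0 <= n by rewrite addr_ge0.
rewrite /weight slice_ptM // -!slice_ptB.
have -> : weight_re (x + h) (y + k) - weight_re x y -
   (h * (- ((x - p1) / r) / (12 * r)) - k * ((1 - (y - p2) / r) / (12 * r)))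
   = (24 * r ^+ 2)^-1 * - (h ^+ 2 - k ^+ 2) by rewrite /weight_re; field.
have -> : weight_im (x + h) (y + k) - weight_im x y -
   (h * ((1 - (y - p2) / r) / (12 * r)) + k * (- ((x - p1) / r) / (12 * r)))
   = (24 * r ^+ 2)^-1 * - (2 * h * k) by rewrite /weight_im; field.
have q0 : 0 < 24 * r ^+ 2 by rewrite !mulr_gt0 ?exprn_gt0.
rewrite slice_ptZ qnormM qnorm_real gtr0_norm ?invr_gt0 // ler_pdivrMl //.
apply: le_trans (qnorm_slice_le _ _ SI) _.
rewrite !normrN (_ : h ^+ 2 - k ^+ 2 = (h - k) * (h + k)); last by ring.
rewrite !normrM normr_nat.
have H1 := ler_normD h k; have H2 := ler_normB h k.
have H3 : `|h - k| * `|h + k| + 2 * `|h| * `|k| <= n * n + n * n.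
  apply: lerD; first by rewrite ler_pM.
  rewrite /n; have := mulr_ge0 (normr_ge0 h) (normr_ge0 h).
  have := mulr_ge0 (normr_ge0 k) (normr_ge0 k).
  have := mulr_ge0 (normr_ge0 k) (normr_ge0 h).
  lra.
apply: le_trans H3 _.
have H4 : n * n <= 12 * r ^+ 2 * e * n by rewrite ler_wpM2r // /n; lra.
by move: H4; rewrite -/n; lra.
Qed.

Lemma weight_center : weight p1 p2 = 1.
Proof.
have re1 : weight_re p1 p2 = 1 by rewrite /weight_re !subrr !mul0r; field.
have im0 : weight_im p1 p2 = 0 by rewrite /weight_im !subrr !mul0r; field.
by rewrite /weight re1 im0 slice_pt0.
Qed.

Lemma weight_circle t : - (1 / 4) <= sin t ->
  qnorm (weight (p1 + r * cos t) (p2 + r * sin t)) ^+ 2 <= 63 / 64.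
Proof.
move=> st; rewrite qnorm_slice // /weight_re /weight_im.
have r1 : r != 0 by rewrite gt_eqF.
have -> : (p1 + r * cos t - p1) / r = cos t by field.
have -> : (p2 + r * sin t - p2) / r = sin t by field.
have := cos2Dsin2 t; have := sin_le1 t; move: st; set Y := sin t; set X := cos t.
move=> Y0 Y1 XY; have -> : X ^+ 2 = 1 - Y ^+ 2 by rewrite -XY addrK.
have -> : (X - X * Y) / 12 = X * ((1 - Y) / 12) by field.
rewrite exprMn; have -> : X ^+ 2 = 1 - Y ^+ 2 by rewrite -XY addrK.
have B : (1 - Y ^+ 2) * ((1 - Y) / 12) ^+ 2 <= 25 / 16 / 144.
  have H1 : (1 - Y) ^+ 2 <= 25 / 16.
    have -> : 25 / 16 = (5 / 4 : R) ^+ 2 by field.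
    by rewrite ler_sqr ?nnegrE; lra.
  have H2 : 0 <= (1 - Y) ^+ 2 by rewrite sqr_ge0.
  have H3 : 0 <= Y ^+ 2 by rewrite sqr_ge0.
  have H4 : (1 - Y ^+ 2) * (1 - Y) ^+ 2 <= (1 - Y) ^+ 2.
    by rewrite mulrBl mul1r gerBl mulr_ge0.
  by rewrite exprMn exprVn mulrA; lra.
set u := - Y - (1 - Y ^+ 2 - Y ^+ 2) / 2.
have u1 : u <= - (3 / 16).
  have : 0 <= (Y + 1 / 4) * (1 - Y) by apply: mulr_ge0; lra.
  by rewrite /u; lra.
have u2 : - (3 / 4) <= u.
  by have := sqr_ge0 (Y - 1 / 2); rewrite /u; lra.
have A : (1 + u / 12) ^+ 2 <= (1 - 1 / 64) ^+ 2.
  by rewrite ler_sqr ?nnegrE; lra.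
by lra.
Qed.

End Weight.

(** Multiplying g by a high power of the weight keeps its value at the centre of
    the circle and makes its maximum on the circle arbitrarily small, since g
    vanishes on the arc where the weight may be large. *)
Lemma vanish_center g (p1 p2 r : R) : 0 < r ->
  (forall x y, (x - p1) ^+ 2 + (y - p2) ^+ 2 <= r ^+ 2 -> exists c, ldiff I g x y c) ->
  (forall t, sin t < - (1 / 4) -> g (p1 + r * cos t) (p2 + r * sin t) = 0) ->
  g p1 p2 = 0.
Proof.
move=> r0 gD g0; pose q := weight p1 p2 r.
pose V N := iter N (fun w x y => q x y * w x y) g.
have VD N x y : (x - p1) ^+ 2 + (y - p2) ^+ 2 <= r ^+ 2 -> exists c, ldiff I (V N) x y c.
  move=> xy; elim: N => [|N [c IHN]]; first exact: gD.
  by eexists; exact: (ldiffM SI (ldiff_weight p1 p2 r0 x y) IHN).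
have Vp N : V N p1 p2 = g p1 p2.
  by elim: N => [//|N IHN]; rewrite /V iterS -/(V N) /q weight_center mul1r.
have [B HB] := circle_bounded SI r0 gD.
have B0 : 0 <= B.
  by apply: le_trans (qnorm_ge0 _) (HB 0 _ _); rewrite // mulrn_wge0 // pi_ge0.
pose m : R := Num.sqrt (63 / 64).
have m0 : 0 <= m by exact: sqrtr_ge0.
have m2 : m ^+ 2 = 63 / 64 by rewrite sqr_sqrtr //; lra.
have m1 : m < 1 by rewrite -[ltRHS]sqrtr1 ltr_sqrt //; lra.
have VB N t : 0 <= t -> t <= pi *+ 2 -> qnorm (V N (p1 + r * cos t) (p2 + r * sin t)) <= m ^+ N * B.
  move=> t0 tL; have [tl|tg] := ltP (sin t) (- (1 / 4)).
    have -> : V N (p1 + r * cos t) (p2 + r * sin t) = 0.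
      by elim: N => [|N IHN]; [exact: g0|rewrite /V iterS -/(V N) IHN mulr0].
    by rewrite qnorm0 mulr_ge0 ?exprn_ge0.
  elim: N => [|N IHN]; first by rewrite expr0 mul1r; exact: HB.
  rewrite /V iterS -/(V N) qnormM exprS -mulrA ler_pM ?qnorm_ge0 //.
  by rewrite le_sqr_ge0 // m2 weight_circle.
have C N j : `|qcoord j (g p1 p2)| <= m ^+ N * B.
  by rewrite -(Vp N); apply: (max_modulus SI r0 (@VD N)); exact: VB.
apply: qcoord_eq0 => j; apply/eqP; rewrite -normr_eq0 eq_le normr_ge0 andbT.
apply/ler_addgt0Pl => e e0; rewrite addr0.
have := @cvg_geometric R B m; rewrite ger0_norm // => /(_ m1).
move/cvgrPdist_lt/(_ _ e0) => [N _ /(_ N (leqnn N))] /=.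
rewrite sub0r normrN => DN; apply: le_trans (C N j) _; rewrite mulrC.
exact: le_trans (ler_norm _) (ltW DN).
Qed.

(** Vanishing below a horizontal line spreads to the points at height at most
    r / 4 above the line, by circles of radius r around them; in a strip the same
    r serves for all points below a given height, and finitely many steps reach
    it. *)
Lemma vanish_strip g (l : R) : 0 < l ->
  (forall x y, `|y| < l -> exists c, ldiff I g x y c) ->
  (forall x y, y < 0 -> g x y = 0) ->
  forall x y, `|y| < l -> g x y = 0.
Proof.
move=> l0 gD g0 x0 y0 y0l; have [yn|yp] := ltP y0 0; first exact: g0.
rewrite (ger0_norm yp) in y0l.
pose r := (l - y0) / 2; have r0 : 0 < r by rewrite divr_gt0 // subr_gt0.
have rE : r * 2 = l - y0 by rewrite /r divfK.
have step n x y : y <= y0 -> y < n%:R * (r / 4) -> g x y = 0.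
  elim: n x y => [|n IHn] x y yy yn; first by apply: g0; rewrite mul0r in yn.
  have [ylt|yge] := ltP y 0; first exact: g0.
  apply: (@vanish_center g x y r) => // [x' y' H|t ts].
    apply: gD; have : (y' - y) ^+ 2 <= r ^+ 2.
      by apply: le_trans H; rewrite lerDr sqr_ge0.
    rewrite -ler_sqrt ?sqr_ge0 // !sqrtr_sqr (gtr0_norm r0) !ler_norml ltr_norml.
    by lra.
  have rs : r * sin t < r * - (1 / 4) by rewrite ltr_pM2l.
  by apply: IHn; move: yn; rewrite -natr1; lra.
apply: (step (Num.trunc (y0 / (r / 4))).+1) => //.
have r40 : 0 < r / 4 by rewrite divr_gt0.
by rewrite -ltr_pdivrMr // truncnS_gt.
Qed.

(** Extending f by 0 below the axis keeps it differentiable, because the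
    derivative of f vanishes on the axis; the exponential straightens the
    half-plane into a strip, where the previous lemma applies. *)
Lemma vanish_halfplane f :
  (forall x y, 0 < x -> exists c, ldiff I f x y c) ->
  (forall x, 0 < x -> f x 0 = 0) ->
  forall x y, 0 < x -> 0 <= y -> f x y = 0.
Proof.
move=> fD f0.
pose F s t := f (expR s * cos t) (expR s * sin t).
pose g s t := if t < 0 then 0 else F s t.
have hp : 0 < pi / 2 :> R by rewrite divr_gt0 ?pi_gt0.
have FD s t : `|t| < pi / 2 -> exists c, ldiff I F s t c.
  rewrite ltr_norml => tp; have [|c fc] := fD (expR s * cos t) (expR s * sin t).
    by rewrite mulr_gt0 ?expR_gt0 // cos_gt0_pihalf.
  exists (cis I s t * c).
  exact: (@ldiff_comp R I SI (fun s t => expR s * cos t) (fun s t => expR s * sin t)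
    f s t _ _ c (ldiff_cis SI s t) fc).
have F0 s : F s 0 = 0 by rewrite /F sin0 cos0 mulr0 mulr1 f0 ?expR_gt0.
have c0 s c : ldiff I F s 0 c -> c = 0.
  move=> Fc; apply/eqP; rewrite -qnorm_eq0 eq_le qnorm_ge0 andbT.
  apply/ler_addgt0Pl => e e0; rewrite addr0; have [d d0 Hd] := Fc e e0.
  have := Hd d 0; rewrite addr0 !F0 subrr sub0r qnormN slice_pt0 qnormM qnorm_real.
  by rewrite normr0 addr0 gtr0_norm // [d * _]mulrC ler_pM2r //; apply=> //; exact: ltW.
have gD x y : `|y| < pi / 2 -> exists c, ldiff I g x y c.
  move=> yp; have [c Fc] := FD x y yp; have [yn|yn|y0] := ltgtP y 0.
  - exists 0; apply: (@ldiff_local R I (fun _ _ => 0) g x y 0 (- y / 2)).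
    + by rewrite divr_gt0 // oppr_gt0.
    + move=> h k _; rewrite ler_norml => kd; rewrite /g ifT //; lra.
    + exact: ldiff0.
  - exists c; apply: (@ldiff_local R I F g x y c (y / 2)) => //.
    + by rewrite divr_gt0.
    + move=> h k _; rewrite ler_norml => kd; rewrite /g ifF //; apply/negbTE.
      by rewrite -leNgt; lra.
  - exists 0; move: Fc; rewrite y0 => Fc; have c00 := c0 _ _ Fc; rewrite c00 in Fc.
    move=> e e0; have [d d0 Hd] := Fc e e0; exists d => // h k hd kd.
    have := Hd h k hd kd; rewrite /g ltxx add0r !F0; case: ifP => // _ _.
    by rewrite mulr0 !subr0 qnorm0 mulr_ge0 ?addr_ge0 // ltW.
have g0 x y : y < 0 -> g x y = 0 by rewrite /g => ->.
move=> x y x0 y0; pose t := atan (y / x).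
have tp : `|t| < pi / 2 by rewrite ltr_norml atan_gtNpi2 atan_ltpi2.
have ct : 0 < cos t by apply: cos_gt0_pihalf; rewrite atan_gtNpi2 atan_ltpi2.
have xt : expR (ln (x / cos t)) = x / cos t by rewrite lnK // posrE divr_gt0.
have := vanish_strip hp gD g0 (ln (x / cos t)) tp.
have t0 : 0 <= t by rewrite -(atan0 R) le_atan // divr_ge0 // ltW.
rewrite /g ltNge t0 /= /F xt divfK ?gt_eqF // -mulrA [_^-1 * _]mulrC.
by rewrite -[sin t / cos t]/(tan t) /t atanK mulrCA divff ?mulr1 // gt_eqF.
Qed.

End UniqueContinuation.

(** * Slice hyperholomorphic functions and the identity principle *)

Section RealDifferential.
Variable R : realType.
Implicit Types (p q a b : quat R) (u v : 'rV[R]_4) (L phi : quat R -> quat R).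

Lemma rowqK v : qrow (rowq v) = v.
Proof.
apply/rowP => k; rewrite mxE /qcoord (tnth_nth 0).
case: k => -[|[|[|[|//]]]] kp /=; congr (v _ _); apply: val_inj => //=; by rewrite inordK.
Qed.
Lemma qrowD a b : qrow (a + b) = qrow a + qrow b.
Proof. by apply/rowP => k; rewrite !mxE qcoordD. Qed.
Lemma qrowZ (r : R) a : qrow (r%:q * a) = r *: qrow a.
Proof. by apply/rowP => k; rewrite !mxE qcoord_realM. Qed.
Lemma rowqD u v : rowq (u + v) = rowq u + rowq v.
Proof. by apply: (can_inj (@qrowK R)); rewrite qrowD !rowqK. Qed.
Lemma rowqZ (r : R) u : rowq (r *: u) = r%:q * rowq u.
Proof. by apply: (can_inj (@qrowK R)); rewrite qrowZ !rowqK. Qed.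
Lemma qrowB a b : qrow (a - b) = qrow a - qrow b.
Proof. by apply/rowP => k; rewrite !mxE qcoordB. Qed.

Lemma row_coord_le v k : `|v 0 k| <= `|v|.
Proof.
rewrite [leRHS]/Num.norm /= mx_normrE; apply/bigmax_geP; right.
by exists (0, k).
Qed.

Lemma qnorm_row_le v : qnorm (rowq v) <= 4 * `|v|.
Proof.
apply: le_trans (qnorm_le_coord _) _; rewrite -[v in leRHS]rowqK.
have H k : `|qcoord k (rowq v)| <= `|qrow (rowq v)|.
  by have := row_coord_le (qrow (rowq v)) k; rewrite mxE.
have -> (x : R) : 4 * x = x + x + x + x by ring.
by do ?apply: lerD; exact: H.
Qed.

Lemma row_qnorm_le q : `|qrow q| <= qnorm q.
Proof.
rewrite [leLHS]/Num.norm /= mx_normrE; apply/bigmax_leP; split; first exact: qnorm_ge0.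
by move=> [i k] _ /=; rewrite mxE qcoord_le_norm.
Qed.

(** L is the real differential of phi at p, written with quaternions instead of
    rows of coordinates. *)
Definition qdiff phi p L := [/\ {morph L : a b / a + b},
  forall (r : R) a, L (r%:q * a) = r%:q * L a &
  forall e : R, 0 < e -> exists2 d : R, 0 < d & forall h, qnorm h <= d ->
    qnorm (phi (p + h) - phi p - L h) <= e * qnorm h].

Let rowfun phi v := qrow (phi (rowq v)).

Lemma differentiable_qdiff phi p : differentiable (rowfun phi) (qrow p) ->
  qdiff phi p (fun h => rowq ('d (rowfun phi) (qrow p) (qrow h))).
Proof.
move=> D; split=> [a b|r a|e e0].
- by rewrite qrowD linearD rowqD.
- by rewrite qrowZ linearZ rowqZ.
have e40 : 0 < e / 4 by rewrite divr_gt0.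
have /diff_locallyP[_ /eqaddoP H] := D.
have /nbhs_ballP[d /= d0 Hd] := H _ e40.
exists (d / 2); first by rewrite divr_gt0.
move=> h hd; have hq : `|qrow h| < d.
  apply: le_lt_trans (row_qnorm_le h) _; apply: le_lt_trans hd _.
  by rewrite ltr_pdivrMr // ltr_pMr // ltr1n.
have {}H := Hd (qrow h); rewrite -ball_normE /= sub0r normrN in H.
have {}H := H hq; rewrite /= in H.
have -> : phi (p + h) - phi p - rowq ('d (rowfun phi) (qrow p) (qrow h)) =
   rowq ((rowfun phi \o shift (qrow p) - (cst (rowfun phi (qrow p)) +
      'd (rowfun phi) (qrow p))) (qrow h)).
  rewrite /= /rowfun; apply: (can_inj (@qrowK R)); rewrite rowqK !qrowB rowqK.
  rewrite !fctE /= /rowfun -qrowD !qrowK [h + p]addrC.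
  by rewrite opprD addrA.
apply: le_trans (qnorm_row_le _) _; rewrite -ler_pdivlMl // mulrC mulrAC.
apply: le_trans H _; rewrite ler_pM2l //; exact: row_qnorm_le.
Qed.

Lemma qdiff_bounded phi p L : qdiff phi p L ->
  exists2 K, 0 <= K & forall h, qnorm (L h) <= K * qnorm h.
Proof.
case=> LD LZ _.
pose K := qnorm (L 1) + qnorm (L (qi R)) + qnorm (L (Quat 0 0 1 0))
  + qnorm (L (Quat 0 0 0 1)).
exists K; first by rewrite !addr_ge0 ?qnorm_ge0.
move=> h; have -> : h = (qcoord 0 h)%:q * 1 + (qcoord 1 h)%:q * qi R
   + (qcoord (inord 2) h)%:q * Quat 0 0 1 0 + (qcoord (inord 3) h)%:q * Quat 0 0 0 1.
  by rewrite /qcoord !(tnth_nth 0) !inordK //; apply: quatP => /=; ring.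
rewrite !LD !LZ.
have H k (w : quat R) : qnorm ((qcoord k h)%:q * w) <= qnorm w * qnorm h.
  by rewrite qnormM qnorm_real mulrC ler_wpM2l ?qnorm_ge0 ?qcoord_le_norm.
set h' := (X in _ <= _ * qnorm X).
have <- : h = h'.
  by rewrite /h' /qcoord !(tnth_nth 0) !inordK //; apply: quatP => /=; ring.
rewrite /K !mulrDl; do 3![apply: le_trans (ler_qnormD _ _) _; apply: lerD => //].
Qed.

Lemma qdiff_differentiable phi p L : qdiff phi p L ->
  differentiable (rowfun phi) (qrow p) /\
  forall a, 'd (rowfun phi) (qrow p) (qrow a) = qrow (L a).
Proof.
move=> D; have [K K0 LK] := qdiff_bounded D; have [LD LZ Leps] := D.
pose f v := qrow (L (rowq v)).
have f_lin : linear f.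
  by move=> r u v; rewrite /f rowqD rowqZ LD LZ qrowD qrowZ.
pose df : {linear 'rV[R]_4 -> 'rV[R]_4} :=
  HB.pack f (GRing.isLinear.Build R _ _ *:%R f f_lin).
have fK v : `|df v| <= (4 * K) * `|v|.
  rewrite -[df v]/(qrow (L (rowq v))); apply: le_trans (row_qnorm_le _) _.
  apply: le_trans (LK _) _; rewrite -mulrA mulrCA ler_wpM2l //.
  exact: qnorm_row_le.
have df_cont : continuous df.
  move=> x; apply/(@cvgrPdist_le _ _ _ (nbhs x)) => e e0.
  have K1 : 0 < 4 * K + 1 by rewrite ltr_wpDl // mulr_ge0.
  apply/nbhs_ballP; exists (e / (4 * K + 1)); first by rewrite /= divr_gt0.
  move=> y; rewrite -ball_normE /= ltr_pdivlMr // => xy.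
  have := fK (x - y); rewrite linearB => fxy.
  apply: le_trans fxy _; apply: le_trans (ltW xy).
  by rewrite mulrC ler_wpM2l // lerDl.
have [E dfo] : 'd (rowfun phi) (qrow p) = df :> ('rV[R]_4 -> 'rV[R]_4) /\
    differentiable (rowfun phi) (qrow p).
  suff dfo : forall e, 0 < e -> \forall v \near (0 : 'rV[R]_4),
      `|(rowfun phi \o shift (qrow p) -
      (cst (rowfun phi (qrow p)) + (df : 'rV[R]_4 -> 'rV[R]_4))) v| <= e * `|v|.
    have E : 'd (rowfun phi) (qrow p) = df :> ('rV[R]_4 -> 'rV[R]_4).
      by apply: diff_unique => //; apply/eqaddoP.
    by split=> //; apply/diff_locallyP; rewrite E; split=> //; apply/eqaddoP.
  move=> e e0; have e40 : 0 < e / 4 by rewrite divr_gt0.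
  have [d d0 Hd] := Leps _ e40; apply/nbhs_ballP; exists (d / 4).
    by rewrite /= divr_gt0.
  move=> v; rewrite -ball_normE /= sub0r normrN => vd.
  have -> : (rowfun phi \o shift (qrow p) - (cst (rowfun phi (qrow p)) +
      (df : 'rV[R]_4 -> 'rV[R]_4))) v = qrow (phi (p + rowq v) - phi p - L (rowq v)).
    rewrite !qrowB !fctE /= /rowfun rowqD !qrowK [rowq v + p]addrC.
    by rewrite opprD addrA.
  apply: le_trans (row_qnorm_le _) _.
  apply: le_trans (Hd _ _) _.
    by apply: le_trans (qnorm_row_le _) _; rewrite -ler_pdivlMl // mulrC ltW.
  by rewrite -mulrA ler_pM2l // ler_pdivrMl // qnorm_row_le.
by split=> // a; rewrite E -[df _]/(qrow (L (rowq (qrow a)))) qrowK.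
Qed.

(** A path with constant velocity a differentiates phi to L a; the paths in use
    are the horizontal and vertical lines of a slice. *)
Lemma qdiff_qderive phi p L (path : R -> quat R) t a : qdiff phi p L ->
  (forall h, path (h + t) = p + h%:q * a) ->
  qderive (fun s => phi (path s)) t = L a.
Proof.
move=> D path_p; have [df dE] := qdiff_differentiable D.
rewrite /qderive -[RHS]qrowK; congr rowq; rewrite -dE -deriveE //.
rewrite /derive1 /derive; set d := (fun _ : R => _); set d' := (fun _ : R => _).
suff -> : d = d' by [].
apply/funext => h; rewrite /d /d' path_p; have -> : path t = p.
  by have := path_p 0; rewrite add0r qreal0 mul0r addr0.
by rewrite /= /rowfun -qrowZ -qrowD !qrowK [p + _]addrC.
Qed.

Lemma qdiff_affine phi (c : quat R) (e : R) p L : qdiff phi p L ->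
  qdiff (fun q => c + e%:q * phi q) p (fun h => e%:q * L h).
Proof.
move=> [LD LZ Leps]; split=> [a b|r a|x x0].
- by rewrite LD mulrDr.
- by rewrite LZ !mulrA -!qrealM mulrC.
have e1 : 0 < `|e| + 1 by rewrite ltr_wpDl.
have [d d0 Hd] := Leps _ (divr_gt0 x0 e1); exists d => // h hd.
have -> : c + e%:q * phi (p + h) - (c + e%:q * phi p) - e%:q * L h =
    e%:q * (phi (p + h) - phi p - L h).
  by rewrite opprD addrACA subrr add0r !mulrBr.
rewrite qnormM qnorm_real; apply: (@le_trans _ _ ((`|e| + 1) * (x / (`|e| + 1) * qnorm h))).
  by rewrite ler_pM ?qnorm_ge0 ?lerDl // Hd.
by rewrite mulrA mulrC [(_ + 1) * _]mulrC divfK ?gt_eqF // mulrC.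
Qed.

End RealDifferential.

Section IdentityPrinciple.
Variable R : realType.

(** The equation f_x + I f_y = 0 at a point of the slice of I says that the
    differential L sends I to I (L 1).  At a real point this holds for all I at
    once, every slice containing that point. *)
Lemma left_slice_hyperholomorphicP (m n : nat) (f : quat R -> 'M[quat R]_(m, n)) :
  left_slice_hyperholomorphic f <->
  forall p, halfspace p -> forall i j, exists L,
    qdiff (fun q => f q i j) p L /\
    forall I x y, imag_sphere I -> p = slice_pt I x y -> L I = I * L 1.
Proof.
have pathx I y x (h : R) : slice_pt I (h + x) y = slice_pt I x y + h%:q * 1.
  by rewrite mulr1 -[y in LHS]add0r slice_ptD slice_pt0 addrC.
have pathy I y x (h : R) : slice_pt I x (h + y) = slice_pt I x y + h%:q * I.
  rewrite -[x in LHS]add0r slice_ptD addrC; congr (_ + _).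
  by rewrite /slice_pt qreal0 add0r qreal_comm.
split=> [[fd fCR] p p0 i j|H].
  have D := @differentiable_qdiff R (fun q => f q i j) p (fd p p0 i j); eexists; split; first exact: D.
  move=> I x y SI Ep; have x0 : 0 < x.
    by move: p0; rewrite /halfspace /= Ep qRe_slice // SI.1.
  have := fCR I x y SI x0 i j; rewrite Ep in D *.
  rewrite (qdiff_qderive D (pathx I y x)) (qdiff_qderive D (pathy I y x)).
  move/(congr1 (fun q => I * q)); rewrite mulrDr mulr0 mulrA (imag_sphereP SI).1 mulN1r.
  by move/eqP; rewrite subr_eq0 => /eqP.
split=> [p p0 i j|I x y SI x0 i j].
  have [L [D _]] := H p p0 i j; exact: (qdiff_differentiable D).1.
have p0 : halfspace (slice_pt I x y) by rewrite /halfspace /mkset qRe_slice // SI.1.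
have [L [D LI]] := H _ p0 i j.
rewrite (qdiff_qderive D (pathx I y x)) (qdiff_qderive D (pathy I y x)).
by rewrite (LI I x y) // mulrA (imag_sphereP SI).1 mulN1r subrr.
Qed.

Lemma hyperholomorphic_affine (m n : nat) (f : quat R -> 'M[quat R]_(m, n))
  (A : 'M[quat R]_(m, n)) (e : R) :
  left_slice_hyperholomorphic f ->
  left_slice_hyperholomorphic (fun p => A + e%:q *: f p).
Proof.
move/left_slice_hyperholomorphicP => H; apply/left_slice_hyperholomorphicP.
move=> p p0 i j; have [L [D LI]] := H p p0 i j.
exists (fun h => e%:q * L h); split.
  have -> : (fun q => (A + e%:q *: f q) i j) = (fun q => A i j + e%:q * f q i j).
    by apply/funext => q; rewrite !mxE.
  exact: qdiff_affine.
by move=> I x y SI Ep; rewrite (LI I x y) // !mulrA qreal_comm.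
Qed.

Lemma hyperholomorphic_ldiff (m n : nat) (f : quat R -> 'M[quat R]_(m, n)) I x y i j :
  left_slice_hyperholomorphic f -> imag_sphere I -> 0 < x ->
  exists c, ldiff I (fun x y => f (slice_pt I x y) i j) x y c.
Proof.
move=> /left_slice_hyperholomorphicP H SI x0.
have p0 : halfspace (slice_pt I x y) by rewrite /halfspace /mkset qRe_slice // SI.1.
have [L [[LD LZ Leps] LI]] := H _ p0 i j; exists (L 1) => e e0.
have [d d0 Hd] := Leps e e0; exists (d / 2); first by rewrite divr_gt0.
move=> h k hd kd; have := Hd (slice_pt I h k).
have -> : L (slice_pt I h k) = slice_pt I h k * L 1.
  rewrite /slice_pt LD -[h%:q]mulr1 LZ -(qreal_comm k) LZ (LI I x y) // mulrDl mulr1.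
  by rewrite mulrA.
rewrite slice_ptD => {}H; have hk := qnorm_slice_le h k SI.
apply: le_trans (H _) _; first by apply: le_trans hk _; lra.
by rewrite ler_pM2l.
Qed.

(** The identity principle.  On each slice the difference of the two functions is
    holomorphic and vanishes on the positive half-axis. *)
Theorem slice_identity (m n : nat) (f g : quat R -> 'M[quat R]_(m, n)) :
  left_slice_hyperholomorphic f -> left_slice_hyperholomorphic g ->
  (forall x : R, 0 < x -> f x%:q = g x%:q) ->
  forall p, halfspace p -> f p = g p.
Proof.
move=> fh gh fg p /halfspaceP[I [x [y [SI x0 ->]]]]; apply/matrixP => i j.
wlog y0 : I y SI / 0 <= y.
  move=> WL; have [/WL|yn] := leP 0 y; first exact.
  have -> : slice_pt I x y = slice_pt (- I) x (- y).
    by rewrite /slice_pt qrealN mulrNN.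
  by apply: WL; [exact: imag_sphereN|rewrite oppr_ge0 ltW].
apply/eqP; rewrite -subr_eq0; apply/eqP.
apply: (@vanish_halfplane R I SI
  (fun x y => f (slice_pt I x y) i j - g (slice_pt I x y) i j)) => //.
  move=> s t s0; have [c fc] := hyperholomorphic_ldiff t i j fh SI s0.
  by have [c' gc] := hyperholomorphic_ldiff t i j gh SI s0; exists (c - c'); exact: ldiffB.
by move=> s s0; rewrite slice_pt0 fg // subrr.
Qed.

(** The slice extension is specified by its properties; the identity principle
    allows to compute it from any explicit candidate F. *)
Lemma slice_extensionE (m n : nat) (f : R -> 'M[quat R]_(m, n))
  (F : quat R -> 'M[quat R]_(m, n)) :
  left_slice_hyperholomorphic F -> (forall x : R, 0 < x -> F x%:q = f x) ->
  left_slice_hyperholomorphic (slice_extension f) /\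
  forall p, halfspace p -> slice_extension f p = F p.
Proof.
move=> Fh Ff; rewrite /slice_extension.
case: xgetP => [G _ [Gh Gf]|/(_ F)[]] //; split=> // p.
by apply: slice_identity => // x x0; rewrite Gf // Ff.
Qed.

End IdentityPrinciple.

(** * The resolvent of an anti-self-adjoint operator *)

Section SkewResolvent.
Variables (R : realType) (H : qHilbertType R).
Implicit Types (T : H -> H) (u v w d e g : H) (a p q I : quat R) (x y : R).

(** Stated for plain functions, so that T and u |-> - T u are treated alike. *)
Definition skew_op T := [/\ {morph T : u v / u + v},
  forall u a, T (u ** a) = T u ** a, bounded_op T &
  forall u v, ip (T u) v = - ip u (T v)].

Lemma anti_self_adjoint_skew (T : {linear H -> H}) :
  bounded_op T -> anti_self_adjoint T -> skew_op T.
Proof.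
move=> Tb Ta; split=> //; [exact: linearD|exact: linear_rscale|].
move: Ta; rewrite /anti_self_adjoint /adjoint; case: xgetP => [S -> HS|_] E u v.
  by rewrite HS E ipNr.
have T0 w : T w = 0 by apply/eqP; rewrite -oppr_eq0 -[- _]/((fun u => - T u) w) -E.
by rewrite !T0 ip0l ip0r oppr0.
Qed.

Lemma skew_opN T : skew_op T -> skew_op (fun u => - T u).
Proof.
move=> [TD TZ [M TM] Ts]; split=> [u v|u a||u v].
- by rewrite TD opprD.
- by rewrite TZ rscaleNl.
- by exists M => u; rewrite hnorm_opp.
- by rewrite ipNl ipNr Ts.
Qed.

Section Solve.
Variable T : H -> H.
Hypothesis Tskew : skew_op T.

Let TD : {morph T : u v / u + v}. Proof. by case: Tskew. Qed.
Let TZ u a : T (u ** a) = T u ** a. Proof. by case: Tskew. Qed.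
Let TN u : T (- u) = - T u.
Proof. by have := TZ u (-1); rewrite !rscaleNr !rscale1. Qed.
Let TB u v : T (u - v) = T u - T v. Proof. by rewrite TD TN. Qed.
Let Ts u v : ip (T u) v = - ip u (T v). Proof. by case: Tskew. Qed.

Let shifted a u := T u + u ** a.

Let shiftedB a u v : shifted a (u - v) = shifted a u - shifted a v.
Proof. by rewrite /shifted TB rscaleBl opprD addrACA. Qed.
Let shiftedD a u v : shifted a (u + v) = shifted a u + shifted a v.
Proof. by rewrite /shifted TD rscaleDl addrACA. Qed.

Let shifted_coercive a u : qRe (ip (shifted a u) u) = qRe a * hnorm u ^+ 2.
Proof.
rewrite /shifted ipDl qReD ip_rscale ip_self qRe_realM mulrC.
suff -> : qRe (ip (T u) u) = 0 by rewrite add0r.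
have : qRe (ip (T u) u) = - qRe (ip (T u) u).
  by rewrite {1}Ts ip_conj qReN.
by lra.
Qed.

Lemma shifted_bound a u : qRe a * hnorm u <= hnorm (T u + u ** a).
Proof.
have [u0|u0] := eqVneq (hnorm u) 0; first by rewrite u0 mulr0 hnorm_ge0.
have up : 0 < hnorm u by rewrite lt_def u0 hnorm_ge0.
rewrite -(ler_pM2r up) -mulrA -expr2 -shifted_coercive; exact: qRe_ip_le.
Qed.

(** The solution g of T g + g a = d.  For a = conj p the functional <d', g> of the
    solution is the value at p of the slice extension of
    x |-> <(x - T)^-1 d', d>: the equation is affine in all four coordinates
    of p, so that smoothness across the real axis and the Cauchy-Riemann equations
    on every slice can be read off from it. *)
Definition rsol d a : H := xget 0 [set g | T g + g ** a = d].

Lemma rsolP d a : 0 < qRe a -> T (rsol d a) + rsol d a ** a = d.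
Proof.
move=> a0; have [_ _ [M TM] _] := Tskew.
have [g gd] : exists g, shifted a g = d.
  apply: (@coercive_surj R H (shifted a) (qRe a) (M + qnorm a)) => // u.
    apply: le_trans (ler_hnormD _ _) _; rewrite hnorm_rscale mulrDl lerD ?TM //.
    by rewrite mulrC.
  by rewrite shifted_coercive.
by rewrite /rsol; case: xgetP => [h -> //|/(_ g)[]].
Qed.

Lemma rsol_unique d a g : 0 < qRe a -> T g + g ** a = d -> rsol d a = g.
Proof.
move=> a0 gd; apply/eqP; rewrite -subr_eq0; apply/eqP/hnorm0_eq0/eqP.
rewrite eq_le hnorm_ge0 andbT -(pmulr_rle0 _ a0).
apply: le_trans (shifted_bound _ _) _.
by rewrite -/(shifted _ _) shiftedB /shifted rsolP // gd subrr hnorm0.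
Qed.

Lemma rsolD d e a : 0 < qRe a -> rsol (d + e) a = rsol d a + rsol e a.
Proof.
by move=> a0; apply: rsol_unique => //; rewrite -/(shifted _ _) shiftedD /shifted !rsolP.
Qed.

Lemma rsolZ d a b : 0 < qRe a -> a * b = b * a -> rsol (d ** b) a = rsol d a ** b.
Proof.
move=> a0 ab; apply: rsol_unique => //.
by rewrite TZ rscaleA -ab -rscaleA -rscaleDl rsolP.
Qed.

Lemma rsol_bound d a : 0 < qRe a -> hnorm (rsol d a) <= hnorm d / qRe a.
Proof. by move=> a0; rewrite ler_pdivlMr // mulrC -[d in leRHS](rsolP d a0) shifted_bound. Qed.

Section Differential.
Variables (d e : H) (p : quat R).
Hypothesis p0 : 0 < qRe p.
Let pc0 : 0 < qRe (qconj p). Proof. by []. Qed.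
Let g := rsol e (qconj p).

(** The second-order remainder g(p + h) - g(p) + G (g(p) conj h), where G solves
    the equation at p, itself solves the equation at p + h with the right-hand side
    G (g(p) conj h) conj h, which is quadratic in h. *)
Lemma qdiff_rsol : qdiff (fun q => ip d (rsol e (qconj q))) p
  (fun h => - ip d (rsol (g ** qconj h) (qconj p))).
Proof.
split=> [a b|r a|eps eps0].
- by rewrite qconjD rscaleDr rsolD // ipDr opprD.
- rewrite qconjM qconj_real -rscaleA rsolZ //; last by rewrite qreal_comm.
  by rewrite ip_rscaler qconj_real mulrN.
pose K := hnorm d * (hnorm g * 2 / qRe p ^+ 2).
have K0 : 0 <= K by rewrite !mulr_ge0 ?hnorm_ge0 // invr_ge0 exprn_ge0 // ltW.
have K1 : 0 < K + 1 by rewrite ltr_wpDl.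
exists (Num.min (qRe p / 2) (eps / (K + 1))); first by rewrite lt_min !divr_gt0.
move=> h; rewrite le_min => /andP[hp hK].
have ph : qRe p / 2 <= qRe (qconj (p + h)).
  have := le_trans (qRe_le_norm h) hp; rewrite ler_norml [qRe (qconj _)]/=; lra.
have ph0 : 0 < qRe (qconj (p + h)) by apply: lt_le_trans ph; rewrite divr_gt0.
set g' := rsol e (qconj (p + h)); set w := g ** qconj h.
set k := rsol w (qconj p).
have E : g' - g + k = rsol (k ** qconj h) (qconj (p + h)).
  apply/esym/rsol_unique => //.
  have sg : shifted (qconj (p + h)) g = e + w.
    by rewrite /shifted qconjD rscaleDr addrA rsolP.
  have sk : shifted (qconj (p + h)) k = w + k ** qconj h.
    by rewrite /shifted qconjD rscaleDr addrA rsolP.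
  rewrite -/(shifted _ _) shiftedD shiftedB sg sk [shifted _ g']rsolP //.
  by rewrite opprD (addrA e) subrr add0r addrA addNr add0r.
have -> : ip d g' - ip d g - - ip d k = ip d (g' - g + k).
  by rewrite opprK ipDr ipBr.
have kb : hnorm k <= hnorm g * qnorm h / qRe p.
  by apply: le_trans (rsol_bound _ pc0) _; rewrite /w hnorm_rscale qnorm_conj.
have Eb : hnorm (g' - g + k) <= hnorm k * qnorm h * (2 / qRe p).
  rewrite E; apply: le_trans (rsol_bound _ ph0) _.
  rewrite hnorm_rscale qnorm_conj ler_wpM2l ?mulr_ge0 ?hnorm_ge0 ?qnorm_ge0 //.
  by rewrite -[2 / _]invf_div lef_pV2 ?posrE ?divr_gt0.
apply: le_trans (qnorm_ip_le _ _) _.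
apply: (@le_trans _ _ (K * qnorm h * qnorm h)).
  rewrite /K -!mulrA ler_wpM2l ?hnorm_ge0 //; apply: le_trans Eb _.
  have H2 : 0 <= qnorm h * (2 / qRe p).
    by rewrite !mulr_ge0 ?qnorm_ge0 // invr_ge0 ltW.
  rewrite -mulrA; apply: le_trans (ler_wpM2r H2 kb) _.
  rewrite le_eqVlt; apply/orP; left; apply/eqP; field; by rewrite gt_eqF.
rewrite ler_wpM2r ?qnorm_ge0 //; apply: (@le_trans _ _ ((K + 1) * qnorm h)).
  by rewrite ler_wpM2r ?qnorm_ge0 // lerDl.
by rewrite mulrC -ler_pdivlMr.
Qed.

(** On its slice I commutes with p, hence solving the equation commutes with the
    right multiplication by I. *)
Lemma qdiff_rsol_slice I x y : imag_sphere I -> p = slice_pt I x y ->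
  - ip d (rsol (g ** qconj I) (qconj p)) = I * - ip d (rsol (g ** qconj 1) (qconj p)).
Proof.
move=> SI Ep; have [_ cI] := imag_sphereP SI.
have c1 : qconj 1 = 1 :> quat R by rewrite -qreal1 qconj_real.
rewrite c1 rscale1 rsolZ //; last first.
  rewrite -!qconjM; congr qconj; rewrite Ep.
  have E : I = slice_pt I 0 1 by rewrite /slice_pt qreal0 add0r qreal1 mulr1.
  by rewrite {1 4}E; exact: slice_pt_comm.
by rewrite ip_rscaler qconjK mulrN.
Qed.

End Differential.

(** The matrix function C * (p - T)^{- *} D, where D has the columns d_j and the
    i-th coordinate of C u is <u, e_i>. *)
Definition resolvent_mx m n (d : 'I_n -> H) (e : 'I_m -> H) p : 'M[quat R]_(m, n) :=
  \matrix_(i, j) ip (d j) (rsol (e i) (qconj p)).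

Lemma resolvent_mx_hyperholomorphic m n (d : 'I_n -> H) (e : 'I_m -> H) :
  left_slice_hyperholomorphic (resolvent_mx d e).
Proof.
apply/left_slice_hyperholomorphicP => p p0 i j; eexists; split.
  have -> : (fun q => resolvent_mx d e q i j) = (fun q => ip (d j) (rsol (e i) (qconj q))).
    by apply/funext => q; rewrite mxE.
  exact: qdiff_rsol.
by move=> I x y; exact: qdiff_rsol_slice.
Qed.

(** The equations for a and b that make g = a - b I the solution at x + I y for
    every unit I. *)
Definition pair_solution x y d (a b : H) :=
  T a + a ** x%:q - b ** y%:q = d /\ T b + b ** x%:q + a ** y%:q = 0.

(** Solving at the two points x + i y and x - i y gives a and b; they also serve
    for any other unit, because their equations do not contain i. *)
Lemma resolvent_mx_slice m n (d : 'I_n -> H) (e : 'I_m -> H) x y : 0 < x ->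
  exists a b : 'I_m -> H, [/\ forall i, pair_solution x y (e i) (a i) (b i),
    slice_re (resolvent_mx d e) x y = \matrix_(i, j) ip (d j) (a i),
    slice_im (resolvent_mx d e) x y = \matrix_(i, j) ip (d j) (b i) &
    forall p, qRe p = x -> qnorm (qIm p) = y -> resolvent_mx d e p =
      slice_re (resolvent_mx d e) x y + qdir p *: slice_im (resolvent_mx d e) x y].
Proof.
move=> x0; pose i0 := qi R; pose h : quat R := (2^-1)%:q.
pose ap := qconj (slice_pt i0 x y); pose am := qconj (slice_pt i0 x (- y)).
have ap0 : 0 < qRe ap by rewrite /ap [qRe _](@qRe_slice R i0 x y).
have am0 : 0 < qRe am by rewrite /am [qRe _](@qRe_slice R i0 x (- y)).
pose gp i := rsol (e i) ap; pose gm i := rsol (e i) am.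
pose a i := gp i ** h + gm i ** h; pose b i := gp i ** (i0 * h) - gm i ** (i0 * h).
pose c := i0 * h.
have Ep i : T (gp i) + gp i ** ap = e i by exact: rsolP.
have Em i : T (gm i) + gm i ** am = e i by exact: rsolP.
have ap_h : ap * h = h * x%:q - c * y%:q.
  by rewrite /ap /c /h /slice_pt /i0; apply: quatP => /=; field.
have am_h : am * h = h * x%:q + c * y%:q.
  by rewrite /am /c /h /slice_pt /i0; apply: quatP => /=; field.
have ap_c : ap * c = c * x%:q + h * y%:q.
  by rewrite /ap /c /h /slice_pt /i0; apply: quatP => /=; field.
have am_c : am * c = c * x%:q - h * y%:q.
  by rewrite /am /c /h /slice_pt /i0; apply: quatP => /=; field.
have E1 i : T (a i) + a i ** x%:q - b i ** y%:q = e i.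
  rewrite /a /b -/c TD rscaleDl rscaleBl opprB !addrA.
  rewrite [LHS](AC 6 ((1*3*6)*(2*4*5))) /=.
  have -> : T (gp i ** h) + gp i ** h ** x%:q - gp i ** c ** y%:q = e i ** h.
    by rewrite TZ !rscaleA -addrA -rscaleBr -ap_h -rscaleA -rscaleDl Ep.
  have -> : T (gm i ** h) + gm i ** h ** x%:q + gm i ** c ** y%:q = e i ** h.
    by rewrite TZ !rscaleA -addrA -rscaleDr -am_h -rscaleA -rscaleDl Em.
  by rewrite -rscaleDr qhalf2 rscale1.
have E2 i : T (b i) + b i ** x%:q + a i ** y%:q = 0.
  rewrite /a /b -/c TB !rscaleDl rscaleNl !addrA.
  rewrite [LHS](AC 6 ((1*3*5)*((2*4)*6))) /= -opprD.
  have -> : T (gp i ** c) + gp i ** c ** x%:q + gp i ** h ** y%:q = e i ** c.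
    by rewrite TZ !rscaleA -addrA -rscaleDr -ap_c -rscaleA -rscaleDl Ep.
  have -> : - (T (gm i ** c) + gm i ** c ** x%:q) + gm i ** h ** y%:q = - (e i ** c).
    rewrite -[gm i ** h ** _]opprK -opprD; congr (- _).
    by rewrite TZ !rscaleA -addrA -rscaleBr -am_c -rscaleA -rscaleDl Em.
  exact: subrr.
have Ere : slice_re (resolvent_mx d e) x y = \matrix_(i, j) ip (d j) (a i).
  apply/matrixP => i j; rewrite /slice_re !mxE ipDr !ip_rscaler qconj_real.
  by rewrite -mulrDr.
have Eim : slice_im (resolvent_mx d e) x y = \matrix_(i, j) ip (d j) (b i).
  apply/matrixP => i j; rewrite /slice_im !mxE ipBr !ip_rscaler -mulrBr.
  by rewrite qconjM qconj_real; congr (_ * _ * _); apply: quatP; rewrite /= ?oppr0.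
clearbody a b; exists a, b; split=> // p px py; rewrite Ere Eim; apply/matrixP => i j; rewrite !mxE.
set I := qdir p; have Ep' : qconj p = x%:q - I * y%:q.
  rewrite {1}(qdirE p) qconjD qconj_real qconjM qconj_real qconj_qdir px py -/I.
  by rewrite mulrN qreal_comm.
have IIy : I * (I * y%:q) = - y%:q by rewrite -py qdir_mul.
have p0 : 0 < qRe (qconj p) by rewrite -[qRe _]/(qRe p) px.
have -> : rsol (e i) (qconj p) = a i - b i ** I.
  apply: rsol_unique => //; rewrite TB TZ Ep' rscaleBr !rscaleBl.
  transitivity ((T (a i) + a i ** x%:q - b i ** y%:q)
      - (T (b i) + b i ** x%:q + a i ** y%:q) ** I); last first.
    by rewrite E1 E2 rscale0l subr0.
  rewrite [b i ** I ** (I * _)]rscaleA IIy rscaleNr -[I * _](qreal_comm y).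
  rewrite !rscaleDl !rscaleA -(qreal_comm x) !opprD !opprK !addrA.
  by rewrite [LHS](AC 6 (1*3*6*2*4*5)) /=.
by rewrite ipBr ip_rscaler qconj_qdir mulNr opprK.
Qed.

End Solve.
End SkewResolvent.

(** * The kernel of a function and the Sylvester equation *)

Section StarResolvent.
Variables (R : realType) (H : qHilbertType R).

Lemma opinv_solves (T : H -> H) (x : R) w : skew_op T -> 0 < x ->
  let S := opinv (fun u : H => (x%:q : (quat R)^c) *: u - T u) in
  S w ** x%:q - T (S w) = w.
Proof.
move=> Ts x0; have TNs := skew_opN Ts.
rewrite /opinv; case: xgetP => [S _ [_ SK]|no]; first exact: SK.
pose S w := rsol (fun u => - T u) w x%:q.
have xp : 0 < qRe x%:q by [].
have [] := no S; split=> u; last by rewrite addrC; exact: rsolP.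
by apply: rsol_unique => //; rewrite addrC.
Qed.

(** At real x the solution for T is paired with the inverse of x - T, since the
    adjoint of x - T is x + T. *)
Lemma star_resolventE m n (C : H -> hvec R m) (T : H -> H) (D : hvec R n -> H)
  (e : 'I_m -> H) : skew_op T ->
  (forall u i, (C u : 'cV[quat R]_m) i 0 = ip u (e i)) ->
  left_slice_hyperholomorphic (star_resolvent C T D) /\
  forall p, halfspace p -> star_resolvent C T D p =
    resolvent_mx T (fun j => D (delta_mx j 0 : 'cV[(quat R)^c]_n)) e p.
Proof.
move=> Ts Ce; apply: slice_extensionE; first exact: resolvent_mx_hyperholomorphic.
move=> x x0; apply/matrixP => i j; rewrite !mxE /= Ce qconj_real.
set d := D _; set s := opinv _ d.
have sd : s ** x%:q - T s = d by exact: opinv_solves.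
have xp : 0 < qRe x%:q by [].
have := rsolP Ts (e i) xp; set g := rsol T (e i) x%:q => ge.
have [_ _ _ Tskew] := Ts.
rewrite -[in LHS]sd -[in RHS]ge ipBl ipDr Tskew opprK ip_rscale ip_rscaler qconj_real.
by rewrite addrC qreal_comm.
Qed.

End StarResolvent.

Section Kernel.
Variable R : realType.
Implicit Types (p q a b c A B I : quat R) (x y : R).

(** This equation says that the kernel inverts p + conj q with respect to the star
    product; it characterizes the kernel. *)
Lemma kker_sylvester p q : 0 < qRe p -> 0 < qRe q ->
  p * kker p q + kker p q * qconj q = 1.
Proof.
move=> p0 q0; pose N := qconj p + qconj q.
pose D := (qnorm p ^+ 2)%:q + (2 * qRe p)%:q * qconj q + qconj q ^+ 2.
rewrite /kker -/D -/N.
have ND : p * N + N * qconj q = D.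
  by rewrite /N /D qnorm_sqr [qconj q ^+ 2]expr2; apply: quatP => /=; ring.
have D0 : D != 0.
  apply/eqP => D0; have N0 : N = 0.
    apply: (@sylvester_inj R p (qconj q)) => //.
    by rewrite ND D0 mulr0 mul0r addr0.
  by have := addr_gt0 p0 q0; rewrite -[_ + _]/(qRe N) N0 /= ltxx.
have UD : D \is a GRing.unit by [].
have qD : qconj q * D = D * qconj q.
  by rewrite /D [qconj q ^+ 2]expr2; apply: quatP => /=; ring.
have qDV : D^-1 * qconj q = qconj q * D^-1.
  exact/esym/commrV.
by rewrite -[N * D^-1 * _]mulrA qDV (mulrA p N) (mulrA N (qconj q)) -mulrDl ND divrr.
Qed.

(** The equation of the kernel at x + i y and x - i y, decoupled into equations
    for the slice components a and b of the kernel. *)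
Lemma sylvester_slice (k : quat R -> quat R) c x y :
  (forall p, qRe p = x -> p * k p + k p * c = 1) ->
  let kp := k (slice_pt (qi R) x y) in let km := k (slice_pt (qi R) x (- y)) in
  let a := (2^-1)%:q * (kp + km) in let b := (2^-1)%:q * - qi R * (kp - km) in
  a * c = 1 + y%:q * b - x%:q * a /\ b * c = - (x%:q * b) - y%:q * a.
Proof.
move=> kc; have := kc _ (@qRe_slice R (qi R) x (- y) erefl).
have := kc _ (@qRe_slice R (qi R) x y erefl).
move: (k _) (k _) => kp km Hp Hm.
have P0 := congr1 (@qRe R) Hp; have P1 := congr1 (@qIi R) Hp.
have P2 := congr1 (@qIj R) Hp; have P3 := congr1 (@qIk R) Hp.
have M0 := congr1 (@qRe R) Hm; have M1 := congr1 (@qIi R) Hm.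
have M2 := congr1 (@qIj R) Hm; have M3 := congr1 (@qIk R) Hm.
rewrite /slice_pt /= in P0 P1 P2 P3 M0 M1 M2 M3.
by split; apply: quatP => /=; lra.
Qed.

Lemma sylvester_slice_r (k : quat R -> quat R) p x y :
  (forall q, qRe q = x -> p * k q + k q * qconj q = 1) ->
  let kp := k (slice_pt (qi R) x y) in let km := k (slice_pt (qi R) x (- y)) in
  let a := (2^-1)%:q * (kp + km) in let b := (kp - km) * ((2^-1)%:q * - qi R) in
  p * a = 1 - a * x%:q - b * y%:q /\ p * b = a * y%:q - b * x%:q.
Proof.
move=> kc; have := kc _ (@qRe_slice R (qi R) x (- y) erefl).
have := kc _ (@qRe_slice R (qi R) x y erefl).
move: (k _) (k _) => kp km Hp Hm.
have P0 := congr1 (@qRe R) Hp; have P1 := congr1 (@qIi R) Hp.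
have P2 := congr1 (@qIj R) Hp; have P3 := congr1 (@qIk R) Hp.
have M0 := congr1 (@qRe R) Hm; have M1 := congr1 (@qIi R) Hm.
have M2 := congr1 (@qIj R) Hm; have M3 := congr1 (@qIk R) Hm.
rewrite /slice_pt /= in P0 P1 P2 P3 M0 M1 M2 M3.
by split; apply: quatP => /=; lra.
Qed.

(** The star product by a slice function A + I B commutes with X |-> p X + X c,
    because the slice components x and y of p are real; a and b are the components
    of a solution of p k + k c = 1. *)
Lemma sylvester_star A B a b c I x y : I * (I * y%:q) = - y%:q ->
  a * c = 1 + y%:q * b - x%:q * a -> b * c = - (x%:q * b) - y%:q * a ->
  let X := (A * a - B * b) + I * (A * b + B * a) in
  (x%:q + I * y%:q) * X + X * c = A + I * B.
Proof.
move=> IIy ac bc; set X0 := A * a - B * b; set X1 := A * b + B * a.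
have E0 : x%:q * X0 - y%:q * X1 + X0 * c = A.
  rewrite /X0 /X1 mulrBl -!mulrA ac bc; apply: quatP => /=; ring.
have E1 : y%:q * X0 + x%:q * X1 + X1 * c = B.
  rewrite /X0 /X1 [X in _ + X]mulrDl -!mulrA ac bc; apply: quatP => /=; ring.
cbv zeta; rewrite -[in RHS]E0 -[in RHS]E1; clearbody X0 X1.
have -> : (x%:q + I * y%:q) * (X0 + I * X1) =
    x%:q * X0 - y%:q * X1 + I * (y%:q * X0 + x%:q * X1).
  rewrite mulrDl !mulrDr !mulrA -[I * y%:q * I]mulrA (qreal_comm y I) IIy mulNr.
  by rewrite (qreal_comm x I) [LHS](AC (2*2) ((1*4)*(3*2))) /=.
by rewrite mulrDl [in RHS]mulrDr -(mulrA I X1) [LHS](AC (2*2) ((1*3)*(2*4))) /=.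
Qed.

Lemma sylvester_star_r (a b C D p I : quat R) x y : I * (I * y%:q) = - y%:q ->
  p * a = 1 - a * x%:q - b * y%:q -> p * b = a * y%:q - b * x%:q ->
  let Y := (a * C - b * D) + (a * D + b * C) * I in
  p * Y + Y * (x%:q - I * y%:q) = C + D * I.
Proof.
move=> IIy pa pb; set Y0 := a * C - b * D; set Y1 := a * D + b * C.
have E0 : p * Y0 + (Y0 * x%:q + Y1 * y%:q) = C.
  rewrite /Y0 /Y1 mulrBr !mulrA pa pb; apply: quatP => /=; ring.
have E1 : p * Y1 + (Y1 * x%:q - Y0 * y%:q) = D.
  rewrite /Y0 /Y1 [X in X + _]mulrDr !mulrA pa pb; apply: quatP => /=; ring.
cbv zeta; rewrite -[in RHS]E0 -[in RHS]E1; clearbody Y0 Y1.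
have -> : (Y0 + Y1 * I) * (x%:q - I * y%:q) =
    Y0 * x%:q + Y1 * y%:q + (Y1 * x%:q - Y0 * y%:q) * I.
  rewrite mulrBr !mulrDl -[Y1 * I * (I * _)]mulrA IIy mulrN opprD opprK.
  rewrite mulNr -!mulrA (qreal_comm x I) (qreal_comm y I).
  by rewrite [LHS](AC (2*2) ((1*4)*(2*3))) /=.
by rewrite mulrDr [in RHS]mulrDl (mulrA p) [LHS](AC (2*2) ((1*3)*(2*4))) /=.
Qed.

Lemma mulmx_scalarE m n (X : 'M[quat R]_(m, n)) a i j : (X *m a%:M) i j = X i j * a.
Proof.
rewrite mxE (bigD1 j) //= big1 => [|k kj]; last by rewrite mxE (negbTE kj) mulr0n mulr0.
by rewrite !mxE eqxx mulr1n addr0.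
Qed.

Lemma mul_scalar_mxE m n (X : 'M[quat R]_(m, n)) a i j : (a%:M *m X) i j = a * X i j.
Proof. by rewrite mul_scalar_mx mxE. Qed.

Lemma slice_re_scalar n (k : quat R -> quat R) x y :
  slice_re (fun p => (k p)%:M : 'M[quat R]_n) x y =
  ((2^-1)%:q * (k (slice_pt (qi R) x y) + k (slice_pt (qi R) x (- y))))%:M.
Proof. by rewrite /slice_re -raddfD scale_scalar_mx. Qed.

Lemma slice_im_scalar n (k : quat R -> quat R) x y :
  slice_im (fun p => (k p)%:M : 'M[quat R]_n) x y =
  ((2^-1)%:q * - qi R * (k (slice_pt (qi R) x y) - k (slice_pt (qi R) x (- y))))%:M.
Proof. by rewrite /slice_im -raddfB scale_scalar_mx. Qed.

Lemma slice_im_r_scalar n (k : quat R -> quat R) x y :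
  slice_im_r (fun p => (k p)%:M : 'M[quat R]_n) x y =
  ((k (slice_pt (qi R) x y) - k (slice_pt (qi R) x (- y))) * ((2^-1)%:q * - qi R))%:M.
Proof. by rewrite /slice_im_r -raddfB -scalar_mxM. Qed.

Lemma hadj_slice_re n (Phi : quat R -> 'M[quat R]_n) x y i j :
  slice_re (fun q => hadj (Phi q)) x y i j = qconj (slice_re Phi x y j i).
Proof. by rewrite !mxE qconjM qconjD qconj_real qreal_comm. Qed.

Lemma hadj_slice_im n (Phi : quat R -> 'M[quat R]_n) x y i j :
  slice_im_r (fun q => hadj (Phi q)) x y i j = - qconj (slice_im Phi x y j i).
Proof.
rewrite /slice_im_r mulmx_scalarE !mxE qconjM qconjB -mulrN; congr (_ * _).
by apply: quatP => /=; ring.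
Qed.

(** The equation p k + k conj(q) = 1, star multiplied by Phi(p) on the left and by
    the adjoint of Phi(q) on the right, gives an equation for either summand of the
    kernel of Phi. *)
Lemma Phi_kernel_sylvester n (Phi : quat R -> 'M[quat R]_n) :
  (forall p, halfspace p -> Phi p = slice_re Phi (qRe p) (qnorm (qIm p)) +
     qdir p *: slice_im Phi (qRe p) (qnorm (qIm p))) ->
  forall p q, halfspace p -> halfspace q -> forall i j,
  p * Phi_kernel Phi p q i j + Phi_kernel Phi p q i j * qconj q =
  Phi p i j + qconj (Phi q j i).
Proof.
move=> PhiE p q p0 q0 i j.
rewrite /Phi_kernel mxE mulrDr mulrDl addrACA; congr (_ + _).
  have kc p' : qRe p' = qRe p -> p' * kker p' q + kker p' q * qconj q = 1.
    by move=> E; apply: kker_sylvester; rewrite ?E.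
  have [ac bc] := @sylvester_slice (fun p' => kker p' q) _ _ (qnorm (qIm p)) kc.
  have := sylvester_star (slice_re Phi (qRe p) (qnorm (qIm p)) i j)
    (slice_im Phi (qRe p) (qnorm (qIm p)) i j) (qdir_mul p) ac bc.
  rewrite -(qdirE p) [in RHS](PhiE p p0) => E.
  rewrite [RHS]mxE [X in _ = _ + X]mxE -E /star slice_re_scalar slice_im_scalar.
  by rewrite !(mulmx_scalarE, mxE).
have kc q' : qRe q' = qRe q -> p * kker p q' + kker p q' * qconj q' = 1.
  by move=> E; apply: kker_sylvester; rewrite ?E.
have [pa pb] := @sylvester_slice_r (kker p) _ _ (qnorm (qIm q)) kc.
have := sylvester_star_r (qconj (slice_re Phi (qRe q) (qnorm (qIm q)) j i))
  (- qconj (slice_im Phi (qRe q) (qnorm (qIm q)) j i)) (qdir_mul q) pa pb.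
have -> : (qRe q)%:q - qdir q * (qnorm (qIm q))%:q = qconj q.
  by rewrite [in RHS](qdirE q) qconjD qconj_real qconjM qconj_real qconj_qdir mulrN qreal_comm.
move=> E; rewrite [in RHS](PhiE q q0) [X in _ = qconj X]mxE [X in _ = qconj (_ + X)]mxE qconjD qconjM.
rewrite qconj_qdir mulrN -mulNr -E /star_r slice_re_scalar slice_im_r_scalar.
rewrite -hadj_slice_re -hadj_slice_im.
set G := slice_re _ _ _; set D := slice_im_r _ _ _.
by rewrite !(mulmx_scalarE, mul_scalar_mxE, mxE).
Qed.

End Kernel.

(** * Positivity and the star inverse *)

Section SliceSum.
Variable R : realType.
Variables (n : nat) (J : 'M[quat R]_n).
Implicit Types F : quat R -> 'M[quat R]_n.

Lemma slice_re_addl F x y : slice_re (fun p => J + F p) x y = J + slice_re F x y.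
Proof.
by rewrite /slice_re addrACA !scalerDr -scalerDl qhalf2 scale1r.
Qed.

Lemma slice_im_addl F x y : slice_im (fun p => J + F p) x y = slice_im F x y.
Proof. by rewrite /slice_im opprD addrACA subrr add0r. Qed.

Lemma slice_re_opp F x y : slice_re (fun p => - F p) x y = - slice_re F x y.
Proof. by rewrite /slice_re -opprD scalerN. Qed.

Lemma slice_im_opp F x y : slice_im (fun p => - F p) x y = - slice_im F x y.
Proof. by rewrite /slice_im -opprD scalerN. Qed.

Lemma slice_local (F G : quat R -> 'M[quat R]_n) x y : 0 < x ->
  (forall p, halfspace p -> F p = G p) ->
  slice_re F x y = slice_re G x y /\ slice_im F x y = slice_im G x y.
Proof.
move=> x0 FG; have H t : halfspace (slice_pt (qi R) x t).
  by rewrite /halfspace /mkset qRe_slice.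
by rewrite /slice_re /slice_im !FG.
Qed.

End SliceSum.

Section Positivity.
Variables (R : realType) (H : qHilbertType R).

Lemma gram_positive n (K : quat R -> quat R -> 'M[quat R]_n) (g : quat R -> 'I_n -> H) :
  (forall p q, halfspace p -> halfspace q -> forall i j, K p q i j = ip (g q j) (g p i)) ->
  positive_definite_kernel K.
Proof.
move=> KE N w c w0; pose G i := \sum_a g (w i) a ** c i a 0.
have ME i j : (hadj (c i) *m K (w i) (w j) *m c j) 0 0 = ip (G j) (G i).
  rewrite mxE /G ip_suml; apply: eq_bigr => b _.
  rewrite ip_rscale mxE ip_sumr mulr_suml [RHS]mulr_suml; apply: eq_bigr => a _.
  by rewrite ip_rscaler !mxE KE.
set M := \matrix_(i, j) _; have MijE i j : M i j = ip (G j) (G i) by rewrite mxE ME.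
clearbody M; split.
  by apply/matrixP => i j; rewrite [LHS]mxE [X in qconj X]mxE !MijE -ip_conj.
move=> v; suff -> : (hadj v *m M *m v) 0 0 = ip (\sum_i G i ** v i 0) (\sum_i G i ** v i 0).
  exact: ip_ge0.
rewrite mxE ip_suml; apply: eq_bigr => b _.
rewrite ip_rscale mxE ip_sumr mulr_suml [RHS]mulr_suml; apply: eq_bigr => a _.
by rewrite ip_rscaler MijE !mxE.
Qed.

(** The kernel of J + C * (p - T)^{- *} C^* is E(p) E(q)^*, where
    E(p)^* delta_i = g_i(p) solves T g + g conj(p) = C^* delta_i: both sides solve
    the same Sylvester equation. *)
Lemma resolvent_positive n (T : H -> H) (d : 'I_n -> H) (J : 'M[quat R]_n)
  (Phi : quat R -> 'M[quat R]_n) : skew_op T -> hadj J = - J ->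
  (forall p, halfspace p -> Phi p = J + resolvent_mx T d d p) ->
  positive_function Phi.
Proof.
move=> Ts Jadj PhiE; apply: (@gram_positive _ _ (fun p i => rsol T (d i) (qconj p))).
move=> p q p0 q0 i j.
apply: (@sylvester_inj R p (qconj q)) => //.
rewrite Phi_kernel_sylvester //; last first.
  move=> p' p'0; have [re im] := slice_local (qnorm (qIm p')) p'0 PhiE.
  rewrite re im slice_re_addl slice_im_addl PhiE // -addrA.
  have [a [b [_ _ _ E]]] := resolvent_mx_slice Ts d d (qnorm (qIm p')) p'0.
  by rewrite -E.
have pc0 : 0 < qRe (qconj p) by [].
have qc0 : 0 < qRe (qconj q) by [].
rewrite !PhiE // !mxE; set g := rsol T (d i) (qconj p); set h := rsol T (d j) (qconj q).
have Ep : T g + g ** qconj p = d i by exact: rsolP.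
have Eh : T h + h ** qconj q = d j by exact: rsolP.
have Jij : J i j = - qconj (J j i).
  by move/matrixP/(_ i j): Jadj; rewrite !mxE => ->; rewrite opprK.
have [_ _ _ Tskew] := Ts.
rewrite -[in LHS]Ep -[in LHS]Eh qconjD -ip_conj Jij.
rewrite addrACA addNr add0r ipDl ipDr ip_rscale ip_rscaler qconjK Tskew.
by rewrite addrACA addNr add0r addrC.
Qed.

End Positivity.

Section ResolventIdentity.
Variables (R : realType) (H : qHilbertType R) (n : nat).
Variables (T1 T2 : H -> H) (d1 e1 d2 e2 : 'I_n -> H) (J : 'M[quat R]_n) (s : R).
Hypotheses (T1s : skew_op T1) (T2s : skew_op T2).
Hypothesis rank_n : forall w, \sum_c d1 c ** ip w (e2 c) = (T2 w - T1 w) ** s%:q.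
Hypothesis Jl : forall i, \sum_c e2 c ** qconj (J i c) = - (e1 i ** s%:q).
Hypothesis Jr : forall j, \sum_c d1 c ** J c j = d2 j ** s%:q.

Lemma pair_solutionE (T : H -> H) x y (e a b : H) : pair_solution T x y e a b ->
  T a = e - a ** x%:q + b ** y%:q /\ T b = - (b ** x%:q) - a ** y%:q.
Proof.
move=> [<- /eqP]; rewrite -addrA addr_eq0 opprD => /eqP ->; split=> //.
by rewrite [_ - a ** _]addrAC addrK subrK.
Qed.

Lemma ip_realC (u v : H) (x : R) : ip (u ** x%:q) v = ip u (v ** x%:q).
Proof. by rewrite ip_rscale ip_rscaler qconj_real qreal_comm. Qed.

(** The adjoint of x + i y - T, in the complexification where i is a central unit
    fixed by the adjunction, is x + i y + T; in components this moves the resolvent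
    from one side of the inner product to the other. *)
Lemma pair_solution_dual (T : H -> H) x y (d e a b h1 h2 : H) : skew_op T ->
  pair_solution T x y e a b -> pair_solution (fun u => - T u) x y d h1 h2 ->
  ip d a = ip h1 e /\ ip d b = ip h2 e.
Proof.
move=> [_ _ _ Ts] /pair_solutionE[Ta Tb] [<- F2].
have Th : T h2 = h2 ** x%:q + h1 ** y%:q.
  by move/eqP: F2; rewrite -addrA addrC subr_eq0 => /eqP.
have Ka : ip (T h2) a = - ip h2 (T a) by exact: Ts.
have Kb : ip (T h2) b = - ip h2 (T b) by exact: Ts.
rewrite Ta Th ipDl !ip_realC ipDr ipBr in Ka.
rewrite Tb Th ipDl !ip_realC ipBr ipNr opprD !opprK in Kb.
move/addrI in Kb.
rewrite !ipBl !ipDl !ipNl !Ts !opprK !ip_realC Ta Tb !(ipDr, ipNr) Kb.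
split; first by apply: quatP => /=; ring.
have -> : ip h1 (a ** y%:q) = (ip h2 (a ** x%:q) + ip h1 (a ** y%:q)) - ip h2 (a ** x%:q).
  by rewrite addrAC subrr add0r.
by rewrite Ka; apply: quatP => /=; ring.
Qed.

Let entry_sumB (M1 M2 M3 M4 : 'M[quat R]_n) i j :
  (M1 + M2 + (M3 - M4)) i j = M1 i j + M2 i j + (M3 i j - M4 i j).
Proof. by rewrite !mxE. Qed.
Let entry_sumD (M1 M2 M3 M4 : 'M[quat R]_n) i j :
  (M1 + M2 + (M3 + M4)) i j = M1 i j + M2 i j + (M3 i j + M4 i j).
Proof. by rewrite !mxE. Qed.

(** The resolvent identity (z - T1)^-1 - (z - T2)^-1 = (z - T1)^-1 (T1 - T2)
    (z - T2)^-1 with z = x + i y, tested against the given vectors and split into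
    its two slice components.  The sign s allows for both orders of the two operators. *)
Lemma resolvent_identity_slice x y : 0 < x ->
  let A := slice_re (resolvent_mx T1 d1 e1) x y in
  let B := slice_im (resolvent_mx T1 d1 e1) x y in
  let C := slice_re (resolvent_mx T2 d2 e2) x y in
  let D := slice_im (resolvent_mx T2 d2 e2) x y in
  J *m C + A *m J + (A *m C - B *m D) = 0 /\
  J *m D + B *m J + (A *m D + B *m C) = 0.
Proof.
move=> x0; have [a1 [b1 [P1 -> -> _]]] := resolvent_mx_slice T1s d1 e1 y x0.
have [a2 [b2 [P2 -> -> _]]] := resolvent_mx_slice T2s d2 e2 y x0.
have [h1 [h2 [P3 _ _ _]]] := resolvent_mx_slice (skew_opN T2s) d2 d2 y x0.
cbv zeta.
have [_ _ _ S1] := T1s; have [_ _ _ S2] := T2s.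
have dual c j := pair_solution_dual T2s (P2 c) (P3 j).
have s_mid (u v : H) : ip (u ** s%:q) v = s%:q * ip u v.
  by rewrite ip_rscale qreal_comm.
have JC (h : 'I_n -> H) i j : (J *m \matrix_(k, l) ip (h l) (e2 k)) i j
    = - (s%:q * ip (h j) (e1 i)).
  rewrite mxE; transitivity (ip (h j) (\sum_c e2 c ** qconj (J i c))).
    by rewrite ip_sumr; apply: eq_bigr => c _; rewrite mxE ip_rscaler qconjK.
  by rewrite Jl ipNr ip_rscaler qconj_real.
have AJ (a : 'I_n -> H) i j : ((\matrix_(k, l) ip (d1 l) (a k)) *m J) i j
    = s%:q * ip (d2 j) (a i).
  rewrite mxE; transitivity (ip (\sum_c d1 c ** J c j) (a i)).
    by rewrite ip_suml; apply: eq_bigr => c _; rewrite mxE ip_rscale.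
  by rewrite Jr s_mid.
have AC (a h : 'I_n -> H) i j : ((\matrix_(k, l) ip (d1 l) (a k)) *m
    (\matrix_(k, l) ip (h l) (e2 k))) i j = s%:q * ip (T2 (h j) - T1 (h j)) (a i).
  rewrite mxE -s_mid -rank_n ip_suml; apply: eq_bigr => c _.
  by rewrite !mxE ip_rscale.
have CE : \matrix_(i, j) ip (d2 j) (a2 i) = \matrix_(i, j) ip (h1 j) (e2 i).
  by apply/matrixP => i j; rewrite !mxE (dual i j).1.
have DE : \matrix_(i, j) ip (d2 j) (b2 i) = \matrix_(i, j) ip (h2 j) (e2 i).
  by apply/matrixP => i j; rewrite !mxE (dual i j).2.
have T1E i := pair_solutionE (P1 i).
have T2E j : T2 (h1 j) = h1 j ** x%:q - h2 j ** y%:q - d2 j /\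
    T2 (h2 j) = h2 j ** x%:q + h1 j ** y%:q.
  have [F1 F2] := pair_solutionE (P3 j).
  rewrite -[T2 (h1 j)]opprK -[T2 (h2 j)]opprK F1 F2 !opprD !opprK; split=> //.
  by rewrite -addrA addrC.
have S1' u v : ip (T2 u - T1 u) v = ip (T2 u) v + ip u (T1 v).
  by rewrite ipBl S1 opprK.
rewrite CE DE; split; apply/matrixP => i j; rewrite [RHS]mxE.
  rewrite entry_sumB JC AJ !AC !S1' (T1E i).1 (T1E i).2 (T2E j).1 (T2E j).2.
  rewrite !(ipDl, ipDr, ipNl, ipNr) !ip_realC.
  by apply: quatP => /=; ring.
rewrite entry_sumD JC AJ !AC !S1' (T1E i).1 (T1E i).2 (T2E j).1 (T2E j).2.
rewrite !(ipDl, ipDr, ipNl, ipNr) !ip_realC.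
by apply: quatP => /=; ring.
Qed.

End ResolventIdentity.

(** * The realization *)

Section Columns.
Variables (R : realType) (n : nat).
Implicit Types (u v : hvec R n) (A B : 'M[quat R]_n).

Definition hdelta (j : 'I_n) : hvec R n := (delta_mx j 0 : 'cV[(quat R)^c]_n).
Definition hcoord (u : hvec R n) (i : 'I_n) : quat R := (u : 'cV[quat R]_n) i 0.

Lemma hvecP u v : (forall i, hcoord u i = hcoord v i) -> u = v.
Proof. by move=> uv; apply/matrixP => i j; rewrite ord1; exact: uv. Qed.

Lemma hcoordD u v i : hcoord (u + v) i = hcoord u i + hcoord v i.
Proof. by rewrite /hcoord mxE. Qed.
Lemma hcoordN u i : hcoord (- u) i = - hcoord u i.
Proof. by rewrite /hcoord mxE. Qed.
Lemma hcoordZ u a i : hcoord (u ** a) i = hcoord u i * a.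
Proof. by rewrite /hcoord mxE. Qed.
Lemma hcoord_sum (f : 'I_n -> hvec R n) i : hcoord (\sum_c f c) i = \sum_c hcoord (f c) i.
Proof.
apply: (big_morph (fun u => hcoord u i)) => [u v|]; first exact: hcoordD.
by rewrite /hcoord mxE.
Qed.
Lemma hcoord_delta i j : hcoord (hdelta j) i = (i == j)%:R.
Proof. by rewrite /hcoord mxE andbT. Qed.
Lemma hcoord_mxop A u i : hcoord (mxop A u) i = \sum_k A i k * hcoord u k.
Proof. by rewrite /hcoord /mxop mxE. Qed.
Lemma hcoord_mxop_delta A i j : hcoord (mxop A (hdelta j)) i = A i j.
Proof.
rewrite hcoord_mxop (bigD1 j) //= big1 => [|k /negbTE kj].
  by rewrite hcoord_delta eqxx mulr1 addr0.
by rewrite hcoord_delta kj mulr0.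
Qed.

Lemma mxopD A u v : mxop A (u + v) = mxop A u + mxop A v.
Proof.
apply: hvecP => i; rewrite hcoordD !hcoord_mxop -big_split; apply: eq_bigr => k _.
by rewrite hcoordD mulrDr.
Qed.
Lemma mxopZ A u a : mxop A (u ** a) = mxop A u ** a.
Proof.
apply: hvecP => i; rewrite hcoordZ !hcoord_mxop mulr_suml; apply: eq_bigr => k _.
by rewrite hcoordZ mulrA.
Qed.
Lemma mxopM A B u : mxop A (mxop B u) = mxop (A *m B) u.
Proof. exact: (@mulmxA (quat R) n n n 1 A B u). Qed.
Lemma mxopN1 u : mxop (- 1%:M) u = - u.
Proof.
apply: hvecP => i; rewrite hcoordN hcoord_mxop (bigD1 i) //= big1 => [|k ki].
  by rewrite !mxE eqxx mulr1n mulN1r addr0.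
by rewrite !mxE eq_sym (negbTE ki) oppr0 mul0r.
Qed.

Lemma ip_hdelta u i : ip u (hdelta i) = hcoord u i.
Proof.
rewrite -[LHS]/(hvec_ip u (hdelta i)) /hvec_ip (bigD1 i) //= big1 => [|k /negbTE ki].
  rewrite -/(hcoord (hdelta i) i) hcoord_delta eqxx addr0 -[true%:R]qreal1 qconj_real.
  exact: mul1r.
by rewrite -/(hcoord (hdelta i) k) hcoord_delta ki qconj0 mul0r.
Qed.

Lemma ip_mxop A u v : ip (mxop A u) v = ip u (mxop (hadj A) v).
Proof.
rewrite -[LHS]/(hvec_ip _ _) -[RHS]/(hvec_ip _ _) /hvec_ip.
transitivity (\sum_i \sum_k qconj (hcoord v i) * (A i k * hcoord u k)).
  by apply: eq_bigr => i _; rewrite -/(hcoord (mxop A u) i) hcoord_mxop mulr_sumr.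
rewrite exchange_big; apply: eq_bigr => k _.
rewrite -/(hcoord (mxop (hadj A) v) k) hcoord_mxop qconj_sum mulr_suml; apply: eq_bigr => i _.
by rewrite !mxE qconjM qconjK mulrA.
Qed.

Lemma hvec_expand (H : qHilbertType R) (B : hvec R n -> H) x :
  {morph B : u v / u + v} -> (forall u a, B (u ** a) = B u ** a) ->
  \sum_c B (hdelta c) ** hcoord x c = B x.
Proof.
move=> BD BZ; have B0 : B 0 = 0 by apply: (addrI (B 0)); rewrite -BD !addr0.
have -> : B x = B (\sum_c hdelta c ** hcoord x c).
  congr B; apply: hvecP => i; rewrite hcoord_sum (bigD1 i) //= big1 => [|k ki].
    by rewrite hcoordZ hcoord_delta eqxx mul1r addr0.
  by rewrite hcoordZ hcoord_delta eq_sym (negbTE ki) mul0r.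
by rewrite (big_morph B BD B0); apply: eq_bigr => c _; rewrite BZ.
Qed.

End Columns.

Section Adjoint.
Variables (R : realType) (H : qHilbertType R) (n : nat).
Variables (Tp Tm : {linear H -> H}) (J : 'M[quat R]_n) (C : {linear H -> hvec R n}).

(** If C had no adjoint, its chosen adjoint would be 0; then T_+ = T_-, the rank n
    is 0, and C maps to the zero space, where 0 is an adjoint. *)
Lemma adjoint_of_rank : has_rank (fun u => Tp u - Tm u) n ->
  (forall u : H, Tp u - Tm u = - adjoint C (mxop J (C u))) ->
  forall u v, ip (C u) v = ip u (adjoint C v).
Proof.
move=> [e [eR eI]]; rewrite /adjoint; case: xgetP => [S _ //|no E].
have n0 : ('I_n -> False).
  move=> i; have : [set v | exists c : 'I_n -> (quat R)^c, v = \sum_i c i *: e i] (e i).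
    exists (fun j => (j == i)%:R); rewrite (bigD1 i) //= big1 => [|j /negbTE ji].
      by rewrite eqxx scale1r addr0.
    by rewrite ji scale0r.
  rewrite -eR => -[u _]; rewrite E oppr0 => ei.
  have := eI (fun j => (j == i)%:R); rewrite (bigD1 i) //= big1 => [|j /negbTE ji].
    rewrite -ei scaler0 addr0 => /(_ erefl i) /eqP.
    by rewrite eqxx oner_eq0.
  by rewrite ji scale0r.
exfalso; apply: (no (fun=> 0)) => u v; rewrite ip0r.
by rewrite -[LHS]/(hvec_ip _ _) /hvec_ip big1 // => i; case: (n0 i).
Qed.

Hypothesis Cadj : forall u v, ip (C u) v = ip u (adjoint C v).

Let ip_inj (v w : H) : (forall u, ip u v = ip u w) -> v = w.
Proof.
move=> vw; apply/eqP; rewrite -subr_eq0; apply/eqP/ip_eq0.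
by rewrite ipBr vw subrr.
Qed.

Lemma adjointD : {morph adjoint C : u v / u + v}.
Proof. by move=> u v; apply: ip_inj => w; rewrite ipDr -!Cadj ipDr. Qed.

Lemma adjointZ u a : adjoint C (u ** a) = adjoint C u ** a.
Proof. by apply: ip_inj => w; rewrite ip_rscaler -!Cadj ip_rscaler. Qed.

Lemma adjointN u : adjoint C (- u) = - adjoint C u.
Proof. by apply: ip_inj => w; rewrite ipNr -!Cadj ipNr. Qed.

Lemma hcoord_mxop_adjoint (A : 'M[quat R]_n) u i :
  hcoord (mxop A (C u)) i = ip u (adjoint C (mxop (hadj A) (hdelta R i))).
Proof. by rewrite -Cadj -ip_mxop ip_hdelta. Qed.

Lemma hcoord_adjoint u i : hcoord (C u) i = ip u (adjoint C (hdelta R i)).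
Proof. by rewrite -Cadj ip_hdelta. Qed.

Lemma adjoint_expand (A : 'M[quat R]_n) (x : hvec R n) (f : 'I_n -> quat R) :
  (forall c, f c = hcoord x c) ->
  \sum_c adjoint C (mxop A (hdelta R c)) ** f c = adjoint C (mxop A x).
Proof.
move=> fx; rewrite (eq_bigr (fun c => adjoint C (mxop A (hdelta R c)) ** hcoord x c)).
  apply: (@hvec_expand _ _ _ (fun x => adjoint C (mxop A x))) => [u v|u a].
    by rewrite mxopD adjointD.
  by rewrite mxopZ adjointZ.
by move=> c _; rewrite fx.
Qed.

End Adjoint.

(** In the star product of J + F and - J - G the constant term is - J^2 = 1, and
    the rest is the combination that the resolvent identity makes zero. *)
Lemma star_unit (R : realType) n (J A B C D : 'M[quat R]_n) (I : quat R) :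
  J *m J = - 1%:M ->
  J *m C + A *m J + (A *m C - B *m D) = 0 ->
  J *m D + B *m J + (A *m D + B *m C) = 0 ->
  ((J + A) *m (- J - C) - B *m (- D)) + I *: ((J + A) *m (- D) + B *m (- J - C)) = 1%:M.
Proof.
move=> JJ E1 E2.
have -> : (J + A) *m (- J - C) - B *m (- D) =
    1%:M - (J *m C + A *m J + (A *m C - B *m D)).
  rewrite mulmxBr !mulmxN mulmxDl JJ opprK [(J + A) *m C]mulmxDl.
  rewrite !opprD !opprK !addrA.
  by rewrite [LHS](AC 5 (1*3*2*4*5)) /=.
have -> : (J + A) *m (- D) + B *m (- J - C) =
    - (J *m D + B *m J + (A *m D + B *m C)).
  rewrite mulmxBr !mulmxN mulmxDl !opprD !addrA.
  by rewrite [LHS](AC 4 (1*3*2*4)) /=.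
by rewrite E1 E2 subr0 oppr0 scaler0 addr0.
Qed.

Lemma star_unit_opp (R : realType) n (J A B C D : 'M[quat R]_n) (I : quat R) :
  J *m J = - 1%:M ->
  J *m C + A *m J + (A *m C - B *m D) = 0 ->
  J *m D + B *m J + (A *m D + B *m C) = 0 ->
  ((- J - A) *m (J + C) - (- B) *m D) + I *: ((- J - A) *m D + (- B) *m (J + C)) = 1%:M.
Proof.
move=> JJ E1 E2; rewrite -[RHS](star_unit I JJ E1 E2).
by rewrite -![- J - _]opprD !mulNmx !mulmxN.
Qed.

Theorem theorem8p9 (R : realType) (H : qHilbertType R) (n : nat)
  (Tp Tm : {linear H -> H}) (J : 'M[quat R]_n) (C : {linear H -> hvec R n})
  (Tp_bounded : bounded_op Tp) (Tm_bounded : bounded_op Tm)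
  (Tp_asa : anti_self_adjoint Tp) (Tm_asa : anti_self_adjoint Tm)
  (rank_n : has_rank (fun u => Tp u - Tm u) n)
  (J_sqr : J *m J = - 1%:M) (J_adj : hadj J = - J)
  (C_bounded : bounded_op C)
  (TpTm : forall u : H, Tp u - Tm u = - adjoint C (mxop J (C u))) :
  let Phi := fun p => J + star_resolvent C Tp (adjoint C) p in
  let Psi := fun p =>
    - J - star_resolvent (mxop J \o C) Tm (adjoint C \o mxop J) p in
  positive_function Phi /\ star_inverse Phi Psi.
Proof.
have Cadj := adjoint_of_rank rank_n TpTm.
have Tps := anti_self_adjoint_skew Tp_bounded Tp_asa.
have Tms := anti_self_adjoint_skew Tm_bounded Tm_asa.
pose d i := adjoint C (hdelta R i).
pose d' i := adjoint C (mxop J (hdelta R i)).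
pose e' i := adjoint C (mxop (hadj J) (hdelta R i)).
have [Fh FE] := @star_resolventE R H n n C Tp (adjoint C) d Tps (hcoord_adjoint Cadj).
have [Gh GE] := @star_resolventE R H n n (mxop J \o C) Tm (adjoint C \o mxop J) e' Tms
  (hcoord_mxop_adjoint Cadj J).
move=> Phi Psi; set F := resolvent_mx Tp d d in FE; set G := resolvent_mx Tm d' e' in GE.
have PhiE p : halfspace p -> Phi p = J + F p by move=> p0; rewrite /Phi FE.
have PsiE p : halfspace p -> Psi p = - J + - G p by move=> p0; rewrite /Psi GE.
split; first exact: resolvent_positive Tps J_adj PhiE.
have JJ (v : hvec R n) : mxop J (mxop J v) = - v by rewrite mxopM J_sqr mxopN1.
have mxop1 (v : hvec R n) : mxop 1%:M v = v by exact: (@mul1mx (quat R) n 1 v).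
have d1E i : d i = adjoint C (mxop 1%:M (hdelta R i)) by rewrite mxop1.
split; last split.
- have -> : Phi = (fun p => J + 1%:q *: star_resolvent C Tp (adjoint C) p).
    by apply/funext => p; rewrite scale1r.
  exact: hyperholomorphic_affine.
- have -> : Psi = (fun p => - J + (-1)%:q *:
      star_resolvent (mxop J \o C) Tm (adjoint C \o mxop J) p).
    by apply/funext => p; rewrite qrealN scaleN1r.
  exact: hyperholomorphic_affine.
move=> p p0; rewrite /star; set x := qRe p; set y := qnorm (qIm p).
have [rPhi iPhi] := slice_local y p0 PhiE; have [rPsi iPsi] := slice_local y p0 PsiE.
rewrite -/x in rPhi iPhi rPsi iPsi.
rewrite rPhi iPhi rPsi iPsi !slice_re_addl !slice_im_addl slice_re_opp slice_im_opp.
split.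
  have [E1 E2] : J *m slice_re G x y + slice_re F x y *m J +
      (slice_re F x y *m slice_re G x y - slice_im F x y *m slice_im G x y) = 0 /\
    J *m slice_im G x y + slice_im F x y *m J +
      (slice_re F x y *m slice_im G x y + slice_im F x y *m slice_re G x y) = 0.
    apply: (@resolvent_identity_slice R H n Tp Tm d d d' e' J 1) => // [w|i|j].
    - rewrite (eq_bigr (fun c => adjoint C (mxop 1%:M (hdelta R c)) ** ip w (e' c))).
        rewrite (adjoint_expand Cadj _ (x := mxop J (C w))).
          by rewrite mxop1 rscale1 -opprB TpTm opprK.
        by move=> c; rewrite hcoord_mxop_adjoint.
      by move=> c _; rewrite d1E.
    - rewrite (adjoint_expand Cadj _ (x := mxop (hadj J) (hdelta R i))).
        by rewrite J_adj mxopM mulNmx mulmxN opprK J_sqr mxopN1 adjointN // rscale1.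
      by move=> c; rewrite hcoord_mxop_delta !mxE.
    rewrite (eq_bigr (fun c => adjoint C (mxop 1%:M (hdelta R c)) ** J c j)).
      rewrite (adjoint_expand Cadj _ (x := mxop J (hdelta R j))).
        by rewrite mxop1 rscale1.
      by move=> c; rewrite hcoord_mxop_delta.
    by move=> c _; rewrite d1E.
  exact: star_unit.
have [E1 E2] : J *m slice_re F x y + slice_re G x y *m J +
      (slice_re G x y *m slice_re F x y - slice_im G x y *m slice_im F x y) = 0 /\
    J *m slice_im F x y + slice_im G x y *m J +
      (slice_re G x y *m slice_im F x y + slice_im G x y *m slice_re F x y) = 0.
  apply: (@resolvent_identity_slice R H n Tm Tp d' e' d d J (-1)) => // [w|i|j].
  - rewrite (adjoint_expand Cadj _ (x := C w)).
      by rewrite qrealN rscaleNr rscale1 TpTm opprK.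
    by move=> c; rewrite hcoord_adjoint.
  - rewrite (eq_bigr (fun c => adjoint C (mxop 1%:M (hdelta R c)) ** qconj (J i c))).
      rewrite (adjoint_expand Cadj _ (x := mxop (hadj J) (hdelta R i))).
        by rewrite mxop1 qrealN rscaleNr rscale1 opprK.
      by move=> c; rewrite hcoord_mxop_delta !mxE.
    by move=> c _; rewrite d1E.
  rewrite (adjoint_expand Cadj _ (x := mxop J (hdelta R j))).
    by rewrite JJ adjointN // qrealN rscaleNr rscale1.
  by move=> c; rewrite hcoord_mxop_delta.
exact: star_unit_opp.
Qed.
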